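(* Assume (C1)–(C3). Then $\mathbf C^{\mathcal T}$ is stable under left twisted convolution by $\overline{\mathbf S}^{\mathrm{BLM}}$, and, identifying $B\wr\mathcal H(d)$ with $\mathbf H_d^{\mathcal T}$ via $\Phi$, $$\operatorname{End}_{\overline{\mathbf S}^{\mathrm{BLM}}}(\mathbf C^{\mathcal T})=B\wr\mathcal H(d),\qquad \operatorname{End}_{B\wr\mathcal H(d)}(\mathbf C^{\mathcal T})=\overline{\mathbf S}^{\mathrm{BLM}}.$$ Moreover $B\wr\mathcal H(d)=1_\omega*\overline{\mathbf S}^{\mathrm{BLM}}*1_\omega$, where $1_\omega(x,x')=\delta_{x,x'}e(x)$.
   Context: $\Bbbk$ field, $F$ unital finite-dimensional $\Bbbk$-algebra, $B=F[x]$ or $F[x^{\pm1}]$, $d\ge2$; $B^{\otimes m}\cong F^{\otimes m}[x_1,\dots,x_m]$ (or Laurent). $\sigma$ = flip. For $Y\in B\otimes B$, $i\ne j$: $Y_{ij}$ = $Y$ with first factor in slot $i$, second in slot $j$; $Y_i=Y_{i,i+1}$; $\phi_i$ = $\phi$ on slots $i,i+1$. Weak Frobenius: $\Delta\in F\otimes F$ with $(a\otimes b)\Delta=\Delta(b\otimes a)$; $W(F)^{\mathfrak S_2}$: those with $\sigma(\Delta)=\Delta$. $\partial^\beta(f)=(\beta f-\sigma(f)\beta)/(x_1-x_2)$. $B\wr\mathcal H(d)$: generated by $B^{\otimes d}$ and $H_1,\dots,H_{d-1}$ with braid relations, $H_i^2=S_iH_i+R_i$, $H_ib=\sigma_i(b)H_i+\rho_i(b)$;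 polynomial type: $R\in F\otimes F$ central, $\sigma(R)=R$; $\beta=\sum_{i,j\in\{0,1\}}\Delta^{ij}x_1^ix_2^j$, $\Delta^{ij}\in W(F)^{\mathfrak S_2}$, $(\Delta^{00}\otimes1)(1\otimes\Delta^{11})=(\Delta^{01}\otimes1)(1\otimes\Delta^{10})$; $\sigma$ flip, $\rho=\partial^\beta$, $S=\Delta^{10}-\Delta^{01}$. (C1) $\alpha\in F\otimes F$, $\alpha\bar\alpha=R$, $\bar\alpha=\sigma(\alpha)+S$; (C2) $\alpha$, all $\Delta^{ij}$ central; (C3) $P:=\alpha(x_1-x_2)+\beta$ not a zero divisor. $\mathcal R=F^{\otimes d}\otimes_\Bbbk\Bbbk(x_1,\dots,x_d)$, place-permutation action ($g$ moves slot $i$ to $g(i)$, $x_i\mapsto x_{g(i)}$); $P_{ij},x_i-x_j$ invertible. $\Lambda$ = compositions of $d$ with positive parts, $\omega=(1^d)$, $G=\mathfrak S_d$, $Y_\lambda=\mathfrak S_d/\mathfrak S_\lambda$, $Y=\bigsqcup Y_\lambda$, $X=Y_\omega=\mathfrak S_d$; for $\nu$ refining $\lambda$, $p_{\nu\lambda}:Y_\nu\to Y_\lambda$ projection; $p_\lambda=p_{\omega\lambda}$. $N_\lambda=\bigcup_k\{(i,j):i\le\lambda_1+\dots+\lambda_k<j\}$, $P_\lambda=\{(i,j):i\ne j\}\setminus N_\lambda$, $e_\lambda=\prod_{N_\lambda}(x_i-x_j)\prod_{P_\lambda}P_{ij}$, twist $e([g])=g(e_\lambda)$. $\mathbf S_d=\mathcal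 R_G(Y\times Y)$ ($G$-equivariant functions) with $(f*g)(x,y)=\sum_zf(x,z)e(z)^{-1}g(z,y)$; $\mathbf H_d=\mathcal R_G(X\times X)$; $\xi_{g,r}(x,y)=\delta_{y,xg}e(x)x(r)$. $S_{\nu\lambda}(y,y')=\delta_{p_{\nu\lambda}(y),y'}e(y')$, $M_{\lambda\nu}(y',y)=\delta_{y',p_{\nu\lambda}(y)}e(y')$; $S_\lambda=S_{\omega\lambda}$, $M_\lambda=M_{\lambda\omega}$, $K_\lambda=S_\lambda*M_\lambda$; for $t\in(B^{\otimes d})^{\mathfrak S_\lambda}$, $t_\lambda(y,y')=\delta_{y,y'}e(y)g(t)$, $y=[g]$. $\mathbf H^{\mathcal T}_d\subseteq\mathbf H_d$: generated by all $K_\lambda$ and $\xi_{1,t}$ ($t\in B^{\otimes d}$); $\Phi:B\wr\mathcal H(d)\to\mathbf H^{\mathcal T}_d$ is the algebra isomorphism $b\mapsto\xi_{1,b}$, $H_i\mapsto\xi_{1,\beta_i/(x_i-x_{i+1})}+\xi_{s_i,P_{i,i+1}/(x_i-x_{i+1})}$. Laurel Schur algebra $\overline{\mathbf S}^{\mathrm{BLM}}\subseteq\mathbf S_d$: generated by all $S_{\nu\lambda},M_{\lambda\nu}$ ($\nu$ refining $\lambda$) and all $t_\lambda$. $\mathbf C^{\mathcal T}=\bigoplus_{\lambda\in\Lambda}M_\lambda*\mathbf H^{\mathcal T}_d\subseteq\bigoplus_\lambda\mathcal R_G(Y_\lambda\times X)$, a right $\mathbf H^{\mathcal T}_d$-module.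 *)

(* Defs.v *)
From HB Require Import structures.
From mathcomp Require Import all_boot all_order all_algebra all_fingroup all_field.
From mathcomp Require Import mpoly.
From Stdlib Require Import ClassicalEpsilon.

Set Implicit Arguments.
Unset Strict Implicit.
Unset Printing Implicit Defensive.

Import GRing.Theory.
Local Open Scope ring_scope.

(* Tensor powers  F^{(x)m} (x)_k k(x_1,...,x_m), via the basis of F.        *)
(* An element is the family of its coordinates on the pure tensors           *)
(*   b_{a 0} (x) ... (x) b_{a (m-1)}  of basis vectors of F.                 *)
Section Tensor.
Variables (k : fieldType) (F : falgType k).

Definition NF := \dim (fullv : {vspace F}).
Definition basF : NF.-tuple F := vbasis fullv.
Definition gam (a b c : 'I_NF) : k := coord basF c (tnth basF a * tnth basF b).
Definition unitc (c : 'I_NF) : k := coord basF c 1.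

Definition Kf (m : nat) := {fraction {mpoly k[m]}}.
Definition tofracK (m : nat) (p : {mpoly k[m]}) : Kf m := @FracField.tofrac _ p.
Definition cstK (m : nat) (c : k) : Kf m := tofracK (c%:MP).
Definition varK (m : nat) (i : 'I_m) : Kf m := tofracK 'X_i.

(* R_m = F^{(x)m} (x) k(x_1..x_m) *)
Definition Rt (m : nat) := {ffun {ffun 'I_m -> 'I_NF} -> Kf m}.

Definition mulR (m : nat) (f g : Rt m) : Rt m :=
  [ffun c : {ffun 'I_m -> 'I_NF} => \sum_(a : {ffun 'I_m -> 'I_NF}) \sum_(b : {ffun 'I_m -> 'I_NF})
     f a * g b * cstK m (\prod_(i < m) gam (a i) (b i) (c i))].
Definition oneR (m : nat) : Rt m := [ffun c : {ffun 'I_m -> 'I_NF} => cstK m (\prod_(i < m) unitc (c i))].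
Definition sclR (m : nat) (c : Kf m) (f : Rt m) : Rt m := [ffun a : {ffun 'I_m -> 'I_NF} => c * f a].

Definition renP (m n : nat) (h : 'I_m -> 'I_n) (p : {mpoly k[m]}) : {mpoly k[n]} :=
  mmap (@mpolyC n k) (fun i => 'X_(h i)) p.
Definition renK (m n : nat) (h : 'I_m -> 'I_n) (x : Kf m) : Kf n :=
  tofracK (renP h (\n_(@repr_of _ _ x))) / tofracK (renP h (\d_(@repr_of _ _ x))).

(* Y |-> Y_h : the tensor factor in slot i of F^{(x)m} is put in slot h i of
   F^{(x)n} (h injective), 1 in the other slots, and x_i |-> x_{h i}.
   For m = n and h = g a permutation, this is the place-permutation action. *)
Definition emb (m n : nat) (h : 'I_m -> 'I_n) (f : Rt m) : Rt n :=
  [ffun a : {ffun 'I_n -> 'I_NF} =>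
     renK h (f [ffun i => a (h i)]) *
     cstK n (\prod_(j < n | ~~ [exists i, h i == j]) unitc (a j))].

Definition act (d : nat) (g : 'S_d) (f : Rt d) : Rt d := emb (fun i => g i) f.

Definition isF (m : nat) (f : Rt m) : Prop := forall a, exists c : k, f a = cstK m c.
(* elements of B^{(x)m}: coefficients in k[x] (resp. k[x^{+-1}] if laurent) *)
Definition isBcoef (laurent : bool) (m : nat) (c : Kf m) : Prop :=
  exists (p : {mpoly k[m]}) (N : nat), (laurent \/ N = 0%N) /\
     c = tofracK p / tofracK ((\prod_(i < m) 'X_i) ^+ N).
Definition isB (laurent : bool) (m : nat) (f : Rt m) : Prop :=
  forall a, isBcoef laurent (f a).

Definition i0 : 'I_2 := ord0.
Definition i1 : 'I_2 := @Ordinal 2 1 isT.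
Definition swap2 (i : 'I_2) : 'I_2 := if i == i0 then i1 else i0.
Definition flip (f : Rt 2) : Rt 2 := emb swap2 f.
Definition pure2 (a b : F) : Rt 2 :=
  [ffun c : {ffun 'I_2 -> 'I_NF} => cstK 2 (coord basF (c i0) a * coord basF (c i1) b)].
Definition centralF2 (f : Rt 2) : Prop :=
  forall y, isF y -> mulR y f = mulR f y.
Definition weakFrob (D : Rt 2) : Prop :=
  isF D /\ forall a b : F, mulR (pure2 a b) D = mulR D (pure2 b a).
Definition WS2 (D : Rt 2) : Prop := weakFrob D /\ flip D = D.

Definition h01 (i : 'I_2) : 'I_3 := widen_ord (isT : (2 <= 3)%N) i.
Definition h12 (i : 'I_2) : 'I_3 := lift ord0 i.

Definition betaP (D00 D01 D10 D11 : Rt 2) : Rt 2 :=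
  D00 + sclR (varK i0) D10 + sclR (varK i1) D01
      + sclR (varK i0 * varK i1) D11.
Definition SP (D01 D10 : Rt 2) : Rt 2 := D10 - D01.
Definition alphabar (alpha D01 D10 : Rt 2) : Rt 2 := flip alpha + SP D01 D10.
Definition PP (alpha D00 D01 D10 D11 : Rt 2) : Rt 2 :=
  sclR (varK i0 - varK i1) alpha + betaP D00 D01 D10 D11.

Definition poly_type (Rr D00 D01 D10 D11 : Rt 2) : Prop :=
  [/\ isF Rr, centralF2 Rr, flip Rr = Rr,
      [/\ WS2 D00, WS2 D01, WS2 D10 & WS2 D11] &
      mulR (emb h01 D00) (emb h12 D11) = mulR (emb h01 D01) (emb h12 D10)].

Definition C1 (Rr alpha D01 D10 : Rt 2) : Prop :=
  isF alpha /\ mulR alpha (alphabar alpha D01 D10) = Rr.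
Definition C2 (alpha D00 D01 D10 D11 : Rt 2) : Prop :=
  [/\ centralF2 alpha, centralF2 D00, centralF2 D01, centralF2 D10 & centralF2 D11].
Definition C3 (laurent : bool) (P : Rt 2) : Prop :=
  forall y, isB laurent y -> (mulR P y = 0 -> y = 0) /\ (mulR y P = 0 -> y = 0).

End Tensor.

(* A composition lambda of d with positive parts is encoded by its set of    *)
(* cut points D = {l_1, l_1+l_2, ...} \ {d}, a subset of {1..d-1} (0-indexed *)
(* positions: c in D means a cut between positions c-1 and c).               *)
(* Permutations: mathcomp's product is (s * t) i = t (s i), i.e. s * t is    *)
(* the composite t o s.                                                      *)
Section Schur.
Variables (k : fieldType) (F : falgType k) (d : nat) (laurent : bool) (P : Rt F 2).

Local Notation R := (Rt F d).

Definition validD (D : {set 'I_d}) : bool := [forall c, (c \in D) ==> (0 < c)%N].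
Definition omegaD : {set 'I_d} := [set c : 'I_d | (0 < c)%N].

Definition pairf (i j : 'I_d) (t : 'I_2) : 'I_d := if t == i0 then i else j.
Definition Pij (i j : 'I_d) : R := emb (pairf i j) P.
Definition xdiff (i j : 'I_d) : R := sclR (@varK k d i - @varK k d j) (oneR F d).

Definition crossN (D : {set 'I_d}) (i j : 'I_d) : bool :=
  [exists c, (c \in D) && ((i < c)%N && (c <= j)%N)].
Definition elam (D : {set 'I_d}) : R :=
  \big[@mulR _ F d/oneR F d]_(p : 'I_d * 'I_d | p.1 != p.2)
     (if crossN D p.1 p.2 then xdiff p.1 p.2 else Pij p.1 p.2).

Definition blk (D : {set 'I_d}) (i : 'I_d) : nat := #|[set c in D | (c <= i)%N]|.
Definition Young (D : {set 'I_d}) : {set 'S_d} :=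
  [set s : 'S_d | [forall i, blk D (s i) == blk D i]].
(* the left coset  g S_lambda = { g o s | s in S_lambda } *)
Definition cosetY (D : {set 'I_d}) (g : 'S_d) : {set 'S_d} :=
  [set (s * g)%g | s in Young D].

Definition isY (p : {set 'I_d} * {set 'S_d}) : bool :=
  validD p.1 && [exists g, p.2 == cosetY p.1 g].
(* Y = disjoint union of the S_d / S_lambda *)
Definition Y := {p : {set 'I_d} * {set 'S_d} | isY p}.

Definition lamY (y : Y) : {set 'I_d} := (val y).1.
Definition rep (y : Y) : 'S_d := repr (val y).2.
Definition inX (y : Y) : bool := lamY y == omegaD.
Definition eY (y : Y) : R := act (rep y) (elam (lamY y)).
Definition proj (lam : {set 'I_d}) (y : Y) : Y := insubd y (lam, cosetY lam (rep y)).

Definition Fun := Y -> Y -> R.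
Definition addF (f g : Fun) : Fun := fun x y => f x y + g x y.
Definition zeroF : Fun := fun _ _ => 0.
Definition sclF (c : k) (f : Fun) : Fun := fun x y => sclR (@cstK k d c) (f x y).

Definition invR (f : R) : R :=
  epsilon (inhabits (0 : R)) (fun g => mulR f g = oneR F d /\ mulR g f = oneR F d).

Definition conv (f g : Fun) : Fun :=
  fun x y => \sum_(z : Y) mulR (mulR (f x z) (invR (eY z))) (g z y).

Definition xi1 (r : R) : Fun :=
  fun x y => if inX x && (y == x) then mulR (eY x) (act (rep x) r) else 0.
Definition Snl (nu lam : {set 'I_d}) : Fun :=
  fun y y' => if [&& lamY y == nu, lamY y' == lam & proj lam y == y'] then eY y' else 0.
Definition Mln (lam nu : {set 'I_d}) : Fun :=
  fun y' y => if [&& lamY y' == lam, lamY y == nu & proj lam y == y'] then eY y' else 0.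
Definition Klam (lam : {set 'I_d}) : Fun := conv (Snl omegaD lam) (Mln lam omegaD).
Definition tlam (lam : {set 'I_d}) (t : R) : Fun :=
  fun y y' => if (lamY y == lam) && (y == y') then mulR (eY y) (act (rep y) t) else 0.
Definition oneOmega : Fun := fun x x' => if inX x && (x == x') then eY x else 0.

Definition refines (nu lam : {set 'I_d}) : Prop :=
  [/\ validD nu, validD lam & lam \subset nu].
Definition YoungInv (lam : {set 'I_d}) (t : R) : Prop :=
  forall s, s \in Young lam -> act s t = t.

Inductive Gen (S : Fun -> Prop) : Fun -> Prop :=
| Gen_gen f : S f -> Gen S f
| Gen_zero : Gen S zeroF
| Gen_add f g : Gen S f -> Gen S g -> Gen S (addF f g)
| Gen_scl c f : Gen S f -> Gen S (sclF c f)
| Gen_mul f g : Gen S f -> Gen S g -> Gen S (conv f g).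

Definition HT : Fun -> Prop :=
  Gen (fun f => (exists lam, validD lam /\ f = Klam lam) \/
                (exists t, isB laurent t /\ f = xi1 t)).
Definition SBLM : Fun -> Prop :=
  Gen (fun f => (exists nu lam, refines nu lam /\ f = Snl nu lam) \/
                (exists nu lam, refines nu lam /\ f = Mln lam nu) \/
                (exists lam t, [/\ validD lam, isB laurent t, YoungInv lam t & f = tlam lam t])).
Definition CT (c : Fun) : Prop :=
  exists hs : {set 'I_d} -> Fun, (forall lam, validD lam -> HT (hs lam)) /\
    c = \big[addF/zeroF]_(lam : {set 'I_d} | validD lam) conv (Mln lam omegaD) (hs lam).

Definition EndLeft (A : Fun -> Prop) (phi : Fun -> Fun) : Prop :=
  [/\ forall c, CT c -> CT (phi c),
      forall c c', CT c -> CT c' -> phi (addF c c') = addF (phi c) (phi c') &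
      forall a c, A a -> CT c -> phi (conv a c) = conv a (phi c)].
Definition EndRight (A : Fun -> Prop) (phi : Fun -> Fun) : Prop :=
  [/\ forall c, CT c -> CT (phi c),
      forall c c', CT c -> CT c' -> phi (addF c c') = addF (phi c) (phi c') &
      forall a c, A a -> CT c -> phi (conv c a) = conv (phi c) a].

End Schur.

(* Main.v *)
Require Import Defs.
From HB Require Import structures.
From mathcomp Require Import all_boot all_order all_algebra all_fingroup all_field.
From mathcomp Require Import mpoly.
From mathcomp Require Import zify ring.
From Stdlib Require Import ClassicalEpsilon FunctionalExtensionality.

Set Implicit Arguments.
Unset Strict Implicit.
Unset Printing Implicit Defensive.

Import GRing.Theory.
Local Open Scope ring_scope.

(* A point of Y is a total preorder on the d slots, and p_{nu lambda}(y) = y' means that y' is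
   coarser than y.  Dividing f(x,y) by e(x) turns twisted convolution into the product of
   Y x Y matrices over R; then M_{lambda nu} becomes a 0/1 matrix, S_{nu lambda} has entries
   Theta(y,y') for y' coarser than y, and H_d^T is generated by diagonal matrices and the
   K_lambda.  Here Theta(u,v) is the product of theta_ij = P_ij/(x_i - x_j) over the pairs
   with i < j in u but not in v.

   (1) H_d^T has the PBW description  sum_w D_{b_w} L_w  with b_w in B^{(x)d}.  The inclusion
   of K_lambda rests on a telescoping identity for prod_i (alpha_in + beta_in/(x_i - x_n)).
   (2) Let co(u,v) be the number of pairs that u and v order in the same way.  Convolution is
   triangular for co: co(u,z) + co(z,v) <= co(u,v) + co(z,z), with equality iff z lies between
   u and v, and then Theta(u,z) Theta(z,v) = Theta(u,v).  Hence the entries of an element of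
   H_d^T at which co is minimal on its support lie in Theta * B^{(x)d}.
   (3) Both the Laurel Schur algebra and M_lambda * H_d^T contain, for every pair (u,v) and every
   admissible b, an element led by Theta(u,v) b at (u,v).  Peeling off leading terms, such a
   class contains every equivariant n with S_mu * n * M_lambda in H_d^T.  This gives stability
   of C^T, and identifies an H_d^T-linear endomorphism, which is determined by the images of
   the M_lambda, with left multiplication by an element of the Schur algebra. *)

(** * The set Y as total preorders *)

(** The elements of H_d^T carry the poles of theta, so integrality over B cannot be tested entry by
    entry: the defect of one entry may be compensated in another. Only at minimal co does a single
    word L_w contribute, without cancellation. This is why membership is decided by leading terms
    and subtraction, and why the spanning half of a PBW theorem is enough: coefficients are read off
    by triangularity. Theta comes from the twist, since e(y') = e(y) Theta(y,y') whenever y' is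
    coarser than y. A leading coefficient b at (u,v) is admissible when it is integral and fixed by
    the common stabilizer of u and v, as equivariance forces. F may be noncommutative, but alpha,
    beta and P are central, so the relations among structure constants are checked in the
    commutative ring dZ. The image of M_lambda under an H_d^T-linear map is killed by H_p - bar
    alpha_p for all p inside the blocks of lambda. As theta is invertible, its columns are constant
    on the fibres of X -> Y_lambda, so it descends to a function on Y x Y_lambda. *)

Section Preorders.
Variable d : nat.
Implicit Types (y z u v : Y d) (D lam nu : {set 'I_d}) (g h : 'S_d) (i j : 'I_d).

(** Intersecting with [omegaD] drops a possible cut at position 0, so that [mkY] below is total and
    needs no validity argument. *)
Definition vcut D := D :&: omegaD d.

Lemma vcut_id D : validD D -> vcut D = D.
Proof.
move=> /forallP vD; apply/setIidPl/subsetP => c cD.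
by rewrite inE; move: (vD c); rewrite cD.
Qed.

Lemma vcut_valid D : validD (vcut D).
Proof. by apply/forallP => c; apply/implyP; rewrite !inE => /andP[]. Qed.

Lemma omegaD_valid : validD (omegaD d).
Proof. by apply/forallP => c; apply/implyP; rewrite inE. Qed.

Lemma lamY_valid y : validD (lamY y).
Proof. by case/andP: (valP y). Qed.

Lemma leq_blk D i j : (i <= j)%N -> (blk D i <= blk D j)%N.
Proof.
move=> ij; apply/subset_leq_card/subsetP => c; rewrite !inE => /andP[-> ci].
exact: leq_trans ci ij.
Qed.

Lemma ltn_blk D i j : (blk D i < blk D j)%N = crossN D i j.
Proof.
apply/idP/idP => [lt_ij|/existsP[c /and3P[cD ic cj]]].
  apply/existsP; apply/existsP; rewrite -[X in is_true X]negbK; apply/negP.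
  rewrite negb_exists => /forallP noc.
  suff: (blk D j <= blk D i)%N by rewrite leqNgt lt_ij.
  apply/subset_leq_card/subsetP => c; rewrite !inE => /andP[cD cj].
  move: (noc c); rewrite cD cj andbT /= -leqNgt => ci; exact: ci.
apply/proper_card/properP; split.
  apply/subsetP => c'; rewrite !inE => /andP[-> /=] /leq_trans -> //.
  by apply: ltnW; apply: leq_trans ic cj.
by exists c; rewrite !inE cD //= -ltnNge.
Qed.

Lemma YoungP D g : reflect (forall i, blk D (g i) = blk D i) (g \in Young D).
Proof.
rewrite inE; apply: (iffP forallP) => H i; first by apply/eqP/H.
exact/eqP/H.
Qed.

Lemma Young_inv D g i : g \in Young D -> blk D ((g^-1)%g i) = blk D i.
Proof. by move/YoungP => gD; rewrite -[in RHS](permKV g i) gD. Qed.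

Lemma mem_cosetY D g h : (h \in cosetY D g) = ((h * g^-1)%g \in Young D).
Proof.
apply/imsetP/idP => [[s sD ->]|hg]; first by rewrite mulgK.
by exists (h * g^-1)%g; rewrite ?mulgKV.
Qed.

Lemma cosetY_refl D g : g \in cosetY D g.
Proof. by rewrite mem_cosetY mulgV; apply/YoungP => i; rewrite perm1. Qed.

Lemma cosetY_eq D g h : h \in cosetY D g -> cosetY D h = cosetY D g.
Proof.
rewrite mem_cosetY => hg; apply/setP => s; rewrite !mem_cosetY.
have E i : blk D ((s * g^-1)%g i) = blk D ((s * h^-1)%g i).
  by rewrite -[RHS](YoungP _ _ hg) -permM mulgA mulgKV.
by apply/YoungP/YoungP => H i; [rewrite E|rewrite -E]; apply: H.
Qed.

Lemma mkY_subproof D g : isY (vcut D, cosetY (vcut D) g).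
Proof. by rewrite /isY /= vcut_valid; apply/existsP; exists g. Qed.

Definition mkY D g : Y d := exist (fun p => isY p) _ (mkY_subproof D g).

Lemma rep_coset y : (val y).2 = cosetY (lamY y) (rep y).
Proof.
case/andP: (valP y) => _ /existsP[g /eqP yg]; rewrite yg.
apply/esym/cosetY_eq; rewrite /rep yg; apply: mem_repr (cosetY_refl _ g).
Qed.

Lemma Y_mkY y : y = mkY (lamY y) (rep y).
Proof.
apply: val_inj => /=; rewrite vcut_id ?lamY_valid // -rep_coset.
exact: surjective_pairing.
Qed.

Lemma lamY_mkY D g : lamY (mkY D g) = vcut D.
Proof. by []. Qed.

Lemma rep_mkY D g : (rep (mkY D g) * g^-1)%g \in Young (vcut D).
Proof. by rewrite -mem_cosetY; apply: mem_repr (cosetY_refl _ g). Qed.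

Lemma mkY_eq D g h : (h * g^-1)%g \in Young (vcut D) -> mkY D h = mkY D g.
Proof. by rewrite -mem_cosetY => hg; apply: val_inj => /=; rewrite (cosetY_eq hg). Qed.

(** A coset g S_lambda is an ordered set partition, whose blocks are the images under g of the
    blocks of lambda. This is the index of the block of slot [i]; by [rk_mkY] the representative
    does not matter. *)
Definition rk y i : nat := blk (lamY y) (((rep y)^-1)%g i).
(* The block of [i] strictly precedes the block of [j] in [y]. *)
Definition lt y i j := (rk y i < rk y j)%N.

Lemma rk_mkY D g i : rk (mkY D g) i = blk (vcut D) ((g^-1)%g i).
Proof.
rewrite /rk lamY_mkY; have := rep_mkY D g; set r := rep _ => rD.
by rewrite -[RHS](Young_inv _ rD) -permM invMg invgK mulKg.
Qed.

Lemma lt_mkY D g i j : lt (mkY D g) i j = crossN (vcut D) ((g^-1)%g i) ((g^-1)%g j).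
Proof. by rewrite /lt !rk_mkY ltn_blk. Qed.

Lemma lt_rep y i j : lt y i j = crossN (lamY y) (((rep y)^-1)%g i) (((rep y)^-1)%g j).
Proof. by rewrite /lt /rk ltn_blk. Qed.

Lemma lt_irr y i : lt y i i = false. Proof. exact: ltnn. Qed.
Lemma lt_asym y i j : lt y i j -> lt y j i = false.
Proof. by rewrite /lt => H; apply/negbTE; rewrite -leqNgt ltnW. Qed.

(** Both value sequences are sorted and rearrange each other, and a multiset has only one sorted
    listing. *)
Lemma sorted_perm_eq (f : 'I_d -> nat) (g : 'S_d) :
  (forall i j, (i <= j)%N -> (f i <= f j)%N) ->
  (forall i j, (i <= j)%N -> (f (g i) <= f (g j))%N) ->
  forall i, f (g i) = f i.
Proof.
move=> mf mfg.
have srt (h : 'I_d -> nat) : (forall i j, (i <= j)%N -> (h i <= h j)%N) ->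
    sorted leq [seq h i | i <- enum 'I_d].
  move=> mh; rewrite sorted_map.
  apply: (@sub_sorted _ (fun i j : 'I_d => (i <= j)%N)) => [i j /mh //|].
  have := iota_sorted 0 d; rewrite -val_enum_ord sorted_map.
  exact: sub_sorted.
have : [seq f (g i) | i <- enum 'I_d] = [seq f i | i <- enum 'I_d].
  apply: (sorted_eq leq_trans anti_leq (srt _ mfg) (srt _ mf)).
  rewrite (map_comp f g); apply: perm_map; apply: uniq_perm.
  - by rewrite map_inj_uniq ?enum_uniq //; apply: perm_inj.
  - exact: enum_uniq.
  move=> i; rewrite mem_enum inE; apply/mapP; exists ((g^-1)%g i); rewrite ?permKV //.
  by rewrite mem_enum.
by move/eq_in_map => H i; apply: H; rewrite mem_enum.
Qed.

Lemma sortedY y g : (forall i j : 'I_d, (i <= j)%N -> ~~ lt y (g j) (g i)) ->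
  y = mkY (lamY y) g.
Proof.
move=> srt; rewrite {1}(Y_mkY y); apply/esym/mkY_eq; rewrite vcut_id ?lamY_valid //.
apply/YoungP; apply: sorted_perm_eq => [|i j ij]; first exact: leq_blk.
by rewrite !permM leqNgt; apply: srt.
Qed.

Lemma rep_sorted y (i j : 'I_d) : (i <= j)%N -> ~~ lt y (rep y j) (rep y i).
Proof. by move=> ij; rewrite /lt /rk !permK -leqNgt leq_blk. Qed.

(** Position 0 is its own predecessor, which is harmless because a valid cut set does not contain
    0. *)
Definition opred i : 'I_d := Ordinal (leq_ltn_trans (leq_pred i) (ltn_ord i)).

Lemma mem_cut D (c : 'I_d) : validD D -> (c \in D) = crossN D (opred c) c.
Proof.
move=> vD; apply/idP/existsP => [cD|[c' /and3P[c'D /= ]]].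
  by exists c; rewrite cD leqnn /= andbT; move/forallP/(_ c): vD; rewrite cD /=; case: (val c).
by move=> c1 c2; have -> : c = c' by apply: val_inj => /=; lia.
Qed.

(** Refinement: by [crs_proj] and [proj_crs] the coarsenings of [y] are its projections, so the maps
    p_{nu lambda} can be handled through preorders alone. *)
Definition crs y y' := forall i j, lt y' i j -> lt y i j.

Lemma mem_lamY y c : (c \in lamY y) = lt y (rep y (opred c)) (rep y c).
Proof. by rewrite lt_rep !permK mem_cut ?lamY_valid. Qed.

Lemma crs_sorted y y' : crs y y' -> y' = mkY (lamY y') (rep y).
Proof.
by move=> yy'; apply: sortedY => i j /(rep_sorted y); apply: contra; apply: yy'.
Qed.

Lemma crs_lam y y' : crs y y' -> lamY y' \subset lamY y.
Proof.
move=> yy'; apply/subsetP => c cy'; rewrite mem_lamY; apply: (yy' _ _ _).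
rewrite (crs_sorted yy') lt_mkY vcut_id ?lamY_valid // !permK.
by rewrite -mem_cut ?lamY_valid.
Qed.

Lemma proj_mkY lam y : validD lam -> proj lam y = mkY lam (rep y).
Proof.
move=> vl; apply: val_inj; rewrite /proj val_insubd /= vcut_id //.
by rewrite /isY /= vl /= ifT //; apply/existsP; exists (rep y).
Qed.

Lemma crs_proj y y' : crs y y' -> proj (lamY y') y = y'.
Proof. by move=> yy'; rewrite proj_mkY ?lamY_valid // -crs_sorted. Qed.

Lemma lamY_proj lam y : validD lam -> lamY (proj lam y) = lam.
Proof. by move=> vl; rewrite proj_mkY // lamY_mkY vcut_id. Qed.

Lemma proj_crs lam y : validD lam -> lam \subset lamY y -> crs y (proj lam y).
Proof.
move=> vl sl i j; rewrite proj_mkY // lt_mkY lt_rep vcut_id // => /existsP[c /andP[cl cc]].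
by apply/existsP; exists c; rewrite (subsetP sl).
Qed.

Lemma Y_ext y y' : (forall i j, lt y i j = lt y' i j) -> y = y'.
Proof.
move=> E; have c1 : crs y y' by move=> i j; rewrite E.
have c2 : crs y' y by move=> i j; rewrite E.
rewrite {1}(Y_mkY y) (crs_sorted c1); congr mkY.
by apply/eqP; rewrite eqEsubset !crs_lam.
Qed.

(** Sorting the slots by [f] yields the representative, and the cuts are the places where the sorted
    values jump. With [Y_ext] this identifies the points of [Y] with the total preorders. *)
Lemma existsY (f : 'I_d -> nat) : {y | forall i j, lt y i j = (f i < f j)%N}.
Proof.
pose r i j := (f i <= f j)%N.
pose s := sort r (enum 'I_d).
have sz : size s = d by rewrite size_sort size_enum_ord.
have us : uniq s by rewrite sort_uniq enum_uniq.
have rt : transitive r by move=> a b c; apply: leq_trans.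
have ss : sorted r s by apply: sort_sorted => a b; apply: leq_total.
pose g0 (i : 'I_d) := nth i s i.
have g0i : injective g0.
  move=> i j; rewrite /g0 (set_nth_default i j) ?sz // => /eqP.
  by rewrite nth_uniq ?sz // => /eqP/val_inj.
pose g := perm g0i.
have gs i j : (i <= j)%N -> (f (g i) <= f (g j))%N.
  rewrite leq_eqVlt => /orP[/eqP/val_inj -> //|ij].
  rewrite !permE /g0 (set_nth_default i j) ?sz //.
  by apply: (sorted_ltn_nth rt i ss); rewrite ?inE ?sz.
pose D := [set c : 'I_d | (f (g (opred c)) < f (g c))%N].
have vD : validD D.
  apply/forallP => c; apply/implyP; rewrite inE; case: c => [[|c] ci] //=.
  by have -> : opred (Ordinal ci) = Ordinal ci; [exact: val_inj|rewrite ltnn].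
have cr i j : crossN D i j = (f (g i) < f (g j))%N.
  apply/existsP/idP => [[c /and3P[]]|].
    rewrite inE => cD ic cj; apply: leq_ltn_trans (leq_trans cD (gs _ _ cj)).
    by apply: gs => /=; lia.
  move=> fij; apply/existsP; rewrite -[X in is_true X]negbK; apply/negP.
  rewrite negb_exists => /forallP noc.
  (* As long as no cut occurs after [i], the sorted values cannot rise. *)
  have key n : forall m : 'I_d, (i <= m)%N -> (m <= j)%N -> (m - i = n)%N -> (f (g m) <= f (g i))%N.
    elim: n => [|n IH] m im mj mi.
      by have -> : m = i by apply: val_inj => /=; lia.
    have : (f (g (opred m)) <= f (g i))%N by apply: IH => /=; lia.
    apply: leq_trans; move: (noc m); rewrite mj andbT negb_and inE -leqNgt.
    by case/orP => //; rewrite -leqNgt => ?; exfalso; lia.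
  have ij : (i <= j)%N.
    by rewrite leqNgt; apply/negP => /ltnW/gs; rewrite leqNgt fij.
  by have := key _ j ij (leqnn _) erefl; rewrite leqNgt fij.
exists (mkY D g) => i j; rewrite lt_mkY vcut_id // cr !permKV //.
Qed.

(** Left translation of cosets by [h]: products of permutations compose from left to right, hence
    the factor on the right. *)
Definition yact h y := mkY (lamY y) (rep y * h)%g.

Lemma lamY_yact h y : lamY (yact h y) = lamY y.
Proof. by rewrite lamY_mkY vcut_id ?lamY_valid. Qed.

Lemma lt_yact h y i j : lt (yact h y) i j = lt y ((h^-1)%g i) ((h^-1)%g j).
Proof. by rewrite lt_mkY lt_rep vcut_id ?lamY_valid // invMg !permM. Qed.

Lemma lt_yactK h y i j : lt (yact h y) (h i) (h j) = lt y i j.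
Proof. by rewrite lt_yact !permK. Qed.

Lemma yact1 y : yact 1%g y = y.
Proof. by apply: Y_ext => i j; rewrite lt_yact invg1 !perm1. Qed.

Lemma yactM h h' y : yact (h * h')%g y = yact h' (yact h y).
Proof. by apply: Y_ext => i j; rewrite !lt_yact invMg !permM. Qed.

Lemma yactKV h y : yact (h^-1)%g (yact h y) = y.
Proof. by rewrite -yactM mulgV yact1. Qed.

Lemma yact_inj h : injective (yact h).
Proof. by move=> y y' /(congr1 (yact (h^-1)%g)); rewrite !yactKV. Qed.

Lemma yact_trans y y' : lamY y = lamY y' -> {h | y' = yact h y}.
Proof.
move=> E; exists ((rep y)^-1 * rep y')%g.
by rewrite {1}(Y_mkY y') /yact mulKVg E.
Qed.

Lemma crs_yact h y y' : crs y y' -> crs (yact h y) (yact h y').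
Proof. by move=> yy' i j; rewrite !lt_yact; apply: yy'. Qed.

Lemma blk_omega i : blk (omegaD d) i = i.
Proof.
rewrite /blk; have -> : [set c in omegaD d | (c <= i)%N] = [set c : 'I_d | (0 < c <= i)%N].
  by apply/setP => c; rewrite !inE.
rewrite cardE -(size_map val).
have -> : map val (enum [set c : 'I_d | (0 < c <= i)%N]) = iota 1 i; last by rewrite size_iota.
apply: (sorted_eq leq_trans anti_leq).
- rewrite sorted_map; apply: (subseq_sorted _ (filter_subseq _ _)); first by move=> ? ? ?; apply: leq_trans.
  by have := iota_sorted 0 d; rewrite -val_enum_ord sorted_map enumT.
- exact: iota_sorted.
apply: uniq_perm; [by rewrite map_inj_uniq ?enum_uniq //; apply: val_inj|exact: iota_uniq|].
move=> m; rewrite mem_iota; apply/mapP/idP => [[c]|mi].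
  by rewrite mem_enum inE => ? -> /=; lia.
have md : (m < d)%N by have := ltn_ord i; lia.
by exists (Ordinal md) => //; rewrite mem_enum inE /=; lia.
Qed.

Definition xg g := mkY (omegaD d) g.

Lemma vcut_omega : vcut (omegaD d) = omegaD d.
Proof. by rewrite vcut_id ?omegaD_valid. Qed.

Lemma inX_xg g : inX (xg g). Proof. by rewrite /inX lamY_mkY vcut_omega. Qed.
Lemma rk_xg g i : rk (xg g) i = (g^-1)%g i.
Proof. by rewrite rk_mkY vcut_omega blk_omega. Qed.
Lemma lt_xg g i j : lt (xg g) i j = ((g^-1)%g i < (g^-1)%g j)%N.
Proof. by rewrite /lt !rk_xg. Qed.

Lemma rep_xg g : rep (xg g) = g.
Proof.
have /YoungP := rep_mkY (omegaD d) g; rewrite -/(xg g) vcut_omega => H.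
suff E : (rep (xg g) * g^-1 = 1)%g by rewrite -[RHS]mul1g -E mulgKV.
by apply/permP => i; rewrite perm1; apply: val_inj; rewrite /= -blk_omega H blk_omega.
Qed.

Lemma xg_rep x : inX x -> xg (rep x) = x.
Proof. by move/eqP => xX; rewrite [RHS]Y_mkY xX. Qed.

Lemma xg_inj : injective xg.
Proof. by move=> g h E; rewrite -(rep_xg g) E rep_xg. Qed.

Lemma yact_xg h g : yact h (xg g) = xg (g * h)%g.
Proof. by rewrite /yact lamY_mkY vcut_omega rep_xg. Qed.

Lemma lt_total x i j : inX x -> i != j -> lt x i j || lt x j i.
Proof.
by move=> /xg_rep <- ij; rewrite !lt_xg -neq_ltn (inj_eq val_inj) (inj_eq perm_inj).
Qed.

Lemma total_inX y : (forall i j, i != j -> lt y i j || lt y j i) -> inX y.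
Proof.
move=> tot; have [x ltx] := existsY (fun i => ((rep y)^-1)%g i).
have xx : x = xg (rep y) by apply: Y_ext => i j; rewrite ltx lt_xg.
suff c : crs y x.
  rewrite /inX eqEsubset; apply/andP; split.
    by have /setIidPl <- : lamY y \subset lamY y by []; rewrite -{2}(vcut_id (lamY_valid y)) subIset // subsetIr orbT.
  by have := crs_lam c; rewrite xx lamY_mkY vcut_omega.
move=> i j; rewrite ltx => lij.
have /tot /orP[//|] : i != j by apply: contraTneq lij => ->; rewrite ltnn.
rewrite -{1}(permKV (rep y) i) -{1}(permKV (rep y) j) => H.
by have := rep_sorted y (ltnW lij); rewrite H.
Qed.

Lemma refineY y (f : 'I_d -> nat) :
  {z | forall i j, lt z i j = lt y i j || ~~ lt y j i && (f i < f j)%N}.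
Proof.
(* [N] exceeds every value of [f], so [rk y i * N + f i] encodes the lexicographic order. *)
pose N := (\max_i f i).+1.
have [z ltz] := existsY (fun i => rk y i * N + f i)%N.
exists z => i j; rewrite ltz /lt.
have fN m : (f m < N)%N by rewrite ltnS; apply: leq_bigmax.
have := fN i; have := fN j.
case: (ltngtP (rk y i) (rk y j)) => [rij|rij|->] /= Nj Ni; last by rewrite ltn_add2l.
- by apply/idP; nia.
- by apply/negbTE; nia.
Qed.

(** Not symmetric: the ties of [u] are broken according to [v]. Both [meet u v] and [meet v u] lie
    between [u] and [v]. *)
Definition meet u v : Y d := sval (refineY u (rk v)).

Lemma lt_meet u v i j : lt (meet u v) i j = lt u i j || ~~ lt u j i && lt v i j.
Proof. by rewrite /meet; case: refineY. Qed.

Lemma meet_yact h u v : meet (yact h u) (yact h v) = yact h (meet u v).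
Proof. by apply: Y_ext => i j; rewrite lt_meet !lt_yact lt_meet. Qed.

Lemma meet_crs u v : crs (meet u v) u.
Proof. by move=> i j; rewrite lt_meet => ->. Qed.

(** The ties of [u] are broken against [v], so that no new agreement with [v] arises; subtracting
    from the maximum reverses the order of [v]. *)
Definition opref u v : Y d := sval (refineY u (fun i => \max_j rk v j - rk v i)%N).

Lemma lt_opref u v i j : lt (opref u v) i j = lt u i j || ~~ lt u j i && lt v j i.
Proof.
rewrite /opref; case: refineY => z /= ->; congr (_ || _ && _); rewrite /lt.
have H m : (rk v m <= \max_j rk v j)%N by apply: leq_bigmax.
by have := H i; have := H j; move: (\max_j _) => N; lia.
Qed.

Definition co u v := #|[set p : 'I_d * 'I_d | lt u p.1 p.2 && lt v p.1 p.2]|.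

Lemma co_yact h u v : co (yact h u) (yact h v) = co u v.
Proof.
pose f (p : 'I_d * 'I_d) := ((h^-1)%g p.1, (h^-1)%g p.2).
have fi : injective f by move=> [a b] [a' b'] [] /perm_inj -> /perm_inj ->.
rewrite /co -[RHS](card_preimset _ fi); apply: eq_card => p.
by rewrite !inE !lt_yact.
Qed.

Lemma co_le u v : (co u v <= d * d)%N.
Proof. by rewrite -[X in (X * X)%N](card_ord d) -card_prod max_card. Qed.

Definition btw u z v := forall i j,
  (lt u i j && lt v i j -> lt z i j) /\ (lt z i j -> lt u i j || lt v i j).

Lemma co_sum u v : co u v = (\sum_(p : 'I_d * 'I_d) (lt u p.1 p.2 && lt v p.1 p.2))%N.
Proof.
rewrite /co -sum1dep_card big_mkcond /=; apply: eq_bigr => p _; by case: (_ && _).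
Qed.

(** The inequality holds pair by pair, between Booleans; the termwise comparison also gives the
    equality case [co_btw]. *)
Lemma co_super u z v : (co u z + co z v <= co u v + co z z)%N.
Proof.
rewrite !co_sum -!big_split; apply: leq_sum => p _ /=.
by case: (lt u _ _); case: (lt z _ _); case: (lt v _ _).
Qed.

Lemma co_btw u z v : (co u v + co z z <= co u z + co z v)%N -> btw u z v.
Proof.
move=> H; have E : (co u z + co z v == co u v + co z z)%N by rewrite eqn_leq H co_super.
move: E; rewrite !co_sum -!big_split /=.
have le p : true -> ((lt u p.1 p.2 && lt z p.1 p.2 : nat) + (lt z p.1 p.2 && lt v p.1 p.2) <=
   (lt u p.1 p.2 && lt v p.1 p.2 : nat) + (lt z p.1 p.2 && lt z p.1 p.2) ?= iff
   ((lt u p.1 p.2 && lt v p.1 p.2 ==> lt z p.1 p.2) && (lt z p.1 p.2 ==> lt u p.1 p.2 || lt v p.1 p.2)))%N.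
  by move=> _; case: (lt u _ _); case: (lt z _ _); case: (lt v _ _).
have [_ ->] := leqif_sum le.
move/forallP => /= H' i j; move: (H' (i, j)); move=> /andP[/implyP ? /implyP ?]; by split.
Qed.

Lemma btw_co u z v : btw u z v -> (co u z + co z v = co u v + co z z)%N.
Proof.
move=> H; rewrite !co_sum -!big_split; apply: eq_bigr => -[i j] _ /=.
have [] := H i j; case: (lt u _ _); case: (lt z _ _); case: (lt v _ _) => //= A B;
  by [have := A isT | have := B isT].
Qed.

Lemma btw_agree u z v : (forall i j, lt z i j = lt u i j \/ lt z i j = lt v i j) -> btw u z v.
Proof.
move=> H i j; split; first by case/andP => ui vj; case: (H i j) => ->.
by case: (H i j) => -> ->; rewrite ?orbT.
Qed.

Lemma co_refl_lam u v : lamY u = lamY v -> co u u = co v v.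
Proof. by case/yact_trans => h ->; rewrite co_yact. Qed.

Lemma crs_lamE w u u' : crs w u -> crs w u' -> lamY u = lamY u' -> u = u'.
Proof. by move=> c c' E; rewrite -(crs_proj c) -(crs_proj c') E. Qed.

End Preorders.

(** * Matrices indexed by Y *)

Notation Mx d T := 'M[T]_#|{: Y d}|.

Section Entries.
Variables (d : nat) (T : pzRingType).
Implicit Types (A B : Mx d T) (x y z : Y d).

(** The ordinals that index the matrix only serve to obtain the ring structure; later arguments
    address entries by points of [Y]. *)
Definition ent A x y : T := A (enum_rank x) (enum_rank y).
Definition mk (f : Y d -> Y d -> T) : Mx d T :=
  \matrix_(i, j) f (enum_val i) (enum_val j).

Lemma ent_mk f x y : ent (mk f) x y = f x y.
Proof. by rewrite /ent mxE !enum_rankK. Qed.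

Lemma entP A B : (forall x y, ent A x y = ent B x y) -> A = B.
Proof.
by move=> H; apply/matrixP => i j; have := H (enum_val i) (enum_val j); rewrite /ent !enum_valK.
Qed.

Lemma entM A B x y : ent (A * B) x y = \sum_z ent A x z * ent B z y.
Proof.
rewrite /ent mxE (reindex (@enum_rank (Y d))) //=.
by exists enum_val => i _; rewrite ?enum_rankK ?enum_valK.
Qed.

Lemma entD A B x y : ent (A + B) x y = ent A x y + ent B x y.
Proof. by rewrite /ent mxE. Qed.
Lemma entN A x y : ent (- A) x y = - ent A x y.
Proof. by rewrite /ent mxE. Qed.
Lemma ent0 x y : ent 0 x y = 0.
Proof. by rewrite /ent mxE. Qed.
Lemma entZ c A x y : ent (c *: A) x y = c * ent A x y.
Proof. by rewrite /ent mxE. Qed.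
Lemma ent_sum (I : Type) (r : seq I) (P : pred I) (F : I -> Mx d T) x y :
  ent (\sum_(i <- r | P i) F i) x y = \sum_(i <- r | P i) ent (F i) x y.
Proof. by rewrite /ent summxE. Qed.

End Entries.

Lemma ent_map d (T T' : pzRingType) (f : T -> T') (A : Mx d T) x y :
  ent (map_mx f A) x y = f (ent A x y).
Proof. by rewrite /ent mxE. Qed.

(** * Abstract coefficient data *)

(* The properties of the coefficients that the argument uses: [dZ] is the centre of [dR],
   [th], [al], [bt] stand for P_ij/(x_i - x_j), alpha_ij, beta_ij/(x_i - x_j), and [thv] for the
   inverse of [th]; [isC] selects the central elements of F^{(x)d}, [isBt] those of B^{(x)d}.
   The axioms [isC_st] and [isC_rr] say that S_ij and R_ij have constant coefficients. *)
Record datum (d : nat) := Datum {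
  dk : pzRingType;
  dZ : comPzRingType;
  dR : pzRingType;
  kz : {rmorphism dk -> dZ};
  io : {rmorphism dZ -> dR};
  actZ : 'S_d -> {rmorphism dZ -> dZ};
  actR : 'S_d -> {rmorphism dR -> dR};
  th : 'I_d -> 'I_d -> dZ;
  thv : 'I_d -> 'I_d -> dZ;
  al : 'I_d -> 'I_d -> dZ;
  bt : 'I_d -> 'I_d -> dZ;
  isC : dZ -> Prop;
  isBt : dR -> Prop;
  ioC : forall z r, io z * r = r * io z;
  actR_io : forall g z, actR g (io z) = io (actZ g z);
  actR1 : forall r, actR 1%g r = r;
  actRM : forall g h r, actR (g * h)%g r = actR h (actR g r);
  actZ1 : forall z, actZ 1%g z = z;
  actZM : forall g h z, actZ (g * h)%g z = actZ h (actZ g z);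
  actZ_kz : forall g c, actZ g (kz c) = kz c;
  thK : forall i j, i != j -> th i j * thv i j = 1;
  thE : forall i j, i != j -> th i j = al i j + bt i j;
  act_al : forall g i j, i != j -> actZ g (al i j) = al (g i) (g j);
  act_bt : forall g i j, i != j -> actZ g (bt i j) = bt (g i) (g j);
  isBt_io : forall c, isC c -> isBt (io c);
  isC_act : forall g c, isC c -> isC (actZ g c);
  isC_kz : forall c, isC (kz c);
  isBt_act : forall g r, isBt r -> isBt (actR g r);
  isBtD : forall r s, isBt r -> isBt s -> isBt (r + s);
  isBtM : forall r s, isBt r -> isBt s -> isBt (r * s);
  swapC : forall c i j, isC c -> i != j -> bt i j * c = bt i j * actZ (tperm i j) c;
  isC_al : forall i j, i != j -> isC (al i j);
  isC_st : forall i j, i != j -> isC (bt i j + bt j i);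
  isC_rr : forall i j, i != j -> isC (th i j * th j i - bt i j * bt j i);
  btYB : forall i j m, i != j -> i != m -> j != m ->
    bt i m * bt j m = bt i m * bt j i + bt j m * bt i j;
  isBt_rho : forall r i j, isBt r -> i != j ->
    isBt (io (bt i j) * r - actR (tperm i j) r * io (bt i j))
}.
Arguments ioC {_ _}.
Arguments actR_io {_ _}.
Arguments thK {_ _ _ _}.
Arguments thE {_ _ _ _}.
Arguments act_al {_ _} _ {_ _}.
Arguments act_bt {_ _} _ {_ _}.
Arguments swapC {_ _ _ _ _}.
Arguments isC_al {_ _ _ _}.
Arguments isC_st {_ _ _ _}.
Arguments isC_rr {_ _ _ _}.
Arguments btYB {_ _ _ _ _}.
Arguments isBt_act {_ _} _ {_}.
Arguments isC_act {_ _} _ {_}.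
Arguments isBt_io {_ _ _}.
Arguments isC_kz {_ _} _.
Arguments isBt_rho {_ _ _ _ _}.
Arguments kz {_ _}.
Arguments io {_ _}.
Arguments actZ {_ _}.
Arguments actR {_ _}.
Arguments th {_ _}.
Arguments thv {_ _}.
Arguments al {_ _}.
Arguments bt {_ _}.
Arguments isC {_ _}.
Arguments isBt {_ _}.

(** * Scalar identities behind the braid relation and the symmetrizers *)

(** To be read with [a], [b], [c] equal to [bt i j], [bt j m], [bt i m] and with primes for reversed
    slots: the two sides are the coefficients of the diagonal term in the braid relation. *)
Lemma braid_scalar_comm (Z : comPzRingType) (r1 r2 a a' b b' c : Z) :
  c * r1 = c * r2 -> c * b = c * a' + b * a -> a * c = b' * c + a * b ->
  a * a * b + (r1 + a * a') * c = b * b * a + (r2 + b * b') * c.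
Proof.
move=> R1 Y1 Y2; apply/eqP; rewrite -subr_eq0; apply/eqP.
have -> : a * a * b + (r1 + a * a') * c - (b * b * a + (r2 + b * b') * c) =
  (c * r1 - c * r2) + (a * (a * b + a' * c - b * b) - b * (b' * c)) by ring.
have -> : a' * c = c * b - b * a by rewrite Y1; ring.
have -> : b' * c = a * (c - b) by rewrite mulrBr Y2; ring.
by rewrite R1; ring.
Qed.

Section Scalars.
Variables (d : nat) (S : datum d).
Implicit Types (i j m : 'I_d) (g h : 'S_d).

Definition st i j : dZ S := bt i j + bt j i.
Definition rr i j : dZ S := th i j * th j i - bt i j * bt j i.

Lemma act_th g i j : i != j -> actZ g (th i j) = th (g i) (g j) :> dZ S.
Proof.
move=> ij; have gij : g i != g j by rewrite (inj_eq perm_inj).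
by rewrite (thE ij) (thE gij) rmorphD /= act_al // act_bt.
Qed.

(** The weak Frobenius property: [bt i j] absorbs the transposition of [i] and [j] applied to a
    constant. *)
Lemma swap_al i j m : i != j -> m != i -> m != j -> bt i j * al m i = bt i j * al m j :> dZ S.
Proof. by move=> ij mi mj; rewrite (swapC (isC_al mi) ij) act_al // tpermL tpermD // eq_sym. Qed.

Lemma act_st g i j : i != j -> actZ g (st i j) = st (g i) (g j).
Proof. by move=> ij; rewrite /st rmorphD !act_bt // eq_sym. Qed.

Lemma act_rr g i j : i != j -> actZ g (rr i j) = rr (g i) (g j).
Proof.
move=> ij; have ji : j != i by rewrite eq_sym.
by rewrite /rr rmorphB !rmorphM /= !act_bt ?act_th.
Qed.

Lemma stC i j : st i j = st j i. Proof. by rewrite /st addrC. Qed.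
Lemma rrC i j : rr i j = rr j i. Proof. by rewrite /rr mulrC [X in _ - X]mulrC. Qed.

Lemma swap_st i j m : i != j -> m != i -> m != j -> bt i j * st m i = bt i j * st m j.
Proof. by move=> ij mi mj; rewrite (swapC (isC_st mi) ij) act_st // tpermL tpermD // eq_sym. Qed.

Lemma swap_rr i j m : i != j -> m != i -> m != j -> bt i j * rr m i = bt i j * rr m j.
Proof. by move=> ij mi mj; rewrite (swapC (isC_rr mi) ij) act_rr // tpermL tpermD // eq_sym. Qed.

(** This is [btYB] for the triple i, m, j once [bt m i] is traded for the constant [st], whose
    values at [i] and at [j] are not distinguished by [bt i j]. *)
Lemma btYB_rev i j m : i != j -> i != m -> j != m ->
  bt i j * bt i m = bt m j * bt i m + bt i j * bt j m :> dZ S.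
Proof.
move=> ij im jm; have [mi mj] : m != i /\ m != j by rewrite ![m == _]eq_sym.
have Y2 := @btYB _ S _ _ _ im ij mj.
have S1 : bt i j * st i m = bt i j * st j m by rewrite stC swap_st // stC.
have -> : bt m j * bt i m = bt i j * st j m - bt i j * bt m i - bt i j * bt j m.
  by rewrite /st mulrDr Y2; ring.
by rewrite -S1 /st; ring.
Qed.

Lemma braid_scalar i j m : i != j -> i != m -> j != m ->
  bt i j * bt i j * bt j m + th i j * th j i * bt i m =
  bt j m * bt j m * bt i j + th j m * th m j * bt i m :> dZ S.
Proof.
move=> ij im jm; have [ji mi mj] : [/\ j != i, m != i & m != j] by rewrite ![_ == i]eq_sym [m == _]eq_sym.
have E a b : th a b * th b a = rr a b + bt a b * bt b a by rewrite /rr subrK.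
rewrite !E.
have Y1 := @btYB _ S _ _ _ ij im jm.
have Y2 := btYB_rev ij im jm.
have R1 : bt i m * rr i j = bt i m * rr j m by rewrite rrC swap_rr.
exact: braid_scalar_comm R1 Y1 Y2.
Qed.

(** Peel off [th j m = al j m + bt j m]. In the sum that remains, [btYB] produces terms with a
    factor [bt j m], and these cancel against the same expansion taken at [j] in place of [m]; hence
    the induction over all [m]. *)
Lemma th_expand (s : seq 'I_d) m : uniq (m :: s) ->
  \prod_(i <- s) th i m = \prod_(i <- s) al i m +
     \sum_(i <- s) bt i m * \prod_(j <- s | j != i) th j i :> dZ S.
Proof.
elim: s m => [|j s IH] m /=; first by rewrite !big_nil addr0.
rewrite inE negb_or -andbA => /and4P[mj ms js us].
have jm : j != m by rewrite eq_sym.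
have IHu l : l \notin s -> uniq (l :: s) by move=> ls; rewrite /= ls us.
rewrite !big_cons /= eqxx /= (IH _ (IHu _ ms)) (thE jm) [X in _ + (bt j m * X + _)]big_mkcond /=.
have -> : \prod_(l <- s) (if l != j then th l j else 1) = \prod_(l <- s) th l j :> dZ S.
  by apply: eq_big_seq => l ls; case: eqP => [E|//]; rewrite -E ls in js.
have -> : \sum_(i <- s) bt i m * \prod_(l <- j :: s | l != i) th l i =
    \sum_(i <- s) (al j m * (bt i m * \prod_(l <- s | l != i) th l i) +
      (bt i m * bt j m - bt j m * bt i j) * \prod_(l <- s | l != i) th l i) :> dZ S.
  apply: eq_big_seq => i /[dup] i_s; case: (eqVneq i j) => [->|ij _]; first by rewrite (negPf js).
  have im : i != m by apply: contraTneq i_s => ->.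
  have ji : j != i by rewrite eq_sym.
  rewrite big_cons ji (thE ji) (btYB ij im jm) addrK !mulrA [bt i m * (_ + _)]mulrDr.
  by rewrite swap_al // -mulrDl; congr (_ * _); ring.
rewrite (IH _ (IHu _ js)).
rewrite big_split /= -mulr_sumr.
have E : bt j m * \prod_(l <- s) al l j = bt j m * \prod_(l <- s) al l m :> dZ S.
  elim: (s) ms js => [|l s' IHs]; first by rewrite !big_nil.
  rewrite !inE !negb_or !big_cons => /andP[ml ms] /andP[jl js].
  by rewrite !mulrA swap_al // 1?eq_sym // mulrAC IHs // mulrAC.
have -> : \sum_(i <- s) (bt i m * bt j m - bt j m * bt i j) * \prod_(l <- s | l != i) th l i =
  bt j m * (\sum_(i <- s) bt i m * \prod_(l <- s | l != i) th l i) -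
  bt j m * (\sum_(i <- s) bt i j * \prod_(l <- s | l != i) th l i) :> dZ S.
  by rewrite !mulr_sumr -sumrB; apply: eq_bigr => i _; ring.
rewrite [bt j m * (_ + _)]mulrDr E; ring.
Qed.

End Scalars.

(** * The operators H_p and their relations *)

Section Operators.
Variables (d' : nat) (S : datum d'.+1).
Notation d := d'.+1.
Notation Z := (dZ S).
Notation R := (dR S).
Implicit Types (g h : 'S_d) (x y z : Y d) (p q n : nat).

(** [inord] sends an index out of range to 0, whence the bounds such as [p.+1 < d] in the lemmas
    below. *)
Definition pos p : 'I_d := inord p.
Definition sp p : 'S_d := tperm (pos p) (pos p.+1).

Lemma pos_neq p q : (p < d)%N -> (q < d)%N -> p != q -> pos p != pos q.
Proof. by move=> pd qd; apply: contraNneq => /(congr1 val) /=; rewrite !inordK // => ->. Qed.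

Lemma spK p : (sp p * sp p = 1)%g. Proof. exact: tperm2. Qed.

Lemma sp_com p q : (p.+1 < q)%N -> (q.+1 < d)%N -> (sp p * sp q = sp q * sp p)%g.
Proof.
move=> pq qd; rewrite conjgC {2}/sp tpermJ !tpermD //; apply: pos_neq; lia.
Qed.

(** The operator Phi(H) at positions p and p+1, freed from the twist. Its two terms come from
    xi_{1,beta/(x_i-x_j)} and xi_{s,P/(x_i-x_j)}; the point g s_p is written [sp p * g]. *)
Definition Hop p (v : 'S_d -> Z) g : Z :=
  bt (g (pos p)) (g (pos p.+1)) * v g +
  th (g (pos p)) (g (pos p.+1)) * v (sp p * g)%g.

(* The matrices are sealed behind an opaque constant, so that unification never
   compares their entries. *)
Lemma HZ_subproof : {A : nat -> Mx d Z | forall p x y, ent (A p) x y = if inX x then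
  bt (rep x (pos p)) (rep x (pos p.+1)) * (y == x)%:R +
  th (rep x (pos p)) (rep x (pos p.+1)) * (y == xg (sp p * rep x)%g)%:R else 0}.
Proof.
exists (fun p => mk (fun x y => if inX x then
  bt (rep x (pos p)) (rep x (pos p.+1)) * (y == x)%:R +
  th (rep x (pos p)) (rep x (pos p.+1)) * (y == xg (sp p * rep x)%g)%:R else 0)) => p x y.
exact: ent_mk.
Qed.
Definition HZ := sval HZ_subproof.
Definition ent_HZ1 : forall p x y, ent (HZ p) x y = _ := svalP HZ_subproof.

(** The rows outside X vanish, so that [DR 1] is the idempotent 1_omega and not the identity
    matrix. *)
Lemma DR_subproof (T : pzRingType) (a : 'S_d -> T -> T) :
  {A : T -> Mx d T | forall c x y, ent (A c) x y =
     if inX x && (x == y) then a (rep x) c else 0}.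
Proof.
exists (fun c => mk (fun x y => if inX x && (x == y) then a (rep x) c else 0)) => c x y.
exact: ent_mk.
Qed.
Definition DZ := sval (DR_subproof (fun g (c : Z) => actZ g c)).
Definition DR := sval (DR_subproof (fun g (r : R) => actR g r)).
Definition ent_DZ1 : forall c x y, ent (DZ c) x y = _ :=
  svalP (DR_subproof (fun g (c : Z) => actZ g c)).
Definition ent_DR1 : forall c x y, ent (DR c) x y = _ :=
  svalP (DR_subproof (fun g (r : R) => actR g r)).
Definition HR p : Mx d R := map_mx io (HZ p).

Lemma sum_delta (T : pzRingType) (F : Y d -> T) y : \sum_z (z == y)%:R * F z = F y.
Proof.
rewrite (bigD1 y) //= eqxx mul1r big1 ?addr0 // => z /negPf ->; exact: mul0r.
Qed.

Lemma ent_HZ p V g y :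
  ent (HZ p * V) (xg g) y = Hop p (fun h => ent V (xg h) y) g.
Proof.
rewrite entM /Hop.
transitivity (\sum_z (bt (g (pos p)) (g (pos p.+1)) * ((z == xg g)%:R * ent V z y) +
  th (g (pos p)) (g (pos p.+1)) * ((z == xg (sp p * g)%g)%:R * ent V z y))).
  by apply: eq_bigr => z _; rewrite ent_HZ1 inX_xg rep_xg mulrDl; congr (_ + _);
    apply: esym; apply: mulrA.
by rewrite big_split; congr (_ + _); rewrite -mulr_sumr sum_delta.
Qed.

Lemma ent_HZ0 p V x y : ~~ inX x -> ent (HZ p * V) x y = 0.
Proof. by move=> /negPf nx; rewrite entM big1 // => z _; rewrite ent_HZ1 nx mul0r. Qed.

Lemma ent_DZ c V g y : ent (DZ c * V) (xg g) y = actZ g c * ent V (xg g) y.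
Proof.
rewrite entM (bigD1 (xg g)) //= big1 ?addr0 => [|z /negPf nz]; rewrite ent_DZ1 inX_xg.
  by rewrite eqxx rep_xg.
by rewrite eq_sym nz mul0r.
Qed.

Lemma ent_DZ0 c V x y : ~~ inX x -> ent (DZ c * V) x y = 0.
Proof. by move=> /negPf nx; rewrite entM big1 // => z _; rewrite ent_DZ1 nx mul0r. Qed.

Lemma ent_DR r V g y : ent (DR r * V) (xg g) y = actR g r * ent V (xg g) y.
Proof.
rewrite entM (bigD1 (xg g)) //= big1 ?addr0 => [|z /negPf nz]; rewrite ent_DR1 inX_xg.
  by rewrite eqxx rep_xg.
by rewrite eq_sym nz mul0r.
Qed.

Lemma ent_DR0 r V x y : ~~ inX x -> ent (DR r * V) x y = 0.
Proof. by move=> /negPf nx; rewrite entM big1 // => z _; rewrite ent_DR1 nx mul0r. Qed.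

Lemma entXP (T : pzRingType) (A B : Mx d T) :
  (forall x y, ~~ inX x -> ent A x y = 0) -> (forall x y, ~~ inX x -> ent B x y = 0) ->
  (forall g y, ent A (xg g) y = ent B (xg g) y) -> A = B.
Proof.
move=> A0 B0 AB; apply: entP => x y.
by case: (boolP (inX x)) => [/xg_rep <- //|xX]; rewrite A0 ?B0.
Qed.

Lemma io_comb (b t : Z) (m n : bool) (v : R) :
  io (b * m%:R + t * n%:R) * v = io b * (m%:R * v) + io t * (n%:R * v).
Proof. by rewrite rmorphD rmorphM rmorphM !rmorph_nat mulrDl !mulrA. Qed.

Lemma ent_HR p V g y : ent (HR p * V) (xg g) y =
  io (bt (g (pos p)) (g (pos p.+1))) * ent V (xg g) y +
  io (th (g (pos p)) (g (pos p.+1))) * ent V (xg (sp p * g)%g) y.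
Proof.
rewrite entM.
transitivity (\sum_z (io (bt (g (pos p)) (g (pos p.+1))) * ((z == xg g)%:R * ent V z y) +
  io (th (g (pos p)) (g (pos p.+1))) * ((z == xg (sp p * g)%g)%:R * ent V z y))).
  by apply: eq_bigr => z _; rewrite ent_map ent_HZ1 inX_xg rep_xg io_comb.
by rewrite big_split; congr (_ + _); rewrite -mulr_sumr sum_delta.
Qed.

Lemma ent_HR0 p V x y : ~~ inX x -> ent (HR p * V) x y = 0.
Proof.
by move=> /negPf nx; rewrite entM big1 // => z _; rewrite ent_map ent_HZ1 nx rmorph0 mul0r.
Qed.


Section Relations.

Lemma HZ_sq p : (p.+1 < d)%N ->
  HZ p * HZ p = DZ (st S (pos p) (pos p.+1)) * HZ p + DZ (rr S (pos p) (pos p.+1)).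
Proof.
move=> pd; have np : pos p != pos p.+1 by apply: pos_neq; lia.
(* Both sides are applied to the identity matrix, so that they become operators on functions of [g]
   and expand by [ent_HZ]. *)
rewrite -[X in _ = _ + X]mulr1 -[LHS]mulr1 -[X in _ = X + _]mulr1 -!mulrA.
apply: entXP => [x y nx|x y nx|g y].
- by rewrite ent_HZ0.
- by rewrite entD !ent_DZ0 ?addr0.
rewrite entD !ent_HZ /Hop !ent_DZ !ent_HZ /Hop.
rewrite !permM tpermL tpermR mulgA spK mul1g act_st // act_rr // /st /rr.
by move: (ent _ _ _) (ent _ _ _) => a b; ring.
Qed.

Lemma HZ_comm p q : (p.+1 < q)%N -> (q.+1 < d)%N -> HZ p * HZ q = HZ q * HZ p.
Proof.
move=> pq qd; rewrite -[LHS]mulr1 -[RHS]mulr1 -[LHS]mulrA -[RHS]mulrA.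
apply: entXP => [x y nx|x y nx|g y]; [by rewrite ent_HZ0|by rewrite ent_HZ0|].
rewrite !ent_HZ /Hop !ent_HZ /Hop !permM.
rewrite !tpermD ?mulgA ?(sp_com pq qd);
  try (apply: pos_neq; lia).
by move: (ent _ _ _) (ent _ _ _) (ent _ _ _) (ent _ _ _) => a b c e; ring.
Qed.

Lemma sp_braid p : (p.+2 < d)%N -> (sp p * (sp p.+1 * sp p) = sp p.+1 * (sp p * sp p.+1))%g.
Proof.
move=> pd; have E (s t : 'S_d) : (t * t = 1 -> t * (s * t) = s ^ t)%g.
  by move=> tt; rewrite /conjg; have -> : (t^-1 = t)%g by apply: (mulgI t); rewrite mulgV tt.
by rewrite !E ?spK // /sp !tpermJ tpermL tpermR !tpermD //; apply: pos_neq; lia.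
Qed.

Lemma HZ_braid p : (p.+2 < d)%N ->
  HZ p * (HZ p.+1 * HZ p) = HZ p.+1 * (HZ p * HZ p.+1).
Proof.
move=> pd; rewrite -[LHS]mulr1 -[RHS]mulr1 -[LHS]mulrA -[RHS]mulrA -[in LHS](mulrA (HZ p.+1)) -[in RHS](mulrA (HZ p)).
have n01 : pos p != pos p.+1 by apply: pos_neq; lia.
have n02 : pos p != pos p.+2 by apply: pos_neq; lia.
have n12 : pos p.+1 != pos p.+2 by apply: pos_neq; lia.
apply: entXP => [x y nx|x y nx|g y]; [by rewrite ent_HZ0|by rewrite ent_HZ0|].
have E2 : sp p (pos p.+2) = pos p.+2 by rewrite tpermD // eq_sym.
have E0 : sp p.+1 (pos p) = pos p by rewrite tpermD // eq_sym.
rewrite !ent_HZ /Hop !ent_HZ /Hop !ent_HZ /Hop.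
rewrite !permM ?(E0, E2, tpermL, tpermR) ?(E0, E2, tpermL, tpermR).
have G1 : (sp p * (sp p * g) = g)%g by rewrite mulgA spK mul1g.
have G2 : (sp p.+1 * (sp p.+1 * g) = g)%g by rewrite mulgA spK mul1g.
have G3 : (sp p * (sp p.+1 * (sp p * g)) = sp p.+1 * (sp p * (sp p.+1 * g)))%g.
  by have := sp_braid pd; rewrite !mulgA => ->.
rewrite G1 G2 G3.
have inj a b : a != b -> g a != g b by rewrite (inj_eq perm_inj).
have BS := @braid_scalar _ S _ _ _ (inj _ _ n01) (inj _ _ n02) (inj _ _ n12).
have Y1 := @btYB _ S _ _ _ (inj _ _ n01) (inj _ _ n02) (inj _ _ n12).
have Y2 := btYB_rev S (inj _ _ n01) (inj _ _ n02) (inj _ _ n12).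
move: BS Y1 Y2.
move: (g (pos p)) (g (pos p.+1)) (g (pos p.+2)) => a b c BS Y1 Y2.
move: (ent _ _ _) (ent _ _ _) (ent _ _ _) (ent _ _ _) (ent _ _ _) (ent _ _ _) => r0 r1 r2 r3 r4 r5.
(* Coefficients are compared: [BS] settles that of [r5], [Y1] that of [r4], [Y2] that of [r3]; the
   others agree already. *)
transitivity (r5 * (bt a b * bt a b * bt b c + th a b * th b a * bt a c) +
    th a b * r4 * (bt a c * bt b a + bt b c * bt a b) + th b c * r3 * (bt a b * bt a c) +
    (bt a b * th b c * th a c * r2 + th a b * th a c * bt b c * r1 + th a b * th a c * th b c * r0)).
  ring.
rewrite BS -Y1 Y2; ring.
Qed.
End Relations.
End Operators.

(** * A basis of PBW type *)

Section PBW.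
Variables (d' : nat) (S : datum d'.+1).
Notation d := d'.+1.
Notation Z := (dZ S).
Notation R := (dR S).
Notation HR := (HR S).
Notation DR := (@DR d' S).
Notation HZ := (HZ S).
Notation sp := (@sp d').
Notation pos := (@pos d').
Notation DZ := (@DZ d' S).
Implicit Types (g h w : 'S_d) (x y z : Y d) (p q n m k : nat) (A B : Mx d R).

Lemma isBt0 : isBt (0 : R).
Proof. by have := isBt_io (@isC_kz _ S 0); rewrite !rmorph0. Qed.
Lemma isBt1 : isBt (1 : R).
Proof. by have := isBt_io (@isC_kz _ S 1); rewrite !rmorph1. Qed.
Lemma mapZM (A B : Mx d Z) : map_mx io (A * B) = map_mx io A * map_mx io B :> Mx d R.
Proof. exact: map_mxM. Qed.
Lemma mapZD (A B : Mx d Z) : map_mx io (A + B) = map_mx io A + map_mx io B :> Mx d R.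
Proof. exact: map_mxD. Qed.

Lemma map_DZ (c : Z) : map_mx io (DZ c) = DR (io c).
Proof.
apply: entP => x y; rewrite ent_map ent_DZ1 ent_DR1; case: ifP => _; last exact: rmorph0.
by rewrite actR_io.
Qed.

Lemma DRD r s : DR (r + s) = DR r + DR s.
Proof.
apply: entP => x y; rewrite entD !ent_DR1; case: ifP => _; last by rewrite addr0.
exact: rmorphD.
Qed.
Lemma DR0 : DR 0 = 0.
Proof. by apply: entP => x y; rewrite ent0 ent_DR1 rmorph0 if_same. Qed.
Lemma DRM r s : DR r * DR s = DR (r * s).
Proof.
rewrite -[LHS]mulr1 -[RHS]mulr1 -[LHS]mulrA; apply: entXP => [x y nx|x y nx|g y].
- by rewrite ent_DR0.
- by rewrite ent_DR0.
by rewrite !ent_DR rmorphM mulrA.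
Qed.

(** The wreath relation H b = sigma(b) H + rho(b); that rho(b) is again integral is the axiom
    [isBt_rho]. *)
Lemma HR_DR p r : (p.+1 < d)%N -> HR p * DR r =
  DR (actR (sp p) r) * HR p +
  DR (io (bt (pos p) (pos p.+1)) * r - actR (sp p) r * io (bt (pos p) (pos p.+1))).
Proof.
move=> pd; have np : pos p != pos p.+1 :> 'I_d by apply: pos_neq; lia.
rewrite -[LHS]mulr1 -[RHS]mulr1 mulrDl -[LHS]mulrA -[X in X + _]mulrA.
apply: entXP => [x y nx|x y nx|g y].
- by rewrite ent_HR0.
- by rewrite entD !ent_DR0 ?addr0.
rewrite entD !ent_HR !ent_DR !ent_HR actRM rmorphB !rmorphM !actR_io act_bt //.
by rewrite mulrDr mulrBl !mulrA [io (th _ _) * _]ioC [RHS]addrC subrKA.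
Qed.

(** On constants rho vanishes, because [bt] absorbs the transposition. *)
Lemma HR_DR_const p (c : Z) : (p.+1 < d)%N -> isC c ->
  HR p * DR (io c) = DR (io (actZ (sp p) c)) * HR p.
Proof.
move=> pd Cc; have np : pos p != pos p.+1 :> 'I_d by apply: pos_neq; lia.
rewrite HR_DR // actR_io -!rmorphM (swapC Cc np) -/(sp p) [actZ _ c * _]mulrC -rmorphB.
by rewrite subrr rmorph0 DR0 addr0.
Qed.

Lemma HR_DR1 p : (p.+1 < d)%N -> HR p * DR 1 = DR 1 * HR p.
Proof.
move=> pd; rewrite HR_DR // !rmorph1 mulr1 mul1r subrr DR0 addr0 //.
Qed.

Lemma DR1_HR p : DR 1 * HR p = HR p.
Proof.
rewrite -[RHS]mulr1 -[LHS]mulr1 -[LHS]mulrA; apply: entXP => [x y nx|x y nx|g y].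
- by rewrite ent_DR0.
- by rewrite ent_HR0.
by rewrite ent_DR rmorph1 mul1r.
Qed.

Lemma HR_sq p : (p.+1 < d)%N -> HR p * HR p =
  DR (io (st S (pos p) (pos p.+1))) * HR p + DR (io (rr S (pos p) (pos p.+1))).
Proof. by move=> pd; rewrite -mapZM HZ_sq // mapZD mapZM !map_DZ. Qed.

Lemma HR_comm p q : (p.+1 < q)%N -> (q.+1 < d)%N -> HR p * HR q = HR q * HR p.
Proof. by move=> pq qd; rewrite -!mapZM HZ_comm. Qed.

Lemma HR_braid p : (p.+2 < d)%N ->
  HR p * HR p.+1 * HR p = HR p.+1 * HR p * HR p.+1.
Proof. by move=> pd; rewrite -!mulrA -!mapZM HZ_braid. Qed.

(** The word H_{m-1} ... H_{m-k}, lifting a minimal coset representative of S_m in S_{m+1}. In [cp]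
    the factors come in reverse order, since each further H multiplies [g] from the left. *)
Fixpoint Cw m k : Mx d R := if k is k'.+1 then Cw m k' * HR (m - k'.+1) else DR 1.
Fixpoint cp m k : 'S_d := if k is k'.+1 then (sp (m - k'.+1) * cp m k')%g else 1%g.

Lemma Cw_comm m k p : (p.+1 < m - k)%N -> (m < d)%N -> Cw m k * HR p = HR p * Cw m k.
Proof.
elim: k => [|k IH] pm md /=; first by rewrite HR_DR1 //; lia.
rewrite -mulrA -HR_comm; [|lia|lia].
by rewrite !mulrA IH; [|lia|].
Qed.

(** The factor moves left by far commutation until a braid move lowers its index; it then commutes
    with what is left. *)
Lemma Cw_braid m k p : (k <= m)%N -> (m - k <= p)%N -> (p.+1 < m)%N -> (m < d)%N ->
  Cw m k * HR p.+1 = HR p * Cw m k.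
Proof.
elim: k => [|k IH] km mk pm md; first by lia.
rewrite [Cw _ _]/=; have [Ep|np] := eqVneq p (m - k.+1)%N; last first.
  rewrite -mulrA HR_comm; [|lia|lia].
  by rewrite !mulrA IH; [|lia|lia|lia|].
case: k km Ep {IH mk} => [|k] km Ep; first by lia.
rewrite /= -!Ep; have -> : (m - k.+1 = p.+1)%N by lia.
rewrite -!mulrA [HR p.+1 * (_ * _)]mulrA -HR_braid ?mulrA ?Cw_comm //; lia.
Qed.

Lemma Cw_const m k (c : Z) : (m < d)%N -> (k <= m)%N -> isC c ->
  Cw m k * DR (io c) = DR (io (actZ (cp m k) c)) * Cw m k.
Proof.
move=> md; elim: k c => [|k IH] c km Cc; rewrite [Cw _ _]/= [cp _ _]/=.
  by rewrite !DRM mul1r mulr1 actZ1.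
rewrite -mulrA HR_DR_const; [|lia|by []].
rewrite mulrA IH; [|lia|exact: isC_act].
by rewrite -mulrA -actZM.
Qed.

Definition Sn n w : bool := [forall i : 'I_d, (n <= i)%N ==> (w i == i)].

Lemma SnP n w : reflect (forall i : 'I_d, (n <= i)%N -> w i = i) (Sn n w).
Proof.
apply: (iffP forallP) => H i; first by move=> ni; apply/eqP/(implyP (H i)).
by apply/implyP => ni; apply/eqP/H.
Qed.

Lemma Sn1 n : Sn n 1%g.
Proof. by apply/SnP => i _; rewrite perm1. Qed.

Lemma Sn_mul n g h : Sn n g -> Sn n h -> Sn n (g * h)%g.
Proof. by move=> /SnP gn /SnP hn; apply/SnP => i ni; rewrite permM gn ?hn. Qed.

Lemma Sn_inv n g : Sn n g -> Sn n g^-1%g.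
Proof. by move=> /SnP gn; apply/SnP => i ni; apply: (@perm_inj _ g); rewrite permKV gn. Qed.

Lemma Sn_le n m g : (n <= m)%N -> Sn n g -> Sn m g.
Proof. by move=> nm /SnP gn; apply/SnP => i mi; apply: gn; lia. Qed.

Lemma Sn_sp n p : (p.+1 < n)%N -> (n <= d)%N -> Sn n (sp p).
Proof.
move=> pn nd; apply/SnP => i ni; rewrite tpermD //; apply/eqP => /(congr1 val) /=;
  rewrite inordK; lia.
Qed.

Lemma Sn_cp m k : (m < d)%N -> (k <= m)%N -> Sn m.+1 (cp m k).
Proof.
move=> md; elim: k => [|k IH] km; first exact: Sn1.
by apply: Sn_mul (IH _); [apply: Sn_sp; lia|lia].
Qed.

Lemma cpV m k : (m < d)%N -> (k <= m)%N -> (cp m k)^-1%g (pos m) = pos (m - k).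
Proof.
move=> md; elim: k => [|k IH] km; first by rewrite /= invg1 perm1 subn0.
rewrite [cp _ _]/= invMg permM IH; last lia.
by rewrite tpermV; have -> : (m - k = (m - k.+1).+1)%N by [lia]; rewrite tpermR.
Qed.

(** [k] is the distance of slot [m] from the last place in [w]; splitting off the corresponding
    cycle leaves an element of S_m, by [Sn_cpV_mul]. *)
Fixpoint Lw n w : Mx d R := if n is m.+1 then
  let k := (m - w^-1%g (pos m))%N in Lw m ((cp m k)^-1 * w)%g * Cw m k else DR 1.

(** Only spanning is recorded here; the coefficients are recovered later from leading terms. *)
Definition Un n A := exists b : 'S_d -> R, (forall w, isBt (b w)) /\
  A = \sum_(w | Sn n w) DR (b w) * Lw n w.

Lemma Un_gen n w r : Sn n w -> isBt r -> Un n (DR r * Lw n w).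
Proof.
move=> wn Br; exists (fun w' => if w' == w then r else 0); split.
  by move=> w'; case: ifP => _ //; apply: isBt0.
rewrite (bigD1 w) //= eqxx big1 ?addr0 // => w' /andP[_ /negPf ->].
by rewrite DR0 mul0r.
Qed.

Lemma Un_add n A B : Un n A -> Un n B -> Un n (A + B).
Proof.
move=> [a [Ba ->]] [b [Bb ->]]; exists (fun w => a w + b w); split.
  by move=> w; apply: isBtD.
by rewrite -big_split; apply: eq_bigr => w _; rewrite DRD mulrDl.
Qed.

Lemma Un0 n : Un n 0.
Proof.
exists (fun _ => 0); split; first by move=> _; apply: isBt0.
by rewrite big1 // => w _; rewrite DR0 mul0r.
Qed.

Lemma Un_ind n (P : Mx d R -> Prop) : P 0 -> (forall A B, P A -> P B -> P (A + B)) ->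
  (forall r w, isBt r -> Sn n w -> P (DR r * Lw n w)) -> forall A, Un n A -> P A.
Proof. by move=> P0 PD PL A [b [Bb ->]]; apply: big_ind => // w wn; apply: PL. Qed.

Lemma Un_succ m k A : (m < d)%N -> (k <= m)%N -> Un m A -> Un m.+1 (A * Cw m k).
Proof.
move=> md km; elim/Un_ind => [|A1 A2 U1 U2|s w Bs wn].
- by rewrite mul0r; apply: Un0.
- by rewrite mulrDl; apply: Un_add.
have H : Sn m.+1 (cp m k * w)%g by apply: Sn_mul (Sn_cp md km) (Sn_le (leqnSn m) wn).
have := Un_gen H Bs.
rewrite /= invMg permM; have -> : w^-1%g (pos m) = pos m.
  by have /SnP -> := Sn_inv wn; rewrite // inordK.
rewrite cpV // inordK; last lia.
have -> : (m - (m - k) = k)%N by lia.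
by rewrite mulKg mulrA.
Qed.

Lemma Sn_cpV_mul m w : (m < d)%N -> Sn m.+1 w ->
  Sn m ((cp m (m - w^-1%g (pos m)))^-1 * w)%g.
Proof.
move=> md wn; apply/SnP => i mi; rewrite permM.
set k := (m - _)%N.
have km : (k <= m)%N by rewrite /k; lia.
have wi : (w^-1%g (pos m) <= m)%N.
  rewrite leqNgt; apply/negP => H; have /SnP/(_ _ H) := Sn_inv wn.
  by move/perm_inj => E; move: H; rewrite E inordK // ltnn.
have [im|im] := eqVneq (i : nat) m; last first.
  have /SnP -> := Sn_inv (Sn_cp md km); last by lia.
  by move/SnP: wn => -> //; lia.
have -> : i = pos m by apply: val_inj => /=; rewrite inordK.
rewrite cpV // /k.
have -> : (m - (m - w^-1%g (pos m)) = w^-1%g (pos m))%N by lia.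
by rewrite /pos inord_val permKV.
Qed.

Lemma Un_ind_succ m (P : Mx d R -> Prop) : (m < d)%N -> P 0 ->
  (forall A B, P A -> P B -> P (A + B)) ->
  (forall A k, (k <= m)%N -> Un m A -> P (A * Cw m k)) -> forall A, Un m.+1 A -> P A.
Proof.
move=> md P0 PD PL A; elim/Un_ind => {A} // r w Br wn.
rewrite [Lw _ _]/= mulrA; apply: PL; first by lia.
by apply: Un_gen => //; apply: Sn_cpV_mul.
Qed.

Inductive Wd n : Mx d R -> Prop :=
| Wd1 : Wd n (DR 1)
| WdH A p : Wd n A -> (p.+1 < n)%N -> Wd n (A * HR p).

Lemma Wd_le n m A : (n <= m)%N -> Wd n A -> Wd m A.
Proof. by move=> nm; elim=> [|B p _ IH pn]; constructor => //; lia. Qed.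

Lemma Wd_Cw n A m k : (m < n)%N -> (k <= m)%N -> (n <= d)%N -> Wd n A -> Wd n (A * Cw m k).
Proof.
move=> mn; elim: k => [|k IH] km nd WA /=.
  elim: WA => [|B p WB IHB pn]; first by rewrite DRM mulr1; constructor.
  by rewrite -mulrA HR_DR1 ?DR1_HR; [constructor|lia].
by rewrite mulrA; constructor; [apply: IH => //; lia|lia].
Qed.

Lemma Wd_Lw n w : (n <= d)%N -> Wd n (Lw n w).
Proof.
elim: n w => [|m IH] w nd /=; first by constructor.
apply: Wd_Cw => //; first by lia.
by apply: Wd_le (IH _ _); lia.
Qed.

Lemma Lw1 n : (n <= d)%N -> Lw n 1%g = DR 1.
Proof.
elim: n => // m IH md; rewrite /= invg1 perm1 inordK // subnn /= invg1 mulg1 IH; last lia.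
by rewrite DRM mulr1.
Qed.

Lemma Un_base n r : (n <= d)%N -> isBt r -> Un n (DR r).
Proof.
move=> nd Br; rewrite -[r]mulr1 -DRM -(Lw1 nd); apply: Un_gen => //; exact: Sn1.
Qed.

(** Straightening, by induction along S_m in S_{m+1}. Both closure properties are needed together:
    the quadratic relation puts constants in the middle of a word, and moving B past a word produces
    shorter words. *)
Lemma Un_closed n : (n <= d)%N ->
  (forall A r, Un n A -> isBt r -> Un n (A * DR r)) /\
  (forall A p, Un n A -> (p.+1 < n)%N -> Un n (A * HR p)).
Proof.
elim: n => [|m IH] nd.
  split=> [A r UA Br|]; last by [].
  elim/Un_ind: UA => [|A1 A2 U1 U2|s w Bs wn].
  - by rewrite mul0r; apply: Un0.
  - by rewrite mulrDl; apply: Un_add.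
  rewrite -mulrA [Lw _ _]/= DRM mul1r -[r]mulr1 -DRM mulrA DRM.
  by apply: (@Un_gen 0 w) => //; apply: isBtM.
have [IHa IHb] := IH (ltnW nd).
have IHc A B : Un m A -> Un m B -> Un m (A * B).
  move=> UA; elim/Un_ind => [|B1 B2|s w Bs wn].
  - by rewrite mulr0; apply: Un0.
  - by rewrite mulrDr; apply: Un_add.
  rewrite mulrA; have := IHa _ _ UA Bs; move: (A * _) => A'.
  have := Wd_Lw w (ltnW nd); elim => [|C p _ IHC pm] UA'; first exact: IHa isBt1.
  by rewrite mulrA; apply: IHb => //; apply: IHC.
have Pb A p : Un m.+1 A -> (p.+1 < m.+1)%N -> Un m.+1 (A * HR p).
  move=> UA pm; elim/Un_ind_succ: UA => // [|A1 A2|{}A k km UA].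
  - by rewrite mul0r; apply: Un0.
  - by rewrite mulrDl; apply: Un_add.
  (* [HR p] commutes with the descending word, prolongs it, passes through it with a lower index, or
     squares its last factor. *)
  have [pk|pk|pk] := ltngtP p (m - k).
  - have [pk1|pk1] := ltnP p.+1 (m - k).
      by rewrite -mulrA Cw_comm // mulrA; apply: Un_succ => //; apply: IHb => //; lia.
    have -> : p = (m - k.+1)%N by lia.
    by rewrite -mulrA; apply: (@Un_succ m k.+1) => //; lia.
  - case: p pm pk => // p pm pk.
    by rewrite -mulrA Cw_braid // mulrA; apply: Un_succ => //; apply: IHb => //; lia.
  case: k km pk => [|k] km pk; first by lia.
  rewrite [Cw _ _]/= -pk -!mulrA HR_sq; last lia.
  have np : pos p != pos p.+1 :> 'I_d by apply: pos_neq; lia.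
  have C1 := @isC_st _ S _ _ np; have C2 := @isC_rr _ S _ _ np.
  have km' : (k <= m)%N by lia.
  rewrite mulrDr mulrA !Cw_const // mulrDr; apply: Un_add.
    have -> : A * (DR (io (actZ (cp m k) (st S (pos p) (pos p.+1)))) * Cw m k * HR p) =
      (A * DR (io (actZ (cp m k) (st S (pos p) (pos p.+1))))) * Cw m k.+1.
      by rewrite /= -pk !mulrA.
    by apply: Un_succ => //; apply: IHa => //; apply/isBt_io/isC_act.
  by rewrite mulrA; apply: Un_succ => //; apply: IHa => //; apply/isBt_io/isC_act.
split=> // A r UA Br.
(* At each factor, moving [s] to the left leaves a term with rho(s) on a shorter word. *)
have key k s : (k <= m)%N -> isBt s -> Un m.+1 (Cw m k * DR s).
  elim: k s => [|k IHk] s km Bs.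
    rewrite [Cw _ _]/= DRM mul1r -[s]mulr1 -DRM.
    by apply: (@Un_succ m 0) => //; apply: Un_base => //; lia.
  rewrite [Cw _ _]/= -mulrA HR_DR; last lia.
  rewrite mulrDr mulrA; apply: Un_add; last first.
    by apply: IHk; [lia|apply: isBt_rho => //; apply: pos_neq; lia].
  by apply: Pb; [apply: IHk; [lia|exact: isBt_act]|lia].
elim/Un_ind_succ: UA => // [|A1 A2 U1 U2|{}A k km UA].
- by rewrite mul0r; apply: Un0.
- by rewrite mulrDl; apply: Un_add.
rewrite -mulrA; elim/Un_ind_succ: (key k r km Br) => // [|B1 B2 U1 U2|B k' km' UB].
- by rewrite mulr0; apply: Un0.
- by rewrite mulrDr; apply: Un_add.
by rewrite mulrA; apply: Un_succ => //; apply: IHc.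
Qed.

Lemma UdM A B : Un d A -> Un d B -> Un d (A * B).
Proof.
have [Ua Ub] := Un_closed (leqnn d).
move=> UA; elim/Un_ind => [|B1 B2|s w Bs wn].
- by rewrite mulr0; apply: Un0.
- by rewrite mulrDr; apply: Un_add.
rewrite mulrA; have := Ua _ _ UA Bs; move: (A * _) => A'.
have := Wd_Lw w (leqnn d); elim => [|C p _ IHC pm] UA'; first exact: Ua isBt1.
by rewrite mulrA; apply: Ub => //; apply: IHC.
Qed.

Lemma Ud_HR p : (p.+1 < d)%N -> Un d (HR p).
Proof.
move=> pd; rewrite -DR1_HR; apply: (Un_closed (leqnn d)).2 => //.
by apply: Un_base => //; apply: isBt1.
Qed.
End PBW.

(** * The symmetrizers K_lambda *)

Section Symmetrizers.
Variables (d' : nat) (S : datum d'.+1).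
Notation d := d'.+1.
Notation Z := (dZ S).
Notation R := (dR S).
Notation HR := (HR S).
Notation DR := (@DR d' S).
Notation HZ := (HZ S).
Notation DZ := (@DZ d' S).
Notation sp := (@sp d').
Notation pos := (@pos d').
Implicit Types (g h t w : 'S_d) (x y z u v : Y d) (p q n m k a : nat) (A B : Mx d R) (i j : 'I_d).

Lemma th_expand_set (I : {set 'I_d}) g (n : 'I_d) : n \notin I ->
  \prod_(i in I) th (g i) (g n) = \prod_(i in I) al (g i) (g n) +
     \sum_(i in I) bt (g i) (g n) * \prod_(j in I | j != i) th (g j) (g i) :> Z.
Proof.
move=> nI; have us : uniq (g n :: [seq g i | i <- enum I]).
  by rewrite /= (mem_map perm_inj) mem_enum nI map_inj_uniq ?enum_uniq //; apply: perm_inj.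
have := th_expand S us; rewrite !big_map !big_enum /= => ->; congr (_ + _).
apply: eq_bigr => i iI; rewrite big_map big_enum_cond /=; congr (_ * _).
by apply: eq_bigl => j; rewrite (inj_eq perm_inj).
Qed.

(** [Tri a n] is the Theta factor of a block [a,n), and [Col a n] is the column gained when position
    n joins it. *)
Definition Col a n g : Z := \prod_(i : 'I_d | (a <= i < n)%N) th (g i) (g (pos n)).
Definition Tri a n g : Z := \prod_(j : 'I_d | (j < n)%N) \prod_(i : 'I_d | (a <= i < j)%N) th (g i) (g j).

Lemma Tri_succ a n g : (n < d)%N -> Tri a n.+1 g = Tri a n g * Col a n g.
Proof.
move=> nd; rewrite /Tri (bigD1 (pos n)) /=; last by rewrite inordK.
rewrite mulrC; congr (_ * _); last by apply: eq_bigl => i; rewrite inordK.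
apply: eq_bigl => j; rewrite -val_eqE /= inordK //; lia.
Qed.

Lemma sp_out m i : (m.+1 < d)%N -> i != m :> nat -> i != m.+1 :> nat -> sp m i = i.
Proof.
by move=> md im im1; rewrite tpermD // -val_eqE /= inordK 1?eq_sym //; lia.
Qed.

Lemma Tri_sp a m g : (m.+1 < d)%N ->
  Tri a m.+1 (sp m * g)%g = Tri a m g * \prod_(i : 'I_d | (a <= i < m)%N) th (g i) (g (pos m.+1)).
Proof.
move=> md; rewrite Tri_succ; last lia; congr (_ * _).
  apply: eq_bigr => j jm; apply: eq_bigr => i /andP[ai ij].
  by rewrite !permM !sp_out //; lia.
apply: eq_bigr => i /andP[ai im]; rewrite !permM tpermL sp_out //; lia.
Qed.

Lemma Col_succ a m g n' : (a <= m)%N -> (m < d)%N -> pos n' = pos m.+1 ->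
  \prod_(i : 'I_d | (a <= i < m.+1)%N) th (g i) (g (pos n')) =
   th (g (pos m)) (g (pos m.+1)) * \prod_(i : 'I_d | (a <= i < m)%N) th (g i) (g (pos m.+1)) :> Z.
Proof.
move=> am md ->; rewrite (bigD1 (pos m)) /=; last by rewrite inordK // am leqnn.
congr (_ * _); apply: eq_bigl => i; rewrite -val_eqE /= inordK //; lia.
Qed.

(** Unrolled, this is the sum over j of A_j H_{a+j} ... H_{a+k-1}, with A_j the product of the
    alphas between a+j and the earlier positions of the block: a weighted sum over minimal coset
    representatives of the symmetric group of [a,a+k) in that of [a,a+k]. *)
Fixpoint hop a k (v : 'S_d -> Z) g : Z := if k is k'.+1 then
   (\prod_(i : 'I_d | (a <= i < (a + k').+1)%N) al (g i) (g (pos (a + k').+1))) * v g +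
   hop a k' (Hop (a + k') v) g else v g.

Lemma hop_ext a k (v v' : 'S_d -> Z) g : v =1 v' -> hop a k v g = hop a k v' g.
Proof. by move/functional_extensionality => ->. Qed.

Definition fixout a n t := forall i, ~~ (a <= i < n)%N -> t i = i.

Lemma fixout_in a n t i : fixout a n t -> (a <= t i < n)%N = (a <= i < n)%N.
Proof.
move=> ft; apply/idP/idP => [H|H]; last first.
  apply: contraTT H => /[dup] H /ft /perm_inj E; by move: H; rewrite E.
by apply: contraTT H => /[dup] H /ft ->.
Qed.

Lemma fixout_tperm a n i j : (a <= i < n)%N -> (a <= j < n)%N -> fixout a n (tperm i j).
Proof. by move=> Hi Hj m Hm; rewrite tpermD //; apply: contraNneq Hm => <-. Qed.

Lemma prod_fixout a n t (F : 'I_d -> Z) : fixout a n t ->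
  \prod_(i : 'I_d | (a <= i < n)%N) F (t i) = \prod_(i : 'I_d | (a <= i < n)%N) F i.
Proof.
move=> ft; rewrite [RHS](reindex_inj (@perm_inj _ t)) /=.
by apply: eq_bigl => i; rewrite fixout_in.
Qed.

(** The operator enlarges a symmetrization over [a,a+k) to one over [a,a+k], the transpositions with
    a+k being the coset representatives. All poles and alphas recombine into the single factor [Tri]
    by [th_expand_set]. *)
Lemma hop_spec a k (s : 'S_d -> Z) g : (a + k < d)%N ->
  (forall t h, fixout a (a + k) t -> s (t * h)%g = s h) ->
  hop a k (fun h => Tri a (a + k) h * s h) g =
  Tri a (a + k).+1 g * \sum_(i : 'I_d | (a <= i <= a + k)%N) s (tperm i (pos (a + k)) * g)%g.
Proof.
elim: k s g => [|k IH] s g akd inv.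
  rewrite /= addn0 Tri_succ; last lia.
  rewrite /Col big1 ?mulr1 => [|i]; last lia.
  rewrite (big_pred1 (pos a)) => [|i]; first by rewrite tperm1 mul1g.
  by rewrite /= -val_eqE /= inordK; lia.
set m := (a + k)%N in IH *.
have E : (a + k.+1 = m.+1)%N by rewrite addnS.
rewrite {}E in akd inv *.
rewrite [hop _ _ _ _]/= -/m.
(* What is left of [Hop m] applied to the input once [Tri a m] is factored out; it is again
   invariant, under the smaller block. *)
pose s' h := bt (h (pos m)) (h (pos m.+1)) * Col a m h * s h + Col a m.+1 h * s (sp m * h)%g.
have am : (a <= m)%N by rewrite /m leq_addr.
have md : (m < d)%N by lia.
have Es' : Hop m (fun h => Tri a m.+1 h * s h) =1 fun h => Tri a m h * s' h.
  move=> h; rewrite /Hop Tri_sp // Tri_succ // /s' [Col a m.+1 h]Col_succ //.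
  by move: (s h) (s _) (Tri _ _ _) (Col _ _ _) (\prod_(i | _) _) => s1 s2 T1 C1 P1; ring.
rewrite (hop_ext _ _ _ Es') IH //; last first.
  move=> t h ft; have tm : t (pos m) = pos m by apply: ft; rewrite inordK // ltnn andbF.
  have tm1 : t (pos m.+1) = pos m.+1 by apply: ft; rewrite inordK //; lia.
  have ft1 : fixout a m.+1 t by move=> i Hi; apply: ft; lia.
  rewrite /s' !permM tm tm1 inv //; congr (_ * _ * _ + _ * _).
  - by rewrite -[RHS](prod_fixout (fun i => th (h i) (h (pos m))) ft);
      apply: eq_bigr => i _; rewrite !permM tm.
  - by rewrite -[RHS](prod_fixout (fun i => th (h i) (h (pos m.+1))) ft1);
      apply: eq_bigr => i _; rewrite !permM tm1.
  have spt : (sp m * t = t * sp m)%g by rewrite [LHS]conjgC /sp tpermJ tm tm1.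
  by rewrite mulgA spt -mulgA (inv t).
have Es i : (a <= i <= m)%N -> s' (tperm i (pos m) * g)%g =
    bt (g i) (g (pos m.+1)) * (\prod_(j : 'I_d | (a <= j < m.+1)%N && (j != i)) th (g j) (g i)) * s g +
    Col a m.+1 g * s (tperm i (pos m.+1) * g)%g.
  move=> /andP[ai im].
  have fi : fixout a m.+1 (tperm i (pos m)) by apply: fixout_tperm; rewrite ?inordK //; lia.
  have pm1 : tperm i (pos m) (pos m.+1) = pos m.+1 by apply: fi; rewrite inordK //; lia.
  rewrite /s' !permM tpermR pm1 (inv _ g fi); congr (_ * _ * _ + _ * _).
  - rewrite [RHS](reindex_inj (@perm_inj _ (tperm i (pos m)))) /Col.
    apply: eq_big => [j|j _]; last by rewrite !permM tpermR.
    rewrite (fixout_in _ fi) -[X in _ != X](tpermR i (pos m)) (inj_eq perm_inj) -val_eqE /= inordK //; lia.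
  - rewrite -[RHS](prod_fixout (fun j => th (g j) (g (pos m.+1))) fi).
    by apply: eq_bigr => j _; rewrite !permM pm1.
  have [->|ne] := eqVneq i (pos m); first by rewrite tperm1 mul1g.
  rewrite -(inv (tperm i (pos m))) //; congr (s _).
  have E : (tperm i (pos m.+1) = tperm i (pos m) * (sp m * tperm i (pos m)))%g.
    have := tpermJ (pos m) (pos m.+1) (tperm i (pos m)).
    by rewrite /conjg tpermV tpermR pm1 => <-.
  by rewrite E -mulgA -mulgA.
rewrite (eq_bigr _ Es) big_split /= -mulr_suml -mulr_sumr.
rewrite [Tri a m.+2 g]Tri_succ // [X in _ = _ * X](bigD1 (pos m.+1)) /=; last by rewrite inordK //; lia.
rewrite tperm1 mul1g.
have -> : \sum_(i < d | (a <= i <= m.+1)%N && (i != pos m.+1)) s (tperm i (pos m.+1) * g)%g =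
   \sum_(i < d | (a <= i <= m)%N) s (tperm i (pos m.+1) * g)%g.
  by apply: eq_bigl => i; rewrite -val_eqE /= inordK //; lia.
(* The alpha term and all the beta terms add up to the full column, which is the summand of the
   trivial transposition. *)
have : Col a m.+1 g = \prod_(i < d | (a <= i < m.+1)%N) al (g i) (g (pos m.+1)) +
   \sum_(i < d | (a <= i <= m)%N) bt (g i) (g (pos m.+1)) *
      \prod_(j < d | (a <= j < m.+1)%N && (j != i)) th (g j) (g i).
  have := @th_expand_set [set i : 'I_d | (a <= i < m.+1)%N] g (pos m.+1).
  rewrite inE inordK // ltnn andbF => /(_ isT).
  under eq_bigl do rewrite inE.
  under [X in _ = X + _]eq_bigl do rewrite inE.
  under [X in _ = _ + X]eq_bigl do rewrite inE ltnS.
  rewrite /Col => ->; congr (_ + _); apply: eq_bigr => i _; congr (_ * _).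
  by apply: eq_bigl => j; rewrite inE.
by move=> ->; move: (s g) (Tri _ _ _) => s1 T1; ring.
Qed.

End Symmetrizers.

Lemma mkY_eqE d (D : {set 'I_d}) (g h : 'S_d) : validD D ->
  (mkY D h == mkY D g) = ((h * g^-1)%g \in Young D).
Proof.
move=> vD; apply/eqP/idP => [/(congr1 val) [/= E]|H]; last by apply: mkY_eq; rewrite vcut_id.
by move: E; rewrite vcut_id // -mem_cosetY => <-; apply: cosetY_refl.
Qed.

Lemma sum_X d (T : nmodType) (F : Y d -> T) : \sum_(x | inX x) F x = \sum_g F (xg g).
Proof.
rewrite (reindex (@xg d)) /=; first by apply: eq_bigl => g; rewrite inX_xg.
by exists (@rep d) => [g _|x]; [exact: rep_xg|exact: xg_rep].
Qed.

Lemma ltn_blk_cut d (D : {set 'I_d}) (c i j : 'I_d) : c \in D -> (i < c)%N -> (c <= j)%N ->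
  (blk D i < blk D j)%N.
Proof. by move=> cD ic cj; rewrite ltn_blk; apply/existsP; exists c; rewrite cD ic. Qed.

Section Klam.
Variables (d' : nat) (S : datum d'.+1).
Notation d := d'.+1.
Notation Z := (dZ S).
Notation R := (dR S).
Notation HR := (HR S).
Notation DR := (@DR d' S).
Notation HZ := (HZ S).
Notation DZ := (@DZ d' S).
Notation sp := (@sp d').
Notation pos := (@pos d').
Implicit Types (g h t w : 'S_d) (x y z u v : Y d) (p q n m k a : nat) (A B : Mx d R) (i j : 'I_d)
  (D lam nu : {set 'I_d}).

Definition thet u v : Z :=
  \prod_(p : 'I_d * 'I_d | lt u p.1 p.2 && ~~ lt v p.1 p.2) th p.1 p.2.

Lemma SZ_subproof : {A : {set 'I_d} -> {set 'I_d} -> Mx d Z | forall nu lam y y',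
  ent (A nu lam) y y' =
    if [&& lamY y == nu, lamY y' == lam & proj lam y == y'] then thet y y' else 0}.
Proof.
exists (fun nu lam => mk (fun y y' =>
  if [&& lamY y == nu, lamY y' == lam & proj lam y == y'] then thet y y' else 0)) => *.
exact: ent_mk.
Qed.
Definition SZ := sval SZ_subproof.
Definition ent_SZ1 : forall nu lam y y', ent (SZ nu lam) y y' = _ := svalP SZ_subproof.

Lemma MZ_subproof : {A : {set 'I_d} -> {set 'I_d} -> Mx d Z | forall lam nu y' y,
  ent (A lam nu) y' y = [&& lamY y' == lam, lamY y == nu & proj lam y == y']%:R}.
Proof.
exists (fun lam nu => mk (fun y' y =>
  [&& lamY y' == lam, lamY y == nu & proj lam y == y']%:R)) => *.
exact: ent_mk.
Qed.
Definition MZ := sval MZ_subproof.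
Definition ent_MZ1 : forall lam nu y' y, ent (MZ lam nu) y' y = _ := svalP MZ_subproof.

Definition KZ lam := SZ (omegaD d) lam * MZ lam (omegaD d).

Lemma ent_SZ nu lam V y y' : validD lam -> ent (SZ nu lam * V) y y' =
  if lamY y == nu then thet y (proj lam y) * ent V (proj lam y) y' else 0.
Proof.
move=> vl; rewrite entM (bigD1 (proj lam y)) //= big1 => [|z /negPf nz]; rewrite ent_SZ1.
  by rewrite lamY_proj // !eqxx !andbT addr0; case: ifP => // _; rewrite mul0r.
by rewrite [_ == z]eq_sym nz !andbF mul0r.
Qed.

Lemma ent_MZ lam V u y : lamY u = lam ->
  ent (MZ lam (omegaD d) * V) u y = \sum_(g | proj lam (xg g) == u) ent V (xg g) y.
Proof.
move=> ul; rewrite entM.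
transitivity (\sum_(x | inX x) (proj lam x == u)%:R * ent V x y).
  rewrite [RHS]big_mkcond; apply: eq_bigr => x _; rewrite ent_MZ1 ul eqxx /inX.
  by case: (lamY x == _); rewrite //= mul0r.
rewrite sum_X [RHS]big_mkcond; apply: eq_bigr => g _.
by case: (proj _ _ == _); rewrite ?mul1r ?mul0r.
Qed.

(** The value of Theta from the total order [g] to its class of type [D], by [thet_PiD]. *)
Definition PiD D g : Z := \prod_(p : 'I_d * 'I_d | (p.1 < p.2)%N && ~~ crossN D p.1 p.2)
  th (g p.1) (g p.2).

Lemma thet_PiD D g : validD D -> thet (xg g) (mkY D g) = PiD D g.
Proof.
move=> vD; pose f (p : 'I_d * 'I_d) := (g p.1, g p.2).
have fi : injective f by move=> [a b] [a' b'] [] /perm_inj -> /perm_inj ->.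
rewrite /thet (reindex_inj fi) /=; apply: eq_bigl => p.
by rewrite lt_xg lt_mkY vcut_id // !permK.
Qed.

(** M sums over a fibre of X -> Y_D, which is a coset of the Young subgroup, and S multiplies by
    Theta: K_D is a weighted symmetrizer. *)
Lemma ent_KZ D V g y : validD D ->
  ent (KZ D * V) (xg g) y = PiD D g * \sum_(s in Young D) ent V (xg (s * g)%g) y.
Proof.
move=> vD; rewrite /KZ -mulrA ent_SZ // lamY_mkY vcut_omega eqxx.
have pr h : proj D (xg h) = mkY D h by rewrite proj_mkY // rep_xg.
rewrite !pr thet_PiD // ent_MZ ?lamY_mkY ?vcut_id //; congr (_ * _).
rewrite (reindex_inj (mulIg g)) /=; apply: eq_bigl => s.
by rewrite pr mkY_eqE // mulgK.
Qed.

Lemma ent_KZ0 D V x y : validD D -> ~~ inX x -> ent (KZ D * V) x y = 0.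
Proof. by move=> vD nx; rewrite /KZ -mulrA ent_SZ // ifN. Qed.

Fixpoint hM a k : Mx d Z := if k is k'.+1 then
   DZ (\prod_(i : 'I_d | (a <= i < (a + k').+1)%N) al i (pos (a + k').+1)) +
   hM a k' * HZ (a + k') else DZ 1.

Lemma ent_hM a k V g y : (a + k < d)%N -> ent (hM a k * V) (xg g) y = hop a k (fun h => ent V (xg h) y) g.
Proof.
elim: k V g => [|k IH] V g akd; first by rewrite /= ent_DZ rmorph1 mul1r.
rewrite [hM _ _]/= mulrDl entD ent_DZ -mulrA IH; last lia.
rewrite [hop _ _ _ _]/=; congr (_ * _ + _); last first.
  by apply: hop_ext => h; rewrite ent_HZ.
rewrite rmorph_prod; apply: eq_bigr => i /andP[_ im]; apply: act_al.
by rewrite -val_eqE /= inordK; lia.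
Qed.

Lemma ent_hM0 a k V x y : ~~ inX x -> ent (hM a k * V) x y = 0.
Proof.
move=> nx; elim: k V => [|k IH] V /=; first by rewrite ent_DZ0.
by rewrite mulrDl entD ent_DZ0 // add0r -mulrA IH.
Qed.

(** A factor invariant under the permutations of the block commutes with every H that occurs. *)
Lemma hop_scale a k n (c : 'S_d -> Z) (v : 'S_d -> Z) g : (a + k < d)%N -> n = (a + k).+1 ->
  (forall t h, fixout a n t -> c (t * h)%g = c h) ->
  hop a k (fun h => c h * v h) g = c g * hop a k v g.
Proof.
elim: k v n g => [|k IH] v n g akd -> inv //=.
have E : Hop (a + k) (fun h => c h * v h) =1 fun h => c h * Hop (a + k) v h.
  move=> h; rewrite /Hop inv; last by apply: fixout_tperm; rewrite inordK; lia.
  by ring.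
rewrite (hop_ext _ _ _ E) (IH _ (a + k).+1) //; [by ring|lia|].
by move=> t h ft; apply: inv => i Hi; apply: ft; lia.
Qed.

Section Step.
Variables (D : {set 'I_d}) (n a : nat).
Hypotheses (vD : validD D) (n0 : (0 < n)%N) (nd : (n < d)%N) (nD : pos n \notin D)
  (Dn : forall c : 'I_d, (n < c)%N -> c \in D) (an : (a < n)%N)
  (Da : (0 < a)%N -> pos a \in D) (Dan : forall c : 'I_d, (a < c <= n)%N -> c \notin D).
Notation D1 := (pos n |: D).

Lemma D1_valid : validD D1.
Proof.
apply/forallP => c; apply/implyP; rewrite !inE => /orP[/eqP ->|]; first by rewrite inordK.
by move: (forallP vD c) => /implyP.
Qed.

Lemma pn : pos n = n :> nat. Proof. exact: inordK. Qed.
Lemma pa : pos a = a :> nat. Proof. by rewrite inordK //; lia. Qed.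

Lemma crossD (i j : 'I_d) : (i < j)%N -> ~~ crossN D i j ->
  (a <= i <= n)%N && (a <= j <= n)%N || (j < a)%N.
Proof.
move=> ij nc; have jn : (j <= n)%N.
  rewrite leqNgt; apply: contra nc => nj; apply/existsP; exists j.
  by rewrite Dn // ij leqnn.
case: (ltnP j a) => ja; first by rewrite orbT.
rewrite jn orbF; case: (ltnP i a) => ia; last by rewrite /=; lia.
case/negP: nc; apply/existsP; exists (pos a); rewrite pa ia ja Da //; lia.
Qed.

Lemma crossD1 (i j : 'I_d) : crossN D1 i j = crossN D i j || ((i < n)%N && (n <= j)%N).
Proof.
apply/existsP/orP => [[c /andP[]]|[/existsP[c /andP[cD H]]|H]].
- rewrite !inE => /orP[/eqP ->|cD H]; first by rewrite pn; right.
  by left; apply/existsP; exists c; rewrite cD.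
- by exists c; rewrite !inE cD orbT.
by exists (pos n); rewrite !inE eqxx pn.
Qed.

Lemma crossD_in (i j : 'I_d) : (a <= i <= n)%N -> (a <= j <= n)%N -> crossN D i j = false.
Proof.
move=> Hi Hj; apply/existsP => -[c /and3P[cD ic cj]].
have H : (a < c <= n)%N by lia.
by move: (Dan H); rewrite cD.
Qed.

Definition rest g : Z := \prod_(p : 'I_d * 'I_d | [&& (p.1 < p.2)%N, ~~ crossN D p.1 p.2 & (p.2 < a)%N])
  th (g p.1) (g p.2).

Lemma swapK_pair (T : Type) : involutive (fun p : T * T => (p.2, p.1)).
Proof. by case. Qed.

Lemma Tri_pair m g : Tri S a m g = \prod_(p : 'I_d * 'I_d | (a <= p.1 < p.2)%N && (p.2 < m)%N)
  th (g p.1) (g p.2).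
Proof.
rewrite /Tri pair_big_dep (reindex_inj (inv_inj (@swapK_pair _))) /=.
by apply: eq_bigl => -[i j] /=; rewrite andbC.
Qed.

Lemma PiD_Tri g : PiD D g = rest g * Tri S a n.+1 g.
Proof.
rewrite /PiD (bigID (fun p : 'I_d * 'I_d => (a <= p.1)%N)) /= mulrC Tri_pair; congr (_ * _).
  apply: eq_bigl => -[i j] /=; apply/idP/idP => [/andP[/andP[ij nc]]|/and3P[ij nc ja]].
    by have := crossD ij nc; rewrite ij nc /=; lia.
  by rewrite ij nc; lia.
apply: eq_bigl => -[i j] /=; apply/idP/idP => [/andP[/andP[ij nc]]|H].
  by have := crossD ij nc; lia.
by rewrite crossD_in; lia.
Qed.

Lemma PiD1_Tri g : PiD D1 g = rest g * Tri S a n g.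
Proof.
rewrite /PiD (bigID (fun p : 'I_d * 'I_d => (a <= p.1)%N)) /= mulrC Tri_pair; congr (_ * _).
  apply: eq_bigl => -[i j] /=; rewrite crossD1; apply/idP/idP.
    by case/andP => /andP[ij]; rewrite negb_or => /andP[nc _]; have := crossD ij nc; rewrite ij nc /=; lia.
  by case/and3P => ij nc ja; rewrite ij (negPf nc); lia.
apply: eq_bigl => -[i j] /=; rewrite crossD1; apply/idP/idP.
  by case/andP => /andP[ij]; rewrite negb_or => /andP[nc nn]; have := crossD ij nc; lia.
by move=> H; rewrite crossD_in; lia.
Qed.

Lemma rest_inv t h : fixout a n.+1 t -> rest (t * h)%g = rest h.
Proof.
move=> ft; apply: eq_bigr => -[i j] /= /and3P[ij _ ja].
by rewrite !permM !ft //; lia.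
Qed.

Lemma blk_D1 j : blk D1 j = (blk D j + (n <= j))%N.
Proof.
rewrite /blk; case: (leqP n j) => nj.
  have -> : [set c in D1 | (c <= j)%N] = pos n |: [set c in D | (c <= j)%N].
    by apply/setP => c; rewrite !inE; case: eqP => [->|//]; rewrite pn nj.
  by rewrite cardsU1 inE (negPf nD) /= addnC.
rewrite addn0; apply: eq_card => c; rewrite !inE; case: eqP => [->|//].
by rewrite pn (negPf nD) leqNgt nj.
Qed.

Lemma blk_gt j : (n < j)%N -> (blk D (pos n) < blk D j)%N.
Proof. by move=> nj; apply: (@ltn_blk_cut _ _ j) => //; [apply: Dn|rewrite pn]. Qed.

Lemma leq_blk_D1 j : (n <= j)%N = (blk D1 (pos n) <= blk D1 j)%N.
Proof.
apply/idP/idP => [nj|]; first by apply: leq_blk; rewrite pn.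
by apply: contraTT; rewrite -ltnNge -ltnNge => jn; rewrite ltn_blk crossD1 pn jn leqnn orbT.
Qed.

Lemma Young_D1 t : (t \in Young D1) = (t \in Young D) && (t (pos n) == pos n).
Proof.
apply/YoungP/andP => [H|[/YoungP H /eqP tn] j].
  have L j : (n <= t j)%N = (n <= j)%N by rewrite !leq_blk_D1 H.
  split; first by apply/YoungP => j; have := H j; rewrite !blk_D1 L => /addIn.
  have := L (pos n); rewrite pn leqnn leq_eqVlt => /orP[/eqP E|nt].
    by apply/eqP/val_inj; rewrite /= pn.
  by have := H (pos n); rewrite !blk_D1 pn leqnn (ltnW nt) => /addIn E; have := blk_gt nt; rewrite E ltnn.
rewrite !blk_D1 H; congr (_ + _)%N; congr (nat_of_bool _).
have [jn|nj|E] := ltngtP j n; last first.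
- by have -> : j = pos n by [apply: val_inj; rewrite /= pn]; rewrite tn pn leqnn.
- apply/idP; rewrite leqNgt; apply/negP => tj; have := blk_gt nj; rewrite -(H j) ltnNge.
  by rewrite leq_blk // pn ltnW.
apply/negbTE; rewrite -ltnNge ltn_neqAle; apply/andP; split.
  apply: contraTneq jn => E; rewrite -leqNgt; have : t j = pos n by apply: val_inj; rewrite /= pn.
  by rewrite -{1}tn => /perm_inj ->; rewrite pn.
rewrite leqNgt; apply/negP => tj; have := blk_gt tj; rewrite (H j) ltnNge leq_blk // pn ltnW //.
Qed.

Lemma blk_in i j : (a <= i <= n)%N -> (a <= j <= n)%N -> blk D i = blk D j.
Proof.
move=> Hi Hj; apply/eqP; rewrite eqn_leq leqNgt [X in _ && X]leqNgt !ltn_blk.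
by rewrite (crossD_in Hi Hj) (crossD_in Hj Hi).
Qed.

Lemma Young_fixout t : fixout a n.+1 t -> t \in Young D.
Proof.
move=> ft; apply/YoungP => i; have [Hi|Hi] := boolP (a <= i < n.+1)%N; last by rewrite ft.
have := fixout_in i ft; rewrite Hi => Hti.
by apply: blk_in; lia.
Qed.

Lemma Young_tperm t i : (a <= i <= n)%N ->
  ((t * tperm i (pos n))%g \in Young D) && ((t * tperm i (pos n))%g (pos n) == i) =
  (t \in Young D1).
Proof.
move=> Hi; rewrite Young_D1 permM; congr (_ && _).
  have /YoungP tY : tperm i (pos n) \in Young D.
    by apply: Young_fixout; apply: fixout_tperm; rewrite ?pn; lia.
  by apply/YoungP/YoungP => H j; have := H j; rewrite permM tY.
by rewrite -[X in _ == X](tpermR i (pos n)) (inj_eq perm_inj).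
Qed.

(** By hypothesis [a,n] is a block of [D] and all later blocks are singletons; [D1] makes [n] a
    singleton too. Cosets of the smaller Young subgroup in the larger one are given by the
    transpositions (i n), so [hop_spec] applies; [rest], the contribution of the earlier blocks,
    factors out. *)
Lemma KZ_step : KZ D = hM a (n - a) * KZ D1.
Proof.
have ak : (a + (n - a) = n)%N by lia.
have v1 := D1_valid.
rewrite -[LHS]mulr1 -[RHS]mulr1 -[RHS]mulrA.
apply: entXP => [x y nx|x y nx|g y].
- by rewrite ent_KZ0.
- by rewrite ent_hM0.
rewrite ent_hM; last by rewrite ak.
rewrite (@hop_ext _ _ _ _ _ (fun h => rest h * (Tri S a (a + (n - a)) h *
   \sum_(s in Young D1) ent 1 (xg (s * h)%g) y))); last first.
  by move=> h; rewrite ent_KZ // PiD1_Tri ak mulrA.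
rewrite (@hop_scale _ _ n.+1); [|by rewrite ak|by rewrite ak|exact: rest_inv].
rewrite hop_spec; [|by rewrite ak|]; last first.
  move=> t h; rewrite ak => ft; rewrite [LHS](reindex_inj (mulIg t^-1%g)) /=.
  have tY : t \in Young D1.
    rewrite Young_D1 Young_fixout => [|i Hi]; last by apply: ft; lia.
    by rewrite ft ?eqxx // pn ltnn andbF.
  apply: eq_big => [s|s _]; last by rewrite mulgA mulgKV.
  apply/YoungP/YoungP => H j; have := H j; rewrite permM.
    by rewrite (Young_inv _ tY).
  by rewrite (Young_inv _ tY).
rewrite ent_KZ // PiD_Tri ak mulrA; congr (_ * _).
(* The Young subgroup is split according to the image of [n]; composing with the transposition (i n)
   brings each part to the smaller subgroup. *)
rewrite (partition_big (fun s : 'S_d => s (pos n)) (fun i => (a <= i <= n)%N)) /=.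
  apply: eq_bigr => i Hi; rewrite (reindex_inj (mulIg (tperm i (pos n)))) /=.
  by apply: eq_big => [t|t _]; [exact: Young_tperm|rewrite mulgA].
move=> s /YoungP/(_ (pos n)) E; apply/andP; split; rewrite leqNgt; apply/negP => H.
  have aD : pos a \in D by apply: Da; lia.
  have := @ltn_blk_cut _ _ _ (s (pos n)) (pos n) aD; rewrite pa pn E ltnn => H'.
  by have := H' H (ltnW an).
by have := blk_gt H; rewrite E ltnn.
Qed.
End Step.

Lemma Ud_hM a k : (a + k < d)%N -> Un d (map_mx io (hM a k) : Mx d R).
Proof.
elim: k => [|k IH] akd; rewrite [hM _ _]/=.
  by rewrite map_DZ rmorph1; apply: Un_base => //; apply: isBt1.
rewrite mapZD mapZM map_DZ; apply: Un_add.
  apply: Un_base => //; elim/big_ind: _ => [|x y Bx By|i /andP[_ ik]].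
  - by rewrite rmorph1; apply: isBt1.
  - by rewrite rmorphM; apply: isBtM.
  by apply/isBt_io/isC_al; rewrite -val_eqE /= inordK; lia.
by apply: UdM; [apply: IH; lia|apply: Ud_HR; lia].
Qed.

Lemma KZ_omega : KZ (omegaD d) = DZ 1.
Proof.
rewrite -[LHS]mulr1 -[RHS]mulr1; apply: entXP => [x y nx|x y nx|g y].
- by rewrite ent_KZ0 ?omegaD_valid.
- by rewrite ent_DZ0.
rewrite ent_DZ ent_KZ ?omegaD_valid // rmorph1; congr (_ * _).
  rewrite /PiD big1 // => -[i j] /= /andP[ij]; rewrite -ltn_blk !blk_omega ij //.
rewrite (big_pred1 1%g) => [|s]; first by rewrite mul1g.
rewrite /=; apply/YoungP/eqP => [H|-> i]; last by rewrite perm1.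
by apply/permP => i; apply: val_inj; rewrite /= perm1 -blk_omega H blk_omega.
Qed.

(** Each use of [KZ_step] adds a cut, until K_omega = 1_omega is reached. *)
Lemma Ud_K D : validD D -> Un d (map_mx io (KZ D) : Mx d R).
Proof.
move: {2}#|omegaD d :\: D| (erefl #|omegaD d :\: D|) => N; elim: N D => [|N IH] D ND vD.
  suff -> : D = omegaD d by rewrite KZ_omega map_DZ rmorph1; apply: Un_base => //; apply: isBt1.
  move/eqP: ND; rewrite cards_eq0 setD_eq0 => oD; apply/eqP; rewrite eqEsubset oD andbT.
  by rewrite -(vcut_id vD) subsetIr.
have /set0Pn[n0 n0D] : omegaD d :\: D != set0 by rewrite -cards_eq0 ND.
(* The largest missing cut: everything after it is a singleton block. *)
pose n := [arg max_(i > n0 in omegaD d :\: D) i]%N.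
have [nD nmax] : n \in omegaD d :\: D /\ forall c, c \in omegaD d :\: D -> (c <= n)%N.
  by rewrite /n; case: arg_maxnP.
have n_pos : (0 < n)%N by move: nD; rewrite !inE => /andP[].
have nND : n \notin D by move: nD; rewrite !inE => /andP[].
(* [a] is to be the start of the block of [n]; position 0 starts a block without being a cut. *)
pose P (i : 'I_d) := (i < n)%N && ((i == 0 :> nat) || (i \in D)).
have P0 : P ord0 by rewrite /P n_pos eqxx.
pose a := [arg max_(i > ord0 | P i) i]%N.
have [Pa amax] : P a /\ forall c, P c -> (c <= a)%N by rewrite /a; case: arg_maxnP.
have posn : pos n = n by rewrite /pos inord_val.
have posa : pos a = a by rewrite /pos inord_val.
move: Pa; rewrite /P => /andP[an aD].
have an' : (a < n)%N by [].
rewrite (@KZ_step D n a) //.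
- rewrite mapZM; apply: UdM; first by apply: Ud_hM; have := ltn_ord n; lia.
  apply: IH; last by apply: D1_valid.
  have -> : omegaD d :\: (pos n |: D) = (omegaD d :\: D) :\ n.
    by apply/setP => c; rewrite posn !inE negb_or andbA.
  by have := cardsD1 n (omegaD d :\: D); rewrite nD ND => -[].
- by rewrite posn.
- move=> c nc; apply/negPn/negP => cD; have := nmax c.
  by rewrite !inE cD (leq_ltn_trans (leq0n n) nc) => /(_ isT); rewrite leqNgt nc.
- by rewrite posa => a0; move: aD; rewrite eqn0Ngt a0.
move=> c /andP[ac cn]; apply/negP => cD.
have cn' : (c < n)%N by rewrite ltn_neqAle cn andbT; apply: contraNneq nND => /val_inj <-.
by have := amax c; rewrite /P cn' cD orbT => /(_ isT); rewrite leqNgt ac.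
Qed.
End Klam.

(** * Leading terms *)

Section Leading.
Variables (d' : nat) (S : datum d'.+1).
Notation d := d'.+1.
Notation Z := (dZ S).
Notation R := (dR S).
Notation HR := (HR S).
Notation DR := (@DR d' S).
Notation thet := (@thet d' S).
Notation sp := (@sp d').
Notation pos := (@pos d').
Implicit Types (g h t w : 'S_d) (x y z u v r : Y d) (p q n m k a : nat) (A B : Mx d R) (i j : 'I_d)
  (D lam nu : {set 'I_d}) (b c : R).

Definition SR nu lam : Mx d R := map_mx io (SZ S nu lam).
Definition MR lam nu : Mx d R := map_mx io (MZ S lam nu).
Definition KR lam : Mx d R := map_mx io (KZ S lam).

Lemma KR_SM lam : KR lam = SR (omegaD d) lam * MR lam (omegaD d).
Proof. exact: mapZM. Qed.

Lemma ent_SR1 nu lam y y' : ent (SR nu lam) y y' =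
  if [&& lamY y == nu, lamY y' == lam & proj lam y == y'] then io (thet y y') else 0.
Proof. by rewrite ent_map ent_SZ1; case: ifP => // _; rewrite rmorph0. Qed.

Lemma ent_MR1 lam nu y' y : ent (MR lam nu) y' y =
  [&& lamY y' == lam, lamY y == nu & proj lam y == y']%:R.
Proof. by rewrite ent_map ent_MZ1 rmorph_nat. Qed.

Lemma thetE u v : thet u v =
  \prod_(p : 'I_d * 'I_d) (if lt u p.1 p.2 && ~~ lt v p.1 p.2 then th p.1 p.2 else 1).
Proof. exact: big_mkcond. Qed.

(** A pair ordered by [u] but not by [v] is lost exactly once, on the way to [z] or after it, and
    betweenness excludes any other factor. *)
Lemma thet_btw u z v : btw u z v -> thet u z * thet z v = thet u v.
Proof.
move=> H; rewrite !thetE -big_split; apply: eq_bigr => -[i j] _ /=.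
have [] := H i j; case: (lt u i j); case: (lt z i j); case: (lt v i j) => //= H1 H2;
  rewrite ?mulr1 ?mul1r //; by [have := H1 isT|have := H2 isT].
Qed.

Lemma thet_act h u v : actZ h (thet u v) = thet (yact h u) (yact h v).
Proof.
pose f (p : 'I_d * 'I_d) := (h p.1, h p.2).
have fi : injective f by move=> [a b] [a' b'] [] /perm_inj -> /perm_inj ->.
rewrite /thet rmorph_prod [RHS](reindex_inj fi) /=.
apply: eq_big => [[i j]|[i j] /= /andP[lij _]]; first by rewrite /= !lt_yactK.
by apply: act_th; apply: contraTneq lij => ->; rewrite lt_irr.
Qed.

Lemma thet_crs u v : crs v u -> thet u v = 1.
Proof.
move=> vu; rewrite /thet big1 // => -[i j] /= /andP[uij].
by rewrite (vu _ _ uij).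
Qed.

Lemma thet_inv u v : exists tv : Z, thet u v * tv = 1.
Proof.
exists (\prod_(p : 'I_d * 'I_d | lt u p.1 p.2 && ~~ lt v p.1 p.2) thv p.1 p.2).
rewrite -big_split big1 // => -[i j] /= /andP[lij _]; apply: thK.
by apply: contraTneq lij => ->; rewrite lt_irr.
Qed.

Lemma thet_inj u v b c : io (thet u v) * b = io (thet u v) * c -> b = c.
Proof.
have [tv E] := thet_inv u v; move/(congr1 (fun e : R => io tv * e)).
by rewrite !mulrA -rmorphM [tv * _]mulrC E rmorph1 !mul1r.
Qed.

Definition eqv A := forall h y y', ent A (yact h y) (yact h y') = actR h (ent A y y').

Lemma eqv_mul A B : eqv A -> eqv B -> eqv (A * B).
Proof.
move=> eA eB h y y'; rewrite !entM rmorph_sum (reindex_inj (@yact_inj _ h)) /=.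
by apply: eq_bigr => z _; rewrite eA eB rmorphM.
Qed.

Lemma eqv_add A B : eqv A -> eqv B -> eqv (A + B).
Proof. by move=> eA eB h y y'; rewrite !entD eA eB rmorphD. Qed.

Lemma eqv_opp A : eqv A -> eqv (- A).
Proof. by move=> eA h y y'; rewrite !entN eA rmorphN. Qed.

Lemma eqv0 : eqv 0.
Proof. by move=> h y y'; rewrite !ent0 rmorph0. Qed.

Lemma proj_yact h lam y : validD lam -> lam \subset lamY y ->
  proj lam (yact h y) = yact h (proj lam y).
Proof.
move=> vl ly; have c := @crs_yact _ h _ _ (proj_crs vl ly).
by have := crs_proj c; rewrite lamY_yact lamY_proj.
Qed.

Lemma proj_sub lam nu y z h : validD lam -> lam \subset nu -> lamY y = nu ->
  (proj lam (yact h y) == yact h z) = (proj lam y == z).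
Proof. by move=> vl ln yn; rewrite proj_yact ?yn // (inj_eq (@yact_inj _ h)). Qed.

Lemma eqv_SR nu lam : validD lam -> lam \subset nu -> eqv (SR nu lam).
Proof.
move=> vl ln h y y'; rewrite !ent_SR1 !lamY_yact.
have [yn|yn] := eqVneq (lamY y) nu; last by rewrite rmorph0.
rewrite (proj_sub _ _ vl ln yn); case: ifP => _; last by rewrite rmorph0.
by rewrite actR_io thet_act.
Qed.

Lemma eqv_MR nu lam : validD lam -> lam \subset nu -> eqv (MR lam nu).
Proof.
move=> vl ln h y' y; rewrite !ent_MR1 !lamY_yact.
have [yn|yn] := eqVneq (lamY y) nu; last by rewrite /= !andbF rmorph_nat.
by rewrite (proj_sub _ _ vl ln yn) rmorph_nat.
Qed.

Lemma rep_yactX h x : inX x -> rep (yact h x) = (rep x * h)%g.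
Proof. by move=> xX; rewrite -{1}(xg_rep xX) yact_xg rep_xg. Qed.

Lemma inX_yact h x : inX (yact h x) = inX x.
Proof. by rewrite /inX lamY_yact. Qed.

Lemma eqv_DR c : eqv (DR c).
Proof.
move=> h x y; rewrite !ent_DR1 inX_yact (inj_eq (@yact_inj _ h)).
case: (boolP (inX x)) => xX /=; last by rewrite rmorph0.
by case: ifP => _; rewrite ?rmorph0 // rep_yactX // actRM.
Qed.

Lemma morph_comb h (e f : Z) (m n : bool) :
  actZ h (e * m%:R + f * n%:R) = actZ h e * m%:R + actZ h f * n%:R.
Proof. by rewrite rmorphD rmorphM rmorphM !rmorph_nat. Qed.

Lemma eqv_HR p : (p.+1 < d)%N -> eqv (HR p).
Proof.
move=> pd h x y; rewrite !ent_map !ent_HZ1 inX_yact.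
case: (boolP (inX x)) => xX; last by rewrite !rmorph0.
have np : pos p != pos p.+1 :> 'I_d by apply: pos_neq; lia.
have gn g : g (pos p) != g (pos p.+1) by rewrite (inj_eq perm_inj).
rewrite actR_io rep_yactX // !permM mulgA -(yact_xg h) !(inj_eq (@yact_inj _ h)).
by rewrite morph_comb (act_bt h (gn _)) (act_th S h (gn _)).
Qed.

(** Minimal agreement is attained on one orbit only, so subtracting such an element changes no other
    entry at that level. *)
Definition Lead A u v b := [/\ eqv A,
  forall y y', ent A y y' != 0 -> [/\ lamY y = lamY u, lamY y' = lamY v, (co u v <= co y y')%N &
     co y y' = co u v -> exists h, y = yact h u /\ y' = yact h v] &
  ent A u v = io (thet u v) * b].

Lemma lead_yact h A u v b : Lead A u v b -> Lead A (yact h u) (yact h v) (actR h b).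
Proof.
move=> [eA sA vA]; split=> // [y y' nz|].
  have [tu tv le ex] := sA _ _ nz; rewrite !lamY_yact co_yact; split=> // /ex[h' [-> ->]].
  by exists (h^-1 * h')%g; rewrite !yactM !yactKV.
by rewrite eA vA rmorphM actR_io thet_act.
Qed.

Lemma ent_mul_neq0 A B y y' : ent (A * B) y y' != 0 ->
  exists z, ent A y z != 0 /\ ent B z y' != 0.
Proof.
rewrite entM => nz.
have [/existsP[z /andP[]]|] := boolP [exists z, (ent A y z != 0) && (ent B z y' != 0)]; first by exists z.
rewrite negb_exists => /forallP H; move: nz; rewrite big1 ?eqxx // => z _.
by have := H z; rewrite negb_and !negbK => /orP[] /eqP ->; rewrite ?mul0r ?mulr0.
Qed.

(** By [co_btw] only middle points that lie between reach the minimal level. The first side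
    condition says that the resulting pairs form one orbit; the second that [z] is the only middle
    point contributing at (u,v), so that coefficients multiply. *)
Lemma lead_mul A B u z v b c : Lead A u z b -> Lead B z v c -> btw u z v ->
  (forall h1 h2, yact h1 z = yact h2 z -> btw (yact h1 u) (yact h1 z) (yact h2 v) ->
     exists h, yact h1 u = yact h u /\ yact h2 v = yact h v) ->
  (forall h1 h2, yact h1 z = yact h2 z -> yact h1 u = u -> yact h2 v = v ->
     yact h1 z = z) ->
  Lead (A * B) u v (b * c).
Proof.
move=> [eA sA vA] [eB sB vB] uzv U1 U2.
have key y z' y' : ent A y z' != 0 -> ent B z' y' != 0 -> (co u v <= co y y')%N /\
    (co y y' = co u v -> exists h1 h2, [/\ y = yact h1 u, z' = yact h1 z, yact h1 z = yact h2 z,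
       y' = yact h2 v & btw y z' y']).
  move=> /sA[ty tz le1 ex1] /sB[_ ty' le2 ex2].
  have E := btw_co uzv; have Ez := co_refl_lam tz; have sup := co_super y z' y'.
  split=> [|Eco]; first by lia.
  have [|h1 [y1 z1]] := ex1; first by lia.
  have [|h2 [z2 y2]] := ex2; first by lia.
  exists h1, h2; split=> //; first by rewrite -z1.
  by apply: co_btw; lia.
split; first exact: eqv_mul.
  move=> y y' /ent_mul_neq0[z' [nA nB]]; have [le ex] := key _ _ _ nA nB.
  have [ty _ _ _] := sA _ _ nA; have [_ ty' _ _] := sB _ _ nB.
  split=> // /ex[h1 [h2 [-> -> z12 -> bt']]]; exact: U1.
rewrite entM (bigD1 z) //= big1 ?addr0 => [|z' nz].
  by rewrite vA vB -(thet_btw uzv) rmorphM !mulrA; congr (_ * _); rewrite -!mulrA -(ioC (thet z v)).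
have [->|nA] := eqVneq (ent A u z') 0; first by rewrite mul0r.
have [->|nB] := eqVneq (ent B z' v) 0; first by rewrite mulr0.
have [_ /(_ erefl)[h1 [h2 [u1 z1 z12 v2 _]]]] := key _ _ _ nA nB.
by move: nz; rewrite z1 (U2 h1 h2) ?eqxx.
Qed.

Lemma lead_SR z v : crs z v -> Lead (SR (lamY z) (lamY v)) z v 1.
Proof.
move=> zv; split; first by apply: eqv_SR; [exact: lamY_valid|exact: crs_lam].
  move=> y y'; rewrite ent_SR1; case: ifP; last by rewrite eqxx.
  case/and3P => /eqP ty /eqP ty' /eqP py _.
  have [h zy] := yact_trans (esym ty).
  have yv : y' = yact h v.
    by rewrite -py zy proj_yact ?lamY_valid ?crs_lam // crs_proj.
  by split=> //; [rewrite zy yv co_yact|move=> _; exists h].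
by rewrite ent_SR1 !eqxx crs_proj // eqxx mulr1.
Qed.

Lemma lead_MR z v : crs z v -> Lead (MR (lamY v) (lamY z)) v z 1.
Proof.
move=> zv; split; first by apply: eqv_MR; [exact: lamY_valid|exact: crs_lam].
  move=> y' y; rewrite ent_MR1; case: and3P; last by rewrite eqxx.
  case=> /eqP ty' /eqP ty /eqP py _.
  have [h zy] := yact_trans (esym ty).
  have yv : y' = yact h v.
    by rewrite -py zy proj_yact ?lamY_valid ?crs_lam // crs_proj.
  by split=> //; [rewrite zy yv co_yact|move=> _; exists h].
by rewrite ent_MR1 !eqxx crs_proj // eqxx thet_crs // rmorph1 mulr1.
Qed.


Lemma meet_btw u v : btw u (meet u v) v.
Proof.
move=> i j; rewrite lt_meet; split; first by case/andP => ->.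
by case/orP => [->|/andP[_ ->]]; rewrite ?orbT.
Qed.

Lemma meet_btwC u v : btw u (meet v u) v.
Proof. by move=> i j; have := @meet_btw v u i j; rewrite andbC orbC. Qed.

Lemma crs_same z v h1 h2 : crs z v -> yact h1 z = yact h2 z -> yact h1 v = yact h2 v.
Proof.
move=> zv E; apply: (@crs_lamE _ (yact h1 z)); first exact: crs_yact.
  by rewrite E; apply: crs_yact.
by rewrite !lamY_yact.
Qed.

Lemma lead_mulS A u v b : Lead A u (meet v u) b ->
  Lead (A * SR (lamY (meet v u)) (lamY v)) u v b.
Proof.
move=> LA; rewrite -[b]mulr1; apply: (lead_mul LA (lead_SR (@meet_crs _ _ _))).
- exact: meet_btwC.
- move=> h1 h2 E _; exists h1; split=> //; apply/esym/(crs_same _ E); exact: meet_crs.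
move=> h1 h2 E u1 v2; rewrite -meet_yact u1.
by rewrite (crs_same (@meet_crs _ v u) E) v2.
Qed.

Lemma lead_Mmul B u v b : Lead B (meet u v) v b ->
  Lead (MR (lamY u) (lamY (meet u v)) * B) u v b.
Proof.
move=> LB; rewrite -[b]mul1r; apply: (lead_mul (lead_MR (@meet_crs _ _ _)) LB).
- exact: meet_btw.
- move=> h1 h2 E _; exists h2; split=> //; apply: (crs_same _ E); exact: meet_crs.
move=> h1 h2 E u1 v2; rewrite E -meet_yact v2.
by rewrite -(crs_same (@meet_crs _ u v) E) u1.
Qed.

(** [u] can be recovered from [r] and [v]: a relation of [u] lost in [r] is opposite to [v], and if
    [u0] followed [v] there, betweenness would put that relation into [r]. *)
Lemma refine_unique u u0 r v : crs u r -> crs u0 r -> lamY u0 = lamY u ->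
  (forall i j, lt u i j -> lt r i j || lt v j i) -> btw u0 r v -> u0 = u.
Proof.
move=> ur u0r tu op bt0; apply: (@crs_lamE _ (meet u u0)) => //; last exact: meet_crs.
move=> i j l0; rewrite lt_meet l0 andbT; case: (boolP (lt u i j)) => //= nu.
apply/negP => lji; case/orP: (op _ _ lji) => [/u0r|vij].
  by rewrite lt_asym // l0.
have [/(_ _) H _] := bt0 i j; rewrite l0 vij in H; have := ur _ _ (H isT).
by rewrite lt_asym.
Qed.

Lemma lead_Smul B u r v b : crs u r -> (forall i j, lt u i j -> lt r i j || lt v j i) ->
  Lead B r v b -> Lead (SR (lamY u) (lamY r) * B) u v b.
Proof.
move=> ur op LB; rewrite -[b]mul1r; apply: (lead_mul (lead_SR ur) LB).
- move=> i j; split=> [/andP[uij vij]|/ur -> //].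
  by case/orP: (op _ _ uij) => //; rewrite lt_asym.
- move=> h1 h2 E bt0; exists h2; split=> //.
  apply: (@refine_unique _ _ (yact h2 r) (yact h2 v)).
  + exact: crs_yact.
  + by rewrite -E; apply: crs_yact.
  + by rewrite !lamY_yact.
  + by move=> i j; rewrite !lt_yact; apply: op.
  by rewrite -E.
move=> h1 h2 E u1 v2; apply: (@crs_lamE _ u) => //; last by rewrite lamY_yact.
by rewrite -{1}u1; apply: crs_yact.
Qed.

Lemma yactX_free h1 h2 x : inX x -> yact h1 x = yact h2 x -> h1 = h2.
Proof. by move=> /xg_rep <-; rewrite !yact_xg => /xg_inj/mulgI. Qed.

Lemma lead_mulX A B u z v b c : inX u -> inX z -> Lead A u z b -> Lead B z v c -> btw u z v ->
  Lead (A * B) u v (b * c).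
Proof.
move=> uX zX LA LB uzv; apply: (lead_mul LA LB uzv).
  by move=> h1 h2 /(yactX_free zX) -> _; exists h2.
move=> h1 h2 _ u1 _; have -> : h1 = 1%g; last exact: yact1.
by apply: (yactX_free uX); rewrite u1 yact1.
Qed.

Lemma lead_DR x c : inX x -> Lead (DR c) x x (actR (rep x) c).
Proof.
move=> xX; split; first exact: eqv_DR.
  move=> y y'; rewrite ent_DR1; case: ifP; last by rewrite eqxx.
  case/andP => yX /eqP <- _; have t : lamY y = lamY x by rewrite (eqP yX) (eqP xX).
  split=> //; first by rewrite (co_refl_lam t).
  by move=> _; have [h ->] := yact_trans (esym t); exists h.
by rewrite ent_DR1 xX eqxx thet_crs // rmorph1 mul1r.
Qed.

Lemma sp_val p i : (p.+1 < d)%N ->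
  sp p i = (if i == p :> nat then p.+1 else if i == p.+1 :> nat then p else i) :> nat.
Proof.
move=> pd; have p0 : pos p = p :> nat by rewrite inordK //; lia.
have p1 : pos p.+1 = p.+1 :> nat by rewrite inordK.
rewrite /sp; case: tpermP => [->|->|n0 n1]; rewrite ?p0 ?p1 ?eqxx //.
  by case: eqP => //; lia.
case: eqP => [E|_]; first by case: n0; apply: val_inj; rewrite /= p0.
by case: eqP => [E|//]; case: n1; apply: val_inj; rewrite /= p1.
Qed.

Lemma sp_ltE p i j : (p.+1 < d)%N ->
  ~~ ((i == p :> nat) && (j == p.+1 :> nat)) -> ~~ ((j == p :> nat) && (i == p.+1 :> nat)) ->
  (sp p i < sp p j)%N = (i < j)%N.
Proof. by move=> pd; rewrite !sp_val //; repeat case: eqP => ? //=; lia. Qed.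

(** The diagonal entry has more agreement than the entry at s_p, so the latter leads. *)
Lemma lead_HR p g : (p.+1 < d)%N -> Lead (HR p) (xg g) (xg (sp p * g)%g) 1.
Proof.
move=> pd; have p0 : pos p = p :> nat by rewrite inordK //; lia.
have p1 : pos p.+1 = p.+1 :> nat by rewrite inordK.
have lu i j : lt (xg (sp p * g)%g) (g i) (g j) = (sp p i < sp p j)%N.
  by rewrite lt_xg invMg !permM !permK /sp tpermV.
have lz i j : lt (xg g) (g i) (g j) = (i < j)%N by rewrite lt_xg !permK.
split; first exact: eqv_HR.
  have colt : (co (xg g) (xg (sp p * g)%g) < co (xg g) (xg g))%N.
    apply/proper_card/properP; split.
      by apply/subsetP => q; rewrite !inE => /andP[-> _].
    exists (g (pos p), g (pos p.+1)); rewrite !inE /= !lz ?lu p0 p1 ?ltnS ?leqnn //=.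
    by rewrite !sp_val // p0 p1 !eqxx; repeat case: eqP => ? //=; lia.
  move=> x y; rewrite ent_map ent_HZ1; case: (boolP (inX x)) => xX; last by rewrite rmorph0 eqxx.
  have tx : lamY x = lamY (xg g) by rewrite (eqP xX) (eqP (inX_xg g)).
  have tX h : lamY (xg h) = lamY (xg (sp p * g)%g) by rewrite (eqP (inX_xg h)) (eqP (inX_xg _)).
  have [->|nyx] := eqVneq y x.
    move=> _; have E := co_refl_lam tx.
    by split; [|rewrite tx tX|rewrite E ltnW|move=> E'; move: colt; rewrite -E E' ltnn].
  have [-> _|_] := eqVneq y _; last by rewrite !mulr0 addr0 rmorph0 eqxx.
  have [h E] := yact_trans (esym tx).
  have Eh : xg (sp p * rep x)%g = yact h (xg (sp p * g)%g).
    by rewrite E yact_xg rep_xg yact_xg mulgA.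
  split=> //; first by rewrite Eh E co_yact.
  by move=> _; exists h.
rewrite ent_map ent_HZ1 inX_xg rep_xg eqxx mulr1 [X in _ * X](_ : _ = 0); last first.
  rewrite (inj_eq (@xg_inj _)); case: eqP => // /(congr1 (fun s => s * g^-1)%g).
  rewrite mulgK mulgV => /permP/(_ (pos p)); rewrite tpermL perm1 => /(congr1 val) /=.
  by rewrite p0 p1; lia.
rewrite mulr0 add0r mulr1; congr (io _); rewrite /thet (big_pred1 (g (pos p), g (pos p.+1))) //.
move=> [i j] /=; rewrite -{1 2}(permKV g i) -{1 2}(permKV g j) lz lu xpair_eqE.
rewrite -[X in (X == _) && _](permKV g i) -[X in _ && (X == _)](permKV g j) !(inj_eq perm_inj).
rewrite -!val_eqE /= p0 p1 !sp_val //.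
by repeat case: eqP => ? //=; lia.
Qed.

Lemma cp_mono m k i j : (m < d)%N -> (k <= m)%N -> i != pos m -> j != pos m -> (i < j)%N ->
  ((cp d' m k)^-1%g i < (cp d' m k)^-1%g j)%N.
Proof.
move=> md; elim: k => [|k IH] km im jm ij; first by rewrite /= invg1 !perm1.
have {}IH := IH (ltnW km) im jm ij.
rewrite [cp _ _ _]/= invMg !permM tpermV -/(sp _) sp_ltE //; first lia.
  apply/negP => /andP[_ /eqP E].
  have : (cp d' m k)^-1%g j = (cp d' m k)^-1%g (pos m).
    by apply: val_inj; rewrite /= E cpV ?(ltnW km) // inordK; lia.
  by move/perm_inj => E'; rewrite E' eqxx in jm.
apply/negP => /andP[_ /eqP E].
have : (cp d' m k)^-1%g i = (cp d' m k)^-1%g (pos m).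
  by apply: val_inj; rewrite /= E cpV ?(ltnW km) // inordK; lia.
by move/perm_inj => E'; rewrite E' eqxx in im.
Qed.

Lemma cp_lt m k i j : (m < d)%N -> (k <= m)%N -> i != pos m -> j != pos m ->
  ((cp d' m k)^-1%g i < (cp d' m k)^-1%g j)%N = (i < j)%N.
Proof.
move=> md km im jm; have [ij|ji|/val_inj ->] := ltngtP i j; last by rewrite ltnn.
  by rewrite cp_mono.
by apply/negbTE; rewrite -leqNgt ltnW // cp_mono.
Qed.

Lemma lead_Cw m k : (m < d)%N -> (k <= m)%N -> Lead (Cw S m k) (xg 1%g) (xg (cp d' m k)) 1.
Proof.
move=> md; elim: k => [|k IH] km.
  by have := lead_DR 1 (inX_xg (1%g : 'S_d)); rewrite rmorph1.
rewrite [Cw _ _ _]/= [cp _ _ _]/= -[1]mulr1.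
have km' := ltnW km.
have pd : ((m - k.+1).+1 < d)%N by lia.
apply: (lead_mulX (inX_xg _) (inX_xg _) (IH km') (lead_HR _ pd)).
apply: btw_agree => a b; rewrite !lt_xg invg1 !perm1 invMg !permM tpermV -/(sp _).
have cm : (cp d' m k)^-1%g (pos m) = (m - k)%N :> nat by rewrite cpV // inordK; lia.
have E (a' : 'I_d) : (cp d' m k)^-1%g a' = (m - k.+1).+1 :> nat -> a' = pos m.
  by move=> Ea; apply: (@perm_inj _ (cp d' m k)^-1%g); apply: val_inj; rewrite /= cm Ea; lia.
have F (a' : 'I_d) : (cp d' m k)^-1%g a' = (m - k.+1)%N :> nat -> (a' < m)%N.
  move=> Ea; rewrite ltnNge leq_eqVlt; apply/negP => /orP[/eqP ma|ma].
    have : a' = pos m by apply: val_inj; rewrite /= inordK.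
    by move=> Ea'; move: Ea; rewrite Ea' cm; lia.
  have /SnP/(_ _ ma) := Sn_inv (@Sn_cp d' m k md km').
  by move=> Ea'; move: Ea; rewrite Ea'; lia.
case: (boolP ((((cp d' m k)^-1%g a == m - k.+1 :> nat) && ((cp d' m k)^-1%g b == (m - k.+1).+1 :> nat)))%N).
  by case/andP => /eqP Ea /eqP Eb; left; rewrite Ea Eb (E _ Eb) [RHS](_ : _ = true) ?ltnSn // inordK // F.
move=> n1; case: (boolP ((((cp d' m k)^-1%g b == m - k.+1 :> nat) && ((cp d' m k)^-1%g a == (m - k.+1).+1 :> nat)))%N).
  case/andP => /eqP Eb /eqP Ea; left; rewrite Ea Eb (E _ Ea) inordK // [RHS](_ : _ = false); first lia.
  by apply/negbTE; rewrite -leqNgt ltnW // F.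
by move=> n2; right; rewrite sp_ltE.
Qed.

(** The word factors through points between 1 and [w], so the Theta factors multiply up to
    Theta(1,w) with coefficient 1. *)
Lemma lead_Lw n w : (n <= d)%N -> Sn n w -> Lead (Lw S n w) (xg 1%g) (xg w) 1.
Proof.
elim: n w => [|m IH] w md wn.
  have -> : w = 1%g by apply/permP => i; rewrite perm1; move/SnP: wn => ->.
  by have := lead_DR 1 (inX_xg (1%g : 'S_d)); rewrite rmorph1.
rewrite [Lw _ _ _]/=; set k := (m - _)%N.
have km : (k <= m)%N by rewrite /k; lia.
have wm : Sn m ((cp d' m k)^-1 * w)%g by apply: Sn_cpV_mul.
have L1 := IH _ (ltnW md) wm.
have L2 := lead_yact ((cp d' m k)^-1 * w)%g (lead_Cw md km).
rewrite !yact_xg mul1g mulKVg rmorph1 in L2.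
rewrite -[1]mulr1; apply: (lead_mulX (inX_xg _) (inX_xg _) L1 L2).
have Ew : w = (cp d' m k * ((cp d' m k)^-1 * w))%g by rewrite mulKVg.
(* On pairs involving slot [m] the middle point agrees with the identity, since it fixes [m]; on all
   others it agrees with the end point, since the cycle is monotone away from [m]. *)
suff H (w' : 'S_d) : Sn m w' -> btw (xg 1%g) (xg w') (xg (cp d' m k * w')%g).
  by rewrite {2}Ew; apply: H.
move=> {}wm; apply: btw_agree => a b; rewrite !lt_xg invg1 !perm1 invMg !permM.
have pm : pos m = m :> nat by rewrite inordK.
have fm (e : 'I_d) : (m <= w'^-1%g e)%N = (m <= e)%N.
  have /SnP wV := Sn_inv wm; apply/idP/idP => [H|H]; last by rewrite wV.
  by have := wV _ H => /perm_inj <-.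
have fpm (e : 'I_d) : w'^-1%g e = pos m -> e = pos m.
  move=> Ee; apply: (@perm_inj _ w'^-1%g); rewrite Ee.
  by have /SnP -> := Sn_inv wm; rewrite ?pm.
have [Ea|na] := eqVneq (w'^-1%g a) (pos m).
  left; rewrite Ea (fpm _ Ea) pm; have [Eb|nb] := eqVneq (w'^-1%g b) (pos m).
    by rewrite Eb (fpm _ Eb) pm.
  have nb' : b != pos m by apply: contraNneq nb => ->; rewrite -{1}(fpm _ Ea) Ea.
  have vb (e : 'I_d) : e != pos m -> e != m :> nat.
    by apply: contraNN => /eqP E; apply/eqP/val_inj; rewrite /= pm.
  have n1 := vb _ nb; have n2 := vb _ nb'.
  by rewrite ltn_neqAle [RHS]ltn_neqAle fm eq_sym n1 eq_sym n2.
have [Eb|nb] := eqVneq (w'^-1%g b) (pos m).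
  left; rewrite Eb (fpm _ Eb) pm.
  by rewrite ltnNge fm -ltnNge.
by right; rewrite cp_lt.
Qed.

(* Every element of the span of the [DR (b w) * Lw w] shows the coefficients [b w] of its
   leading terms; the other words cannot contribute there. *)
Lemma leadH f (N : nat) x y : Un d f -> (forall x y, ent f x y != 0 -> (N <= co x y)%N) ->
  inX x -> inX y -> co x y = N -> exists2 b, isBt b & ent f x y = io (thet x y) * b.
Proof.
move=> [b [Bb Ef]] supp xX yX xy.
pose e := xg (1%g : 'S_d).
have Snd w : Sn d w by apply/SnP => i; rewrite leqNgt ltn_ord.
have LL w := lead_Lw (leqnn d) (Snd w).
have entF w : ent f e (xg w) = \sum_w' b w' * ent (Lw S d w') e (xg w).
  rewrite Ef ent_sum; apply: eq_big => [w'|w' _]; first exact: Snd.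
  by rewrite ent_DR actR1.
have ownF w : (forall w', b w' != 0 -> (co e (xg w) <= co e (xg w'))%N) ->
    ent f e (xg w) = io (thet e (xg w)) * b w.
  move=> H; rewrite entF (bigD1 w) //= big1 ?addr0 => [|w' nw].
    by have [_ _ ->] := LL w; rewrite mulr1 ioC.
  have [->|nb] := eqVneq (b w') 0; first by rewrite mul0r.
  have [->|nL] := eqVneq (ent (Lw S d w') e (xg w)) 0; first by rewrite mulr0.
  have [_ sL _] := LL w'; have [_ _ le ex] := sL _ _ nL.
  have [|h [eh wh]] := ex; first by apply/eqP; rewrite eqn_leq le H.
  have h1 : h = 1%g by apply: (@yactX_free h 1%g e); rewrite ?inX_xg // yact1.
  by move: nw; rewrite -(inj_eq (@xg_inj _)) wh h1 yact1 eqxx.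
have eqf : eqv f.
  rewrite Ef; apply: (big_ind eqv) => [||w _]; [exact: eqv0|exact: eqv_add|].
  by apply: eqv_mul; [exact: eqv_DR|have [] := LL w].
(* If the least agreement among words with nonzero coefficient were below [N], the entry there,
   which nothing cancels, would violate [supp]. *)
have low w : b w != 0 -> (N <= co e (xg w))%N.
  move=> bw; pose w0 := [arg min_(t < w | b t != 0) co e (xg t)].
  have [b0 min0] : b w0 != 0 /\ forall t, b t != 0 -> (co e (xg w0) <= co e (xg t))%N.
    by rewrite /w0; case: arg_minnP.
  apply: leq_trans (min0 _ bw); apply: supp; rewrite ownF //.
  by apply: contraNneq b0 => E; apply/eqP; apply: (@thet_inj e (xg w0)); rewrite E mulr0.
pose h := rep x.
have Ex : x = yact h e by rewrite yact_xg mul1g xg_rep.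
pose w := (rep y * h^-1)%g.
have Ey : y = yact h (xg w) by rewrite yact_xg mulgKV xg_rep.
have cw : co e (xg w) = N by rewrite -xy Ex Ey co_yact.
exists (actR h (b w)); first exact: isBt_act.
by rewrite Ex Ey eqf ownF ?cw // rmorphM actR_io thet_act.
Qed.
End Leading.

(** * Generators of the two algebras, and adjacent blocks *)

Section Algebras.
Variables (d' : nat) (S : datum d'.+1).
Notation d := d'.+1.
Notation Z := (dZ S).
Notation R := (dR S).
Notation HR := (HR S).
Notation DR := (@DR d' S).
Notation SR := (SR S).
Notation MR := (MR S).
Notation KR := (KR S).
Notation thet := (@thet d' S).
Notation sp := (@sp d').
Notation pos := (@pos d').
Notation om := (omegaD d).
Implicit Types (g h w : 'S_d) (x y z u v r : Y d) (p q n m k a : nat) (A B : Mx d R) (i j : 'I_d)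
  (D lam nu mu : {set 'I_d}) (b c t : R).

Lemma TR_subproof : {A : {set 'I_d} -> R -> Mx d R | forall lam c y y',
  ent (A lam c) y y' = if (lamY y == lam) && (y == y') then actR (rep y) c else 0}.
Proof.
exists (fun lam c => mk (fun y y' =>
  if (lamY y == lam) && (y == y') then actR (rep y) c else 0)) => *.
exact: ent_mk.
Qed.
Definition TR := sval TR_subproof.
Definition ent_TR1 : forall lam c y y', ent (TR lam c) y y' = _ := svalP TR_subproof.

Definition YInv lam c := forall s, s \in Young lam -> actR s c = c.

Inductive GenM (G : Mx d R -> Prop) : Mx d R -> Prop :=
| GenM_gen (f : Mx d R) : G f -> GenM G f
| GenM_zero : GenM G 0
| GenM_add (f g : Mx d R) : GenM G f -> GenM G g -> GenM G (f + g)
| GenM_scl (c : dk S) (f : Mx d R) : GenM G f -> GenM G (io (kz c) *: f)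
| GenM_mul (f g : Mx d R) : GenM G f -> GenM G g -> GenM G (f * g).

Lemma GenM_opp G A : GenM G A -> GenM G (- A).
Proof. by move=> GA; have := GenM_scl (- 1) GA; rewrite !rmorphN1 scaleN1r. Qed.

Lemma GenM_sum (G : Mx d R -> Prop) (I : Type) (s : seq I) (P : pred I) (F : I -> Mx d R) :
  (forall e, P e -> GenM G (F e)) -> GenM G (\sum_(i <- s | P i) F i).
Proof. by move=> H; apply: big_ind => //; [exact: GenM_zero|exact: GenM_add]. Qed.

Definition HTm := GenM (fun f => (exists lam, validD lam /\ f = KR lam) \/
  (exists t, isBt t /\ f = DR t)).
Definition Sm := GenM (fun f => (exists nu lam, refines nu lam /\ f = SR nu lam) \/
  (exists nu lam, refines nu lam /\ f = MR lam nu) \/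
  (exists lam t, [/\ validD lam, isBt t, YInv lam t & f = TR lam t])).

Lemma omega_refines lam : validD lam -> refines om lam.
Proof.
move=> vl; split=> //; first exact: omegaD_valid.
by rewrite -(vcut_id vl) subsetIr.
Qed.

Lemma sub_om lam : validD lam -> lam \subset om.
Proof. by case/omega_refines. Qed.

Lemma rep_yact h y : exists2 s, s \in Young (lamY y) & rep (yact h y) = (s * (rep y * h))%g.
Proof.
exists (rep (yact h y) * (rep y * h)^-1)%g; last by rewrite mulgKV.
by have := rep_mkY (lamY y) (rep y * h)%g; rewrite vcut_id ?lamY_valid.
Qed.

Lemma eqv_TR lam c : YInv lam c -> eqv (TR lam c).
Proof.
move=> cI h y y'; rewrite !ent_TR1 lamY_yact (inj_eq (@yact_inj _ h)).
case: ifP => [/andP[/eqP yl _]|_]; last by rewrite rmorph0.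
have [s sY ->] := rep_yact h y; rewrite yl in sY.
by rewrite actRM cI // actRM.
Qed.

Lemma eqv_scl (c : dk S) A : eqv A -> eqv (io (kz c) *: A).
Proof. by move=> eA h y y'; rewrite !entZ eA rmorphM actR_io actZ_kz. Qed.

Lemma Sm_eqv A : Sm A -> eqv A.
Proof.
elim=> [f [[nu [lam [[vn vl ln] ->]]]|[[nu [lam [[vn vl ln] ->]]]|[lam [t [vl Bt It ->]]]]]
  |||c f _|].
- exact: eqv_SR.
- exact: eqv_MR.
- exact: eqv_TR.
- exact: eqv0.
- by move=> f g _ ef _ eg; apply: eqv_add.
- exact: eqv_scl.
by move=> f g _ ef _ eg; apply: eqv_mul.
Qed.

Lemma scl_DR (c : dk S) b : io (kz c) *: DR b = DR (io (kz c) * b).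
Proof.
apply: entP => x y; rewrite entZ !ent_DR1; case: ifP => _; last by rewrite mulr0.
by rewrite rmorphM actR_io actZ_kz.
Qed.

Lemma sclA (c : R) A B : c *: (A * B) = (c *: A) * B.
Proof. exact: scalemxAl. Qed.

Lemma Ud_scl (c : dk S) A : Un d A -> Un d (io (kz c) *: A).
Proof.
elim/Un_ind => [|A1 A2 U1 U2|s w Bs wn].
- by rewrite scaler0; apply: Un0.
- by rewrite scalerDr; apply: Un_add.
rewrite sclA scl_DR; apply: Un_gen => //; apply: isBtM => //.
exact/isBt_io/isC_kz.
Qed.

Lemma HTm_Ud A : HTm A -> Un d A.
Proof.
elim=> [f [[lam [vl ->]]|[t [Bt ->]]]|||c f _|].
- exact: Ud_K.
- exact: Un_base.
- exact: Un0.
- by move=> f g _ ef _ eg; apply: Un_add.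
- exact: Ud_scl.
by move=> f g _ ef _ eg; apply: UdM.
Qed.

Lemma Ud_DR1l A : Un d A -> DR 1 * A = A.
Proof.
elim/Un_ind => [|A1 A2 U1 U2|s w Bs wn]; first by rewrite mulr0.
  by rewrite mulrDr U1 U2.
by rewrite mulrA DRM mul1r.
Qed.

Lemma Ud_DR1r A : Un d A -> A * DR 1 = A.
Proof.
elim/Un_ind => [|A1 A2 U1 U2|s w Bs wn]; first by rewrite mul0r.
  by rewrite mulrDl U1 U2.
rewrite -mulrA; congr (_ * _); elim: (Wd_Lw S w (leqnn d)) => [|B p _ IH pd].
  by rewrite DRM mulr1.
by rewrite -mulrA HR_DR1 // mulrA IH.
Qed.

Lemma HTm_DR t : isBt t -> HTm (DR t).
Proof. by move=> Bt; apply: GenM_gen; right; exists t. Qed.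

Lemma HTm_K lam : validD lam -> HTm (KR lam).
Proof. by move=> vl; apply: GenM_gen; left; exists lam. Qed.

(** For the composition whose only nontrivial block is {p,p+1}, the symmetrizer is alpha + H_p. *)
Lemma HTm_HR p : (p.+1 < d)%N -> HTm (HR p).
Proof.
move=> pd; pose D := om :\ pos p.+1.
have vD : validD D.
  by apply/forallP => c; apply/implyP; rewrite !inE => /andP[].
have DK : pos p.+1 |: D = om by rewrite setD1K // inE inordK.
have E : KR D = DR (io (al (pos p) (pos p.+1))) + HR p.
  rewrite /KR (@KZ_step _ S D p.+1 p) //.
  - rewrite DK KZ_omega mapZM map_DZ rmorph1 subSnn.
    rewrite [hM _ _ _]/= addn0 mapZD mapZM !map_DZ rmorph1 mulrDl DRM mulr1.
    rewrite DR1_HR HR_DR1 // DR1_HR; congr (DR (io _) + _).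
    by rewrite (big_pred1 (pos p)) // => i; rewrite /= -val_eqE /= inordK; lia.
  - by rewrite !inE eqxx.
  - by move=> c pc; rewrite !inE -val_eqE /= inordK //; lia.
  - by move=> p0; rewrite !inE -val_eqE /= !inordK //; lia.
  move=> c pc; rewrite !inE -val_eqE /= inordK //; lia.
have -> : HR p = KR D - DR (io (al (pos p) (pos p.+1))) by rewrite E addrAC subrr add0r.
apply: GenM_add; first exact: HTm_K.
apply/GenM_opp/HTm_DR/isBt_io/isC_al; apply: pos_neq; lia.
Qed.

Lemma HTm_Lw w : HTm (Lw S d w).
Proof.
elim: (Wd_Lw S w (leqnn d)) => [|B p _ IH pd]; first by apply: HTm_DR; apply: isBt1.
by apply: GenM_mul => //; apply: HTm_HR.
Qed.

Lemma DR_TR t : DR t = TR om t.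
Proof. by apply: entP => x y; rewrite ent_DR1 ent_TR1. Qed.

Lemma YInv_om t : YInv om t.
Proof.
move=> s /YoungP H; have -> : s = 1%g; last exact: actR1.
by apply/permP => i; apply: val_inj; rewrite /= perm1 -blk_omega H blk_omega.
Qed.

Lemma Sm_SR nu lam : refines nu lam -> Sm (SR nu lam).
Proof. by move=> H; apply: GenM_gen; left; exists nu, lam. Qed.
Lemma Sm_MR nu lam : refines nu lam -> Sm (MR lam nu).
Proof. by move=> H; apply: GenM_gen; right; left; exists nu, lam. Qed.
Lemma Sm_TR lam t : validD lam -> isBt t -> YInv lam t -> Sm (TR lam t).
Proof. by move=> vl Bt It; apply: GenM_gen; right; right; exists lam, t. Qed.

Lemma HTm_Sm A : HTm A -> Sm A.
Proof.
elim=> [f [[lam [vl ->]]|[t [Bt ->]]]|||c f _ Sf|].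
- rewrite KR_SM; apply: GenM_mul; [apply: Sm_SR|apply: Sm_MR]; exact: omega_refines.
- by rewrite DR_TR; apply: Sm_TR => //; [exact: omegaD_valid|exact: YInv_om].
- exact: GenM_zero.
- by move=> f g _ Sf _ Sg; apply: GenM_add.
- exact: GenM_scl.
by move=> f g _ Sf _ Sg; apply: GenM_mul.
Qed.

(** The word is taken at (1,w) and translated by equivariance to (x,y); acting by the inverse of [g]
    makes the coefficient at [x] equal to [b]. *)
Lemma lead_HTm x y b : inX x -> inX y -> isBt b -> exists2 A, HTm A & Lead A x y b.
Proof.
move=> xX yX Bb; pose g := rep x; pose w := (rep y * g^-1)%g.
exists (DR (actR g^-1%g b) * Lw S d w).
  by apply: GenM_mul; [apply/HTm_DR/isBt_act|exact: HTm_Lw].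
have wd : Sn d w by apply/SnP => i; rewrite leqNgt ltn_ord.
have := lead_yact g (lead_Lw S (leqnn d) wd).
rewrite !yact_xg mul1g mulgKV rmorph1 !xg_rep // => L2.
have := lead_DR (actR g^-1%g b) xX; rewrite -actRM mulVg actR1 => L1.
rewrite -[b in Lead _ _ _ b]mulr1; apply: (lead_mulX xX xX L1 L2).
by apply: btw_agree => i j; left.
Qed.

Lemma yact_fix_rk h y i : yact h y = y -> rk y (h i) = rk y i.
Proof.
move=> E; have H : (rep y * h * (rep y)^-1)%g \in Young (lamY y).
  by rewrite -mkY_eqE ?lamY_valid // -/(yact h y) E; apply/eqP/Y_mkY.
by rewrite /rk -[RHS](YoungP _ _ H) -!permM !mulgA mulVg mul1g.
Qed.

(** Each block of [u] lies in a block of [v], with no condition on the order of the blocks. *)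
Definition tied u v := forall i j, rk u i = rk u j -> rk v i = rk v j.

Lemma tied_fix h u v : tied v u -> yact h v = v -> yact h u = u.
Proof.
move=> vu E; have F i : rk u (h i) = rk u i by apply: vu; apply: yact_fix_rk.
by apply: Y_ext => i j; rewrite lt_yact /lt -[in RHS](permKV h i) -[in RHS](permKV h j) !F.
Qed.

(** [u] and [v] have the same blocks in different orders. Two adjacent blocks of [u] which [v] puts
    in the opposite order are merged; [meet r v] splits them again in the order of [v], so agreement
    grows. *)
Lemma merge_exists u v : tied u v -> tied v u -> u <> v ->
  exists r, [/\ crs u r, (forall i j, lt u i j -> lt r i j || lt v j i) &
    (co u v < co (meet r v) v)%N].
Proof.
move=> uv vu neq.
pose P (q : 'I_d * 'I_d) := lt u q.1 q.2 && lt v q.2 q.1.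
have [e0 Pe0] : exists e0, P e0.
  apply/existsP; apply: contra_notT neq; rewrite negb_exists => /forallP H.
  have tri (w w' : Y d) : tied w' w -> (forall i j, lt w i j -> ~~ lt w' j i) ->
      forall i j, lt w i j -> lt w' i j.
    move=> ww' Hw i j wij; have := Hw _ _ wij; rewrite /lt -leqNgt leq_eqVlt => /orP[/eqP E|//].
    by move: wij; rewrite /lt (ww' _ _ E) ltnn.
  have H1 i j : lt u i j -> ~~ lt v j i by have := H (i, j); rewrite negb_and => /orP[/negPf ->|].
  have H2 i j : lt v i j -> ~~ lt u j i.
    by move=> vij; apply/negP => /H1; rewrite vij.
  by apply: Y_ext => i j; apply/idP/idP; apply: tri.
(* An inverted pair of minimal rank difference in [u]: a block strictly between would give a closer
   inversion. *)
pose e := [arg min_(e < e0 | P e) (rk u e.2 - rk u e.1)]%N.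
have [Pe mine] : P e /\ forall f, P f -> (rk u e.2 - rk u e.1 <= rk u f.2 - rk u f.1)%N.
  by rewrite /e; case: arg_minnP.
move: e Pe mine => -[i j] /= /andP[uij vji] mine; rewrite /= in uij vji mine.
have nobtw (m : 'I_d) : ~~ (lt u i m && lt u m j).
  apply/negP => /andP[uim umj]; case: (boolP (lt v m i)) => [vmi|nvmi].
    by have := mine (i, m); rewrite /P /= uim vmi => /(_ isT); move: uim umj; rewrite /lt; lia.
  case: (boolP (lt v j m)) => [vjm|nvjm].
    by have := mine (m, j); rewrite /P /= umj vjm => /(_ isT); move: uim umj; rewrite /lt; lia.
  by move: nvmi nvjm vji; rewrite /lt; lia.
(* The block of [j] receives the rank of the block of [i]. *)
pose f (m : 'I_d) := if rk u m == rk u j then rk u i else rk u m.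
have [r rE] := existsY f.
have rankE (a b : 'I_d) : lt u a b -> ~~ lt r a b -> rk u a = rk u i /\ rk u b = rk u j.
  have := nobtw a; rewrite rE /f /lt => nb ab; move: uij; rewrite /lt => uij.
  by case: eqP => Ea; case: eqP => Eb; lia.
have opp (a b : 'I_d) : lt u a b -> lt r a b || lt v b a.
  move=> ab; case: (boolP (lt r a b)) => //= /(rankE _ _ ab)[Ea Eb].
  by rewrite /lt (uv _ _ Ea) (uv _ _ Eb).
exists r; split=> //.
  move=> a b; have := nobtw a; have := nobtw b; rewrite rE /f /lt; move: uij; rewrite /lt.
  by case: eqP => Ea; case: eqP => Eb; lia.
apply/proper_card/properP; split.
  apply/subsetP => -[a b]; rewrite !inE /= => /andP[ab vab]; rewrite vab andbT lt_meet.
  by case/orP: (opp _ _ ab) => [->//|]; rewrite lt_asym.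
have fij : f i = f j by rewrite /f eqxx; case: ifP.
exists (j, i); rewrite !inE /=; last by rewrite (lt_asym uij).
by rewrite vji andbT lt_meet !rE fij ltnn vji.
Qed.
End Algebras.

(** * Realizing and peeling off leading terms *)

Section Closure.
Variables (d' : nat) (S : datum d'.+1).
Notation d := d'.+1.
Notation Z := (dZ S).
Notation R := (dR S).
Notation HR := (HR S).
Notation DR := (@DR d' S).
Notation SR := (SR S).
Notation MR := (MR S).
Notation KR := (KR S).
Notation TR := (@TR d' S).
Notation Sm := (@Sm d' S).
Notation HTm := (@HTm d' S).
Notation thet := (@thet d' S).
Notation sp := (@sp d').
Notation pos := (@pos d').
Notation om := (omegaD d).
Implicit Types (g h w : 'S_d) (x y z u v r : Y d) (p q n m k a : nat) (A B : Mx d R) (i j : 'I_d)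
  (D lam nu mu : {set 'I_d}) (b c t : R).

Lemma refines_crs z v : crs z v -> refines (lamY z) (lamY v).
Proof. by move=> zv; split; [exact: lamY_valid|exact: lamY_valid|exact: crs_lam]. Qed.

(** Conjugating by the representative turns invariance under the stabilizer of [v] into invariance
    under the Young subgroup. *)
Lemma lead_TR v b : (forall h, yact h v = v -> actR h b = b) ->
  YInv (lamY v) (actR (rep v)^-1%g b) /\ Lead (TR (lamY v) (actR (rep v)^-1%g b)) v v b.
Proof.
move=> fixb; have YI : YInv (lamY v) (actR (rep v)^-1%g b).
  move=> s sY; rewrite -actRM; pose h := ((rep v)^-1 * s * rep v)%g.
  have -> : ((rep v)^-1 * s = h * (rep v)^-1)%g by rewrite mulgK.
  rewrite actRM fixb // /yact {3}(Y_mkY v); apply: mkY_eq.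
  by rewrite !mulgA mulgV mul1g mulgK vcut_id ?lamY_valid.
split=> //; split; first exact: eqv_TR.
  move=> y y'; rewrite ent_TR1; case: ifP; last by rewrite eqxx.
  case/andP => /eqP tv /eqP <- _; split=> //; first by rewrite (co_refl_lam tv).
  by move=> _; have [h ->] := yact_trans (esym tv); exists h.
by rewrite ent_TR1 !eqxx thet_crs // rmorph1 mul1r -actRM mulVg actR1.
Qed.

Lemma coC u v : co u v = co v u.
Proof. by rewrite /co; apply: eq_card => q; rewrite !inE andbC. Qed.

Lemma co_lt_meet u v : meet v u != v -> (co u v < co u (meet v u))%N.
Proof.
move=> neq; have [i [j [ml nl]]] : exists i j, lt (meet v u) i j /\ ~~ lt v i j.
  have [/existsP[i /existsP[j /andP[]]]|] := boolP [exists i, exists j, lt (meet v u) i j && ~~ lt v i j].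
    by exists i, j.
  rewrite negb_exists => /forallP H; case/eqP: neq; apply: Y_ext => i j.
  apply/idP/idP => [mij|]; last exact: meet_crs.
  by have := H i; rewrite negb_exists => /forallP/(_ j); rewrite mij negbK.
apply/proper_card/properP; split.
  by apply/subsetP => q; rewrite !inE => /andP[-> vq]; apply: meet_crs.
exists (i, j); rewrite !inE /= ?(negPf nl) ?andbF // ml andbT.
by move: ml; rewrite lt_meet (negPf nl) /= => /andP[].
Qed.

Lemma tied_meet u v : meet u v = u -> tied u v.
Proof.
move=> E i j Eij; have := lt_meet u v i j; have := lt_meet u v j i; rewrite E /lt Eij ltnn /=.
by move=> /esym/negbT; rewrite -leqNgt => a /esym/negbT; rewrite -leqNgt => b; apply/eqP; rewrite eqn_leq a b.
Qed.

(** Induction on the missing agreement. If [v] or [u] can be refined by the other, an S or an M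
    comes back from the refinement. Otherwise both have the same blocks: for equal points t_lambda
    does it, and else [merge_exists] inverts two adjacent blocks through S, then M. *)
Lemma lead_Sm u v b : isBt b -> (forall h, yact h u = u -> yact h v = v -> actR h b = b) ->
  exists2 A, Sm A & Lead A u v b.
Proof.
move: {2}(d * d - co u v).+1 (ltnSn (d * d - co u v)) => N.
elim: N u v => [|N IH] u v HN Bb fixb; first by [].
have cle := co_le.
have [E1|n1] := eqVneq (meet v u) v; last first.
  have vz := @meet_crs _ v u; have [||A SA LA] := IH u (meet v u) _ Bb.
  - by have := co_lt_meet n1; have := cle _ u (meet v u); lia.
  - move=> h hu hz; apply: fixb => //.
    by have := @crs_same _ _ _ h 1%g vz; rewrite !yact1 => ->.
  exists (A * SR (lamY (meet v u)) (lamY v)); last exact: lead_mulS.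
  by apply: GenM_mul => //; apply/Sm_SR/refines_crs.
have [E2|n2] := eqVneq (meet u v) u; last first.
  have uz := @meet_crs _ u v; have [||A SA LA] := IH (meet u v) v _ Bb.
  - by rewrite (coC _ v); have := co_lt_meet n2; have := cle _ v (meet u v); rewrite (coC v u); lia.
  - move=> h hz hv; apply: fixb => //.
    by have := @crs_same _ _ _ h 1%g uz; rewrite !yact1 => ->.
  exists (MR (lamY u) (lamY (meet u v)) * A); last exact: lead_Mmul.
  by apply: GenM_mul => //; apply/Sm_MR/refines_crs.
have uv := tied_meet E2; have vu := tied_meet E1.
have [E|/eqP neq] := eqVneq u v.
  subst v; have [|YI L] := @lead_TR u b; first by move=> h hu; apply: fixb.
  exists (TR (lamY u) (actR (rep u)^-1%g b)) => //.
  by apply: Sm_TR => //; [exact: lamY_valid|exact: isBt_act].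
have [r [ur op lt_co]] := merge_exists uv vu neq.
have [||A SA LA] := IH (meet r v) v _ Bb; first by have := cle _ (meet r v) v; lia.
  by move=> h _ hv; apply: fixb => //; apply: tied_fix vu hv.
exists (SR (lamY u) (lamY r) * (MR (lamY r) (lamY (meet r v)) * A)).
  apply: GenM_mul; first exact/Sm_SR/refines_crs.
  by apply: GenM_mul => //; apply/Sm_MR/refines_crs/meet_crs.
by apply: lead_Smul => //; apply: lead_Mmul.
Qed.

Definition typ mu lam A := forall y y', ent A y y' != 0 -> lamY y = mu /\ lamY y' = lam.

Lemma lead_typ A u v b : Lead A u v b -> typ (lamY u) (lamY v) A.
Proof. by move=> [_ sA _] y y' /sA[]. Qed.

Lemma typ_neq mu lam A y y' : typ mu lam A -> (lamY y != mu) || (lamY y' != lam) -> ent A y y' = 0.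
Proof.
move=> tA; apply: contraTeq => /tA[-> ->]; by rewrite !eqxx.
Qed.

Lemma ent_SR nu lam B y y' : validD lam -> ent (SR nu lam * B) y y' =
  if lamY y == nu then io (thet y (proj lam y)) * ent B (proj lam y) y' else 0.
Proof.
move=> vl; rewrite entM (bigD1 (proj lam y)) //= big1 => [|z /negPf nz]; rewrite ent_SR1.
  by rewrite lamY_proj // !eqxx !andbT addr0; case: ifP => // _; rewrite mul0r.
by rewrite [_ == z]eq_sym nz !andbF mul0r.
Qed.

Lemma ent_mulMR A lam nu y x : validD lam -> ent (A * MR lam nu) y x =
  if lamY x == nu then ent A y (proj lam x) else 0.
Proof.
move=> vl; rewrite entM (bigD1 (proj lam x)) //= big1 => [|z /negPf nz]; rewrite ent_MR1.
  by rewrite lamY_proj // !eqxx andbT addr0; case: (_ == nu); rewrite ?mulr1 ?mulr0.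
by rewrite [_ == z]eq_sym nz !andbF mulr0.
Qed.

Lemma co_mono u z v y : crs z u -> crs y v -> (co u v <= co z y)%N.
Proof.
move=> zu wv; apply/subset_leq_card/subsetP => -[i j]; rewrite !inE /= => /andP[ui vj].
by rewrite (zu _ _ ui) (wv _ _ vj).
Qed.

(** Integrality is known only on X x X. The entry at (u,v) is moved there without changing its
    level, by total refinements of [u] and [v] that create no new agreement; the Theta factors of
    the refinements match those of S. *)
Lemma lead_coef mu lam A (N : nat) u v : validD mu -> validD lam ->
  Un d (SR om mu * A * MR lam om) ->
  (forall y y', ent A y y' != 0 -> (N <= co y y')%N) ->
  lamY u = mu -> lamY v = lam -> co u v = N ->
  exists2 b, isBt b & ent A u v = io (thet u v) * b.
Proof.
move=> vm vl UF supp um vl' uvN.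
pose o := xg (1%g : 'S_d).
(* Ties of one point are broken against the other; slots tied in both are ordered by [o] in [x'] and
   by its reverse in [x]. *)
pose x' := meet (opref u v) o; pose x := opref (opref v u) o.
have E1 i j : lt x' i j = (lt u i j || ~~ lt u j i && lt v j i) ||
    ~~ (lt u j i || ~~ lt u i j && lt v i j) && lt o i j.
  by rewrite lt_meet !lt_opref.
have E2 i j : lt x i j = (lt v i j || ~~ lt v j i && lt u j i) ||
    ~~ (lt v j i || ~~ lt v i j && lt u i j) && lt o j i.
  by rewrite !lt_opref.
have as2 y i j : lt y i j && lt y j i = false.
  by case: (boolP (lt y i j)) => //= H; rewrite lt_asym.
have c1 : crs x' u by move=> i j uij; rewrite E1 uij.
have c2 : crs x v by move=> i j vij; rewrite E2 vij.
have oX : inX o by apply: inX_xg.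
have x'X : inX x'.
  apply: total_inX => i j ij; rewrite !E1; have := lt_total oX ij.
  by case: (lt u i j); case: (lt u j i); case: (lt v i j); case: (lt v j i);
     case: (lt o i j); case: (lt o j i).
have xX : inX x.
  apply: total_inX => i j ij; rewrite !E2; have := lt_total oX ij.
  by case: (lt u i j); case: (lt u j i); case: (lt v i j); case: (lt v j i);
     case: (lt o i j); case: (lt o j i).
have co' : co x' x = co u v.
  rewrite /co; apply: eq_card => -[i j]; rewrite !inE /= E1 E2.
  have := as2 u i j; have := as2 v i j; have := as2 o i j.
  by case: (lt u i j); case: (lt u j i); case: (lt v i j); case: (lt v j i);
     case: (lt o i j); case: (lt o j i).
have thx : thet x' x = thet x' u * thet u v.
  rewrite !thetE -big_split; apply: eq_bigr => -[i j] _ /=; rewrite E1 E2.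
  have := as2 u i j; have := as2 v i j; have := as2 o i j.
  by case: (lt u i j); case: (lt u j i); case: (lt v i j); case: (lt v j i);
     case: (lt o i j); case: (lt o j i); rewrite //= ?mulr1 ?mul1r.
have entF y z : ent (SR om mu * A * MR lam om) y z =
    if inX y && inX z then io (thet y (proj mu y)) * ent A (proj mu y) (proj lam z) else 0.
  rewrite ent_mulMR // ent_SR // /inX; case: (lamY z == om); last by rewrite andbF.
  by rewrite andbT.
have px' : proj mu x' = u by rewrite -um crs_proj.
have px : proj lam x = v by rewrite -vl' crs_proj.
have subX y ka : inX y -> validD ka -> crs y (proj ka y).
  by move=> /eqP yX vk; apply: proj_crs => //; rewrite yX sub_om.
have suppF y z : ent (SR om mu * A * MR lam om) y z != 0 -> (N <= co y z)%N.
  rewrite entF; case: ifP => [/andP[yX zX] nz|]; last by rewrite eqxx.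
  apply: leq_trans (supp _ _ _) (co_mono (subX _ mu yX vm) (subX _ lam zX vl)).
  by apply: contraNneq nz => ->; rewrite mulr0.
have [b Bb E] := leadH UF suppF x'X xX (etrans co' uvN).
exists b => //; apply: (@thet_inj _ S x' u); rewrite mulrA -rmorphM -thx -E entF.
by rewrite x'X xX px' px.
Qed.

(** An outer induction raises the minimal level, which is bounded by d * d; an inner one counts the
    nonzero entries at that level. *)
Lemma lead_closure (A : Mx d R -> Prop) mu lam : validD mu -> validD lam ->
  A 0 -> (forall f f', A f -> A f' -> A (f + f')) ->
  (forall f, A f -> eqv f) -> (forall f, A f -> typ mu lam f) ->
  (forall f, A f -> Un d (SR om mu * f * MR lam om)) ->
  (forall u v b, lamY u = mu -> lamY v = lam -> isBt b ->
    (forall h, yact h u = u -> yact h v = v -> actR h b = b) -> exists2 f, A f & Lead f u v b) ->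
  forall f, eqv f -> typ mu lam f -> Un d (SR om mu * f * MR lam om) -> A f.
Proof.
move=> vm vl A0 AD Ae At AU AL.
suff H (N : nat) (f : Mx d R) : eqv f -> typ mu lam f -> Un d (SR om mu * f * MR lam om) ->
    (forall y y', ent f y y' != 0 -> (d * d < co y y' + N)%N) -> A f.
  move=> f ef tf Uf; apply: (H (d * d).+1) => // y y' _; lia.
elim: N f => [|N IH] f ef tf Uf supp.
  suff -> : f = 0 by [].
  apply: entP => y y'; rewrite ent0; apply/eqP/negPn/negP => /supp.
  by have := co_le y y'; lia.
(* The nonzero entries at the lowest level that [supp] allows. *)
pose top (f : Mx d R) := [set q : Y d * Y d | (ent f q.1 q.2 != 0) && (co q.1 q.2 + N == d * d)%N].
move: {2}#|top f| (leqnn #|top f|) => T; elim: T f ef tf Uf supp => [|T IHT] f ef tf Uf supp cT.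
  apply: IH => // y y' nz; have := supp _ _ nz; rewrite addnS ltnS leq_eqVlt => /orP[/eqP E|//].
  move: cT; rewrite leqn0 cards_eq0 => /eqP/setP/(_ (y, y')); rewrite !inE /= nz /= -E eqxx //.
have [E|/set0Pn[[u v]]] := eqVneq (top f) set0.
  by apply: IHT => //; rewrite E cards0.
rewrite inE /= => /andP[nz /eqP cuv].
have [um vl'] := tf _ _ nz.
have [|b Bb Eb] := lead_coef (N := co u v) vm vl Uf _ um vl' erefl.
  by move=> y y' /supp; lia.
(* The coefficient [b] is fixed by the common stabilizer because [f] is equivariant and Theta(u,v)
   is fixed and invertible. *)
have [|a Aa La] := AL _ _ _ um vl' Bb.
  move=> h hu hv; apply: (@thet_inj _ S u v); rewrite -Eb -{2}hu -{2}hv ef Eb rmorphM actR_io.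
  by rewrite thet_act hu hv.
have [ea sa va] := La.
rewrite -[f](subrK a); apply: AD => //; apply: IHT.
- by apply: eqv_add => //; apply: eqv_opp.
- move=> y y'; rewrite entD entN => nf.
  have [f0|nf0] := eqVneq (ent f y y') 0; last exact: tf.
  by apply: At Aa _ _ _; apply: contraNneq nf => ->; rewrite f0 subrr.
- rewrite mulrBr mulrBl; apply: Un_add => //; rewrite -[X in Un d (- X)]scale1r -scaleNr.
  have := @Ud_scl _ S (- 1) _ (AU _ Aa); by rewrite !rmorphN1.
- move=> y y'; rewrite entD entN => nf.
  have [f0|nf0] := eqVneq (ent f y y') 0; last exact: supp.
  have na : ent a y y' != 0 by apply: contraNneq nf => ->; rewrite f0 subrr.
  by have [_ _ le _] := sa _ _ na; have := supp _ _ nz; lia.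
(* At this level [a] lives on the orbit of (u,v), where it equals [f]: no entry is created there and
   (u,v) disappears. *)
rewrite -ltnS; apply: leq_trans cT; apply/proper_card/properP; split.
  apply/subsetP => -[y y']; rewrite !inE /= entD entN => /andP[nf cyy]; rewrite cyy andbT.
  apply: contraNneq nf => f0; rewrite f0 sub0r oppr_eq0; apply/negPn/negP => na.
  have [_ _ _ ex] := sa _ _ na; have [|h [yh yh']] := ex; first by move/eqP: cyy cuv; lia.
  move: na; rewrite yh yh' ea va -Eb -ef -yh -yh' f0 eqxx //.
by exists (u, v); rewrite !inE /= ?nz ?cuv ?eqxx // entD entN va Eb subrr eqxx.
Qed.
End Closure.

(** * The double centralizer property for matrices *)

Section DoubleCentralizer.
Variables (d' : nat) (S : datum d'.+1).
Notation d := d'.+1.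
Notation Z := (dZ S).
Notation R := (dR S).
Notation HR := (HR S).
Notation DR := (@DR d' S).
Notation SR := (SR S).
Notation MR := (MR S).
Notation KR := (KR S).
Notation TR := (@TR d' S).
Notation Sm := (@Sm d' S).
Notation HTm := (@HTm d' S).
Notation thet := (@thet d' S).
Notation sp := (@sp d').
Notation pos := (@pos d').
Notation om := (omegaD d).
Implicit Types (g h w : 'S_d) (x y z u v r : Y d) (p q n m k a : nat) (A B : Mx d R) (i j : 'I_d)
  (D lam nu mu : {set 'I_d}) (b c t : R).

Lemma MR_om : MR om om = DR 1.
Proof.
apply: entP => x y; rewrite ent_MR1 ent_DR1 rmorph1 /inX.
have [xX|] := eqVneq (lamY x) om => //=; have [yX|nyX] /= := eqVneq (lamY y) om; last first.
  by case: eqP => // E; rewrite -E xX eqxx in nyX.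
by rewrite -{1}yX crs_proj // eq_sym; case: (x == y).
Qed.

Lemma crs_trans x y z : crs x y -> crs y z -> crs x z.
Proof. by move=> xy yz i j /yz/xy. Qed.

Lemma proj_proj nu lam y : validD nu -> validD lam -> lam \subset nu -> nu \subset lamY y ->
  proj lam (proj nu y) = proj lam y.
Proof.
move=> vn vl ln ny; have c1 := proj_crs vn ny.
have c2 : crs (proj nu y) (proj lam (proj nu y)) by apply: proj_crs; rewrite ?lamY_proj.
by rewrite -[LHS](crs_proj (crs_trans c1 c2)) lamY_proj.
Qed.

Lemma SR_SR nu lam : refines nu lam -> SR om nu * SR nu lam = SR om lam.
Proof.
move=> [vn vl ln]; apply: entP => x y; rewrite ent_SR // ent_SR1 [RHS]ent_SR1.
have [xX|//] /= := eqVneq (lamY x) om.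
rewrite lamY_proj // eqxx /= proj_proj ?xX ?sub_om //.
case: ifP => [/andP[_ /eqP <-]|_]; last by rewrite mulr0.
rewrite -rmorphM thet_btw //.
have c1 : crs x (proj nu x) by apply: proj_crs; rewrite ?xX ?sub_om.
have c2 : crs (proj nu x) (proj lam x).
  by rewrite -(@proj_proj nu lam x) ?xX ?sub_om //; apply: proj_crs; rewrite ?lamY_proj.
by move=> i j; split=> [/andP[_ /c2]|/c1 ->].
Qed.

Lemma MR_MR nu lam : refines nu lam -> MR lam nu * MR nu om = MR lam om.
Proof.
move=> [vn vl ln]; apply: entP => y x; rewrite ent_mulMR // !ent_MR1.
have [xX|] /= := eqVneq (lamY x) om; last by rewrite andbF.
by rewrite lamY_proj // eqxx /= proj_proj ?xX ?sub_om.
Qed.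

Lemma TR_MR lam t : validD lam -> YInv lam t -> TR lam t * MR lam om = MR lam om * DR t.
Proof.
move=> vl It; apply: entP => y x; rewrite ent_mulMR // ent_TR1.
have -> : ent (MR lam om * DR t) y x = ent (MR lam om) y x * (if inX x then actR (rep x) t else 0).
  rewrite entM (bigD1 x) //= ent_DR1 eqxx andbT big1 ?addr0 // => z /negPf nz.
  by rewrite ent_DR1 nz andbF mulr0.
rewrite ent_MR1 /inX; have [xX|] /= := eqVneq (lamY x) om; last by rewrite mulr0.
have [yl|] /= := eqVneq (lamY y) lam; last by rewrite mul0r.
rewrite [y == _]eq_sym; case: eqP => [<-|]; last by rewrite mul0r.
rewrite mul1r proj_mkY //; have sY := rep_mkY lam (rep x); rewrite vcut_id // in sY.
by rewrite -(mulgKV (rep x) (rep (mkY lam (rep x)))) actRM It.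
Qed.

Lemma SR_MR_neq nu lam mu : lam != mu -> SR nu lam * MR mu om = 0.
Proof.
move=> ne; apply: entP => x y; rewrite ent0 entM big1 // => z _; rewrite ent_SR1 ent_MR1.
have [zl|] := eqVneq (lamY z) lam; last by rewrite andbF mul0r.
by rewrite zl (negPf ne) mulr0.
Qed.

Lemma typ_MR_neq mu lam nu A : typ mu lam A -> lam != nu -> A * MR nu om = 0.
Proof.
move=> tA ne; apply: entP => x y; rewrite ent0 entM big1 // => z _; rewrite ent_MR1.
have [->|nz] := eqVneq (ent A x z) 0; first by rewrite mul0r.
by have [_ ->] := tA _ _ nz; rewrite (negPf ne) mulr0.
Qed.

Lemma typ_TR lam t : typ lam lam (TR lam t).
Proof. by move=> y y'; rewrite ent_TR1; case: ifP; rewrite ?eqxx // => /andP[/eqP <- /eqP <-]. Qed.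

Lemma typ_MR lam nu : typ lam nu (MR lam nu).
Proof. by move=> y y'; rewrite ent_MR1; case: and3P; rewrite ?eqxx // => -[/eqP -> /eqP ->]. Qed.

Lemma typ_SR lam nu : typ nu lam (SR nu lam).
Proof. by move=> y y'; rewrite ent_SR1; case: ifP; rewrite ?eqxx // => /and3P[/eqP -> /eqP ->]. Qed.

Lemma typ_mul nu mu lam A B : typ nu mu A -> typ mu lam B -> typ nu lam (A * B).
Proof. by move=> tA tB y y' /ent_mul_neq0[z [/tA[-> _] /tB[_ ->]]]. Qed.

Lemma HTm_typ A : HTm A -> typ om om A.
Proof.
move=> HA; have UA := HTm_Ud HA; rewrite -(Ud_DR1l UA) -(Ud_DR1r UA) !DR_TR.
move=> y y' /ent_mul_neq0[z [/typ_TR[-> _] /ent_mul_neq0[z' [_ /typ_TR[_ ->]]]]] //.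
Qed.

Lemma HTm_eqv A : HTm A -> eqv A.
Proof. by move/HTm_Sm/Sm_eqv. Qed.

Lemma eqv_MRHT nu B : validD nu -> HTm B -> eqv (MR nu om * B).
Proof.
move=> vn HB; apply: eqv_mul; last exact: HTm_eqv.
by apply: eqv_MR => //; apply: sub_om.
Qed.

Lemma SR_MR_HT nu B : validD nu -> HTm B -> SR om nu * (MR nu om * B) = KR nu * B.
Proof. by move=> vn HB; rewrite mulrA -KR_SM. Qed.

(** Leading elements are available since [v] is a total order: then so is [meet u v], and M_nu
    pushes forward an element of H_d^T led at (meet u v, v). *)
Lemma MRHT_closed nu f : validD nu -> eqv f -> typ nu om f -> Un d (SR om nu * f) ->
  exists2 B, HTm B & f = MR nu om * B.
Proof.
move=> vn ef tf Uf; have vo := omegaD_valid d.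
pose M f0 := exists2 B, HTm B & f0 = MR nu om * B.
suff: M f by []; apply: (@lead_closure _ S M nu om) => //.
- by exists 0; rewrite ?mulr0 //; apply: GenM_zero.
- move=> f1 f2 [B1 H1 ->] [B2 H2 ->]; exists (B1 + B2); rewrite ?mulrDr //; exact: GenM_add.
- by move=> _ [B HB ->]; apply: eqv_MRHT.
- by move=> _ [B HB ->]; apply: typ_mul (@typ_MR _ _) (HTm_typ HB).
- move=> _ [B HB ->]; rewrite SR_MR_HT // MR_om.
  have HK : HTm (KR nu * B) by apply: GenM_mul => //; apply: HTm_K.
  by rewrite Ud_DR1r; apply: HTm_Ud.
- move=> u v b un vX Bb _; pose x := meet u v.
  have vX' : inX v by apply/eqP.
  have xX : inX x.
    apply: total_inX => i j ij; rewrite !lt_meet; have := lt_total vX' ij.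
    by case: (lt u i j); case: (lt u j i); case: (lt v i j); case: (lt v j i).
  have [B HB LB] := lead_HTm xX vX' Bb.
  exists (MR nu om * B); first by exists B.
  by have := lead_Mmul LB; rewrite un -/x (eqP xX).
by rewrite MR_om Ud_DR1r.
Qed.

(** The heart of stability under S_{nu lambda}: after applying S_nu the product becomes K_lambda,
    which lies in the PBW span. *)
Lemma SR_MR_closed nu lam : refines nu lam ->
  exists2 B, HTm B & SR nu lam * MR lam om = MR nu om * B.
Proof.
move=> ref; have [vn vl ln] := ref; apply: MRHT_closed => //.
- by apply: eqv_mul; [apply: eqv_SR|apply: eqv_MR => //; apply: sub_om].
- exact: typ_mul (@typ_SR _ _) (@typ_MR _ _).
rewrite mulrA SR_SR // -KR_SM; exact: Ud_K.
Qed.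

Definition CTm (c : Mx d R) := exists hs : {set 'I_d} -> Mx d R, (forall lam, validD lam -> HTm (hs lam)) /\
  c = \sum_(lam | validD lam) MR lam om * hs lam.

Lemma CTm_gen lam B : validD lam -> HTm B -> CTm (MR lam om * B).
Proof.
move=> vl HB; exists (fun nu => if nu == lam then B else 0); split.
  by move=> nu _; case: ifP => // _; apply: GenM_zero.
rewrite (bigD1 lam) //= eqxx big1 ?addr0 // => nu /andP[_ /negPf ->]; exact: mulr0.
Qed.

Lemma CTm0 : CTm 0.
Proof.
exists (fun _ => 0); split=> [lam _|]; first exact: GenM_zero.
by rewrite big1 // => lam _; rewrite mulr0.
Qed.

Lemma CTm_add (c c' : Mx d R) : CTm c -> CTm c' -> CTm (c + c').
Proof.
move=> [hs [Hh ->]] [hs' [Hh' ->]]; exists (fun lam => hs lam + hs' lam); split.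
  by move=> lam vl; apply: GenM_add; [apply: Hh|apply: Hh'].
by rewrite -big_split; apply: eq_bigr => lam _; rewrite mulrDr.
Qed.

Lemma CTm_sum (I : Type) (s : seq I) (P : pred I) (F : I -> Mx d R) :
  (forall e, P e -> CTm (F e)) -> CTm (\sum_(i <- s | P i) F i).
Proof. by move=> H; apply: big_ind => //; [exact: CTm0|exact: CTm_add]. Qed.

Lemma CTm_mulr (c f : Mx d R) : CTm c -> HTm f -> CTm (c * f).
Proof.
move=> [hs [Hh ->]] Hf; rewrite mulr_suml; apply: CTm_sum => lam vl.
by rewrite -mulrA; apply: CTm_gen => //; apply: GenM_mul => //; apply: Hh.
Qed.

Lemma CTm_DR1 : CTm (DR 1).
Proof.
have H1 := HTm_DR (@isBt1 _ S).
rewrite -[DR 1](Ud_DR1l (HTm_Ud H1)) -{1}MR_om; apply: CTm_gen => //; exact: omegaD_valid.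
Qed.

Lemma CTm_MR lam : validD lam -> CTm (MR lam om).
Proof.
move=> vl; have -> : MR lam om = MR lam om * DR 1; last first.
  by apply: CTm_gen => //; apply/HTm_DR/isBt1.
by rewrite -MR_om; apply: entP => y x; rewrite ent_mulMR ?omegaD_valid // ent_MR1;
  case: (eqVneq (lamY x) om) => [<-|]; rewrite ?crs_proj // ?ent_MR1 ?eqxx // andbF.
Qed.

Lemma CTm_scl (c : dk S) (f : Mx d R) : CTm f -> CTm (io (kz c) *: f).
Proof.
move=> [hs [Hh ->]]; exists (fun lam => io (kz c) *: hs lam); split.
  by move=> lam vl; apply/GenM_scl/Hh.
rewrite scaler_sumr; apply: eq_bigr => lam vl; apply: entP => y x.
rewrite entZ !entM mulr_sumr; apply: eq_bigr => z _.
by rewrite entZ !mulrA ioC.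
Qed.

Lemma CTm_mull (s c : Mx d R) : Sm s -> CTm c -> CTm (s * c).
Proof.
move=> Ss; elim: Ss c => [f Hf||f g _ IHf _ IHg|e f _ IH|f g _ IHf _ IHg] c Cc.
- move: Cc => [hs [Hh ->]]; rewrite mulr_sumr; apply: CTm_sum => mu vm; rewrite mulrA.
  have hm := Hh _ vm.
  case: Hf => [[nu [lam [ref ->]]]|[[nu [lam [ref ->]]]|[lam [t [vl Bt It ->]]]]].
  + have [E|ne] := eqVneq lam mu; last by rewrite SR_MR_neq // mul0r; apply: CTm0.
    have [B HB] := SR_MR_closed ref; rewrite -E in hm * => ->; rewrite -mulrA.
    by case: ref => vn _ _; apply: CTm_gen => //; apply: GenM_mul.
  + have [E|ne] := eqVneq nu mu; last by rewrite (typ_MR_neq (@typ_MR _ _)) // mul0r; apply: CTm0.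
    by rewrite -E in hm *; rewrite MR_MR //; case: ref => _ vl _; apply: CTm_gen.
  have [E|ne] := eqVneq lam mu; last by rewrite (typ_MR_neq (@typ_TR _ _)) // mul0r; apply: CTm0.
  rewrite -E in hm *; rewrite TR_MR // -mulrA; apply: CTm_gen => //.
  by apply: GenM_mul => //; apply: HTm_DR.
- by rewrite mul0r; apply: CTm0.
- by rewrite mulrDl; apply: CTm_add; [apply: IHf|apply: IHg].
- by rewrite -sclA; apply/CTm_scl/IH.
by rewrite -mulrA; apply/IHf/IHg.
Qed.

Lemma rowMR_neq nu lam t : nu != lam -> TR nu t * MR lam om = 0.
Proof. by move=> ne; apply: typ_MR_neq ne; apply: typ_TR. Qed.

Lemma TR1_mul mu lam A : typ mu lam A -> TR mu 1 * A = A.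
Proof.
move=> tA; apply: entP => y y'; rewrite entM (bigD1 y) //= big1 => [|z /negPf nz].
  rewrite ent_TR1 eqxx andbT rmorph1 addr0; have [->|n0] := eqVneq (ent A y y') 0.
    by rewrite mulr0.
  by have [-> _] := tA _ _ n0; rewrite eqxx mul1r.
by rewrite ent_TR1 [y == z]eq_sym nz andbF mul0r.
Qed.

Lemma TR1_CTm mu (hs : {set 'I_d} -> Mx d R) : validD mu -> (forall lam, validD lam -> HTm (hs lam)) ->
  TR mu 1 * \sum_(lam | validD lam) MR lam om * hs lam = MR mu om * hs mu.
Proof.
move=> vm Hh; rewrite mulr_sumr (bigD1 mu) //= big1 ?addr0 => [|lam /andP[vl ne]].
  by rewrite mulrA (TR1_mul (@typ_MR _ _)).
by rewrite mulrA rowMR_neq ?mul0r // eq_sym.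
Qed.

(** 1_omega lies in C^T, so s * 1_omega does by stability, and the omega-rows of C^T are H_d^T. *)
Lemma HTm_corner f : HTm f <-> exists s, Sm s /\ f = DR 1 * s * DR 1.
Proof.
split=> [Hf|[s [Ss ->]]].
  exists f; split; first exact: HTm_Sm.
  by rewrite Ud_DR1l ?Ud_DR1r //; apply: HTm_Ud.
have [hs [Hh E]] := CTm_mull Ss CTm_DR1.
rewrite -mulrA E DR_TR TR1_CTm ?omegaD_valid // MR_om.
have H := Hh _ (omegaD_valid d); by rewrite Ud_DR1l //; apply: HTm_Ud.
Qed.

Definition EndL (phi : Mx d R -> Mx d R) :=
  [/\ forall c : Mx d R, CTm c -> CTm (phi c),
      forall c c' : Mx d R, CTm c -> CTm c' -> phi (c + c') = phi c + phi c' &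
      forall a c : Mx d R, Sm a -> CTm c -> phi (a * c) = a * phi c].

Definition EndR (phi : Mx d R -> Mx d R) :=
  [/\ forall c : Mx d R, CTm c -> CTm (phi c),
      forall c c' : Mx d R, CTm c -> CTm c' -> phi (c + c') = phi c + phi c' &
      forall a c : Mx d R, HTm a -> CTm c -> phi (c * a) = phi c * a].

Lemma phi_sum (phi : Mx d R -> Mx d R) (I : Type) (s : seq I) (P : pred I) (F : I -> Mx d R) :
  (forall c c' : Mx d R, CTm c -> CTm c' -> phi (c + c') = phi c + phi c') ->
  (forall e, P e -> CTm (F e)) ->
  phi (\sum_(e <- s | P e) F e) = \sum_(e <- s | P e) phi (F e).
Proof.
move=> add HF; elim: s => [|e s IH].
  rewrite !big_nil; have := add 0 0 CTm0 CTm0; rewrite addr0 => /eqP.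
  by rewrite -subr_eq0 opprD addNKr oppr_eq0 => /eqP.
rewrite !big_cons; case: ifP => // Pe; rewrite add ?IH //; first exact: HF.
exact: CTm_sum.
Qed.

(** C^T lies in the Schur algebra and contains 1_omega, so c = c * 1_omega forces phi(c) = c *
    phi(1_omega). *)
Lemma EndL_HTm phi : EndL phi <-> exists h : Mx d R, HTm h /\ forall c : Mx d R, CTm c -> phi c = c * h.
Proof.
split=> [[phiC add lin]|[h [Hh E]]]; last first.
  split=> [c Cc|c c' Cc Cc'|a c Sa Cc].
  - by rewrite E //; apply: CTm_mulr.
  - by rewrite !E ?mulrDl //; apply: CTm_add.
  by rewrite !E ?mulrA //; apply: CTm_mull.
have S1 : Sm (DR 1) by apply/HTm_Sm/HTm_DR/isBt1.
pose h := phi (DR 1).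
have Hh : HTm h.
  have [hs [Hh E]] := phiC _ CTm_DR1.
  have -> : h = DR 1 * h.
    by rewrite -lin //; [rewrite DRM mulr1|exact: CTm_DR1].
  rewrite /h E DR_TR TR1_CTm ?omegaD_valid // MR_om.
  have H := Hh _ (omegaD_valid d); by rewrite Ud_DR1l //; apply: HTm_Ud.
exists h; split=> // c Cc; have [hs [Hhs E]] := Cc.
have Ec : c = c * DR 1.
  by rewrite E mulr_suml; apply: eq_bigr => lam vl; rewrite -mulrA Ud_DR1r //; apply/HTm_Ud/Hhs.
have Sc : Sm c.
  rewrite E; apply: GenM_sum => lam vl; apply: GenM_mul; last exact/HTm_Sm/Hhs.
  exact/Sm_MR/omega_refines.
by rewrite {1}Ec lin //; exact: CTm_DR1.
Qed.

Lemma HTm_faithful (h h' : Mx d R) : HTm h -> HTm h' -> (forall c : Mx d R, CTm c -> c * h = c * h') -> h = h'.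
Proof.
move=> Hh Hh' E; have := E _ CTm_DR1.
by rewrite !Ud_DR1l //; apply: HTm_Ud.
Qed.

(** Multiplying by M_lambda on the right copies the columns of type lambda to X, and X -> Y_lambda
    is onto. *)
Lemma Sm_faithful A B : (forall c : Mx d R, CTm c -> A * c = B * c) -> A = B.
Proof.
move=> E; apply: entP => y y'; have vl := lamY_valid y'.
have := congr1 (fun f => ent f y (xg (rep y'))) (E _ (CTm_MR vl)).
by rewrite /= !ent_mulMR // lamY_mkY vcut_omega eqxx proj_mkY // rep_xg -Y_mkY.
Qed.
End DoubleCentralizer.

(** * Endomorphisms that commute with the wreath product *)

Section RightEndomorphisms.
Variables (d' : nat) (S : datum d'.+1).
Notation d := d'.+1.
Notation Z := (dZ S).
Notation R := (dR S).
Notation HR := (HR S).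
Notation DR := (@DR d' S).
Notation SR := (SR S).
Notation MR := (MR S).
Notation KR := (KR S).
Notation TR := (@TR d' S).
Notation Sm := (@Sm d' S).
Notation HTm := (@HTm d' S).
Notation CTm := (@CTm d' S).
Notation EndR := (@EndR d' S).
Notation sp := (@sp d').
Notation pos := (@pos d').
Notation om := (omegaD d).
Implicit Types (g h w : 'S_d) (x y z u v r : Y d) (p q n m k a : nat) (A B : Mx d R) (i j : 'I_d)
  (D lam nu mu : {set 'I_d}) (b c t : R).

Lemma ent_mulDR A c y g : ent (A * DR c) y (xg g) = ent A y (xg g) * actR g c.
Proof.
rewrite entM (bigD1 (xg g)) //= ent_DR1 inX_xg eqxx rep_xg big1 ?addr0 // => z /negPf nz.
by rewrite ent_DR1 nz andbF mulr0.
Qed.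

Lemma ent_mulHR A p y g : ent (A * HR p) y (xg g) =
  ent A y (xg g) * io (bt (g (pos p)) (g (pos p.+1))) +
  ent A y (xg (sp p * g)%g) * io (th (g (pos p.+1)) (g (pos p))).
Proof.
have io_split (e f : Z) (m n : bool) : io (e * m%:R + f * n%:R) = io e * m%:R + io f * n%:R.
  by rewrite rmorphD rmorphM rmorphM !rmorph_nat.
pose F h := ent A y (xg h) * io (bt (h (pos p)) (h (pos p.+1))) * (h == g)%:R +
   ent A y (xg h) * io (th (h (pos p)) (h (pos p.+1))) * (h == (sp p * g)%g)%:R.
have -> : ent (A * HR p) y (xg g) = \sum_h F h.
  rewrite entM (bigID (@inX d)) /= [X in _ + X]big1 ?addr0 => [|x /negPf nx]; last first.
    by rewrite ent_map ent_HZ1 nx rmorph0 mulr0.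
  rewrite sum_X; apply: eq_bigr => h _; rewrite ent_map ent_HZ1 inX_xg rep_xg io_split.
  rewrite !(inj_eq (@xg_inj _)) /F mulrDr !mulrA [g == h]eq_sym; congr (_ + _ * _%:R).
  by rewrite -(inj_eq (mulgI (sp p))) mulgA spK mul1g eq_sym.
have delta (G : 'S_d -> R) e : \sum_h G h * (h == e)%:R = G e.
  rewrite (bigD1 e) //= eqxx mulr1 big1 ?addr0 // => h /negPf ->; exact: mulr0.
by rewrite big_split !delta !permM tpermL tpermR.
Qed.

Lemma sp_Young lam p : (p.+1 < d)%N -> pos p.+1 \notin lam -> sp p \in Young lam.
Proof.
move=> pd nl; have E : blk lam (pos p) = blk lam (pos p.+1).
  apply/eqP; rewrite eqn_leq leq_blk /=; last by rewrite !inordK //; lia.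
  rewrite leqNgt ltn_blk; apply/existsP => -[c /and3P[cl]]; rewrite !inordK; try lia.
  move=> c1 c2; case/negP: nl; rewrite (_ : pos p.+1 = c) //.
  by apply: val_inj; rewrite /= inordK; lia.
by apply/YoungP => i; rewrite /sp; case: tpermP => [->|->|].
Qed.

(** A permutation without descents is increasing, hence trivial. *)
Lemma descent (s : 'S_d) : s != 1%g -> exists p, (p.+1 < d)%N /\ (s (pos p.+1) < s (pos p))%N.
Proof.
move=> s1; have [/existsP[p /andP[pd lts]]|] :=
  boolP [exists p : 'I_d, (p.+1 < d)%N && (s (pos p.+1) < s (pos p))%N]; first by exists p.
rewrite negb_exists => /forallP H; case/eqP: s1.
have step n : (n.+1 < d)%N -> (s (pos n) <= s (pos n.+1))%N.
  move=> nd; have nd' : (n < d)%N by lia.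
  by have := H (Ordinal nd'); rewrite /= nd /= -leqNgt.
have mono k n : (n + k < d)%N -> (s (pos n) <= s (pos (n + k)))%N.
  elim: k => [|k IH] nk; first by rewrite addn0.
  by apply: leq_trans (IH _) _; [lia|rewrite addnS; apply: step; lia].
apply/permP => i; apply: val_inj; rewrite perm1.
apply: (@sorted_perm_eq _ (fun j => j : nat) s) => // a b ab.
have := mono (b - a)%N a; rewrite subnKC //; have := ltn_ord b => bd /(_ bd).
by rewrite /pos !inord_val.
Qed.

Lemma co_descent (s : 'S_d) p : (p.+1 < d)%N -> (s (pos p.+1) < s (pos p))%N ->
  (co (xg 1%g) (xg s) < co (xg 1%g) (xg (sp p * s)%g))%N.
Proof.
move=> pd lts; have p0 : pos p = p :> nat by rewrite inordK //; lia.
have p1 : pos p.+1 = p.+1 :> nat by rewrite inordK.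
apply/proper_card/properP; split.
  apply/subsetP => -[a b]; rewrite !inE /= !lt_xg invMg !permM tpermV -/(sp _) invg1 !perm1.
  move=> /andP[ab sab]; rewrite ab sp_ltE //; apply/negP => /andP[/eqP Ea /eqP Eb]; last by move: sab; rewrite Ea Eb ltnNge leqnSn.
  have Ea' : a = s (pos p).
    by rewrite -(permKV s a); congr (s _); apply: val_inj; rewrite /= p0.
  have Eb' : b = s (pos p.+1).
    by rewrite -(permKV s b); congr (s _); apply: val_inj; rewrite /= p1.
  by move: ab; rewrite Ea' Eb' ltnNge ltnW.
exists (s (pos p.+1), s (pos p)).
  rewrite !inE /= !lt_xg invMg !permM tpermV -/(sp _) invg1 !perm1 lts !permK /=.
  by rewrite !sp_val // p0 p1 eqxx; case: eqP => [|_]; [lia|rewrite eqxx].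
by rewrite !inE /= !lt_xg invg1 !perm1 lts !permK /= p0 p1 ltnNge ltnW.
Qed.

(** This is H_p - bar alpha_p: the sum of [st] and the reversed [al] is bar alpha in the slots p,
    p+1. By [ent_mulQp] it takes the difference of two adjacent columns, up to theta. *)
Definition Qp p : Mx d R :=
  HR p - DR (io (st S (pos p) (pos p.+1) + al (pos p.+1) (pos p))).

Lemma ent_mulQp A p y g : (p.+1 < d)%N -> ent (A * Qp p) y (xg g) =
  (ent A y (xg (sp p * g)%g) - ent A y (xg g)) * io (th (g (pos p.+1)) (g (pos p))).
Proof.
move=> pd; have np : pos p != pos p.+1 :> 'I_d by apply: pos_neq; lia.
have np' : pos p.+1 != pos p :> 'I_d by rewrite eq_sym.
have ng' : g (pos p.+1) != g (pos p) by rewrite (inj_eq perm_inj).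
rewrite mulrBr entD entN ent_mulHR ent_mulDR actR_io rmorphD /= act_st // act_al //.
rewrite mulrBl (thE ng') /st !rmorphD !mulrDr; set f := ent A y (xg g); set e := ent A y _.
set x1 := f * _; set x2 := e * _ ; set x3 := e * _; set x4 := f * io (bt _ _); set x5 := f * _.
rewrite -[x1 + x4 + x5]addrA opprD addrA [x1 + _ - x1]addrC addrA addNr add0r.
by rewrite [x4 + x5]addrC.
Qed.

Lemma HTm_Qp p : (p.+1 < d)%N -> HTm (Qp p).
Proof.
move=> pd; have np : pos p != pos p.+1 :> 'I_d by apply: pos_neq; lia.
have np' : pos p.+1 != pos p :> 'I_d by rewrite eq_sym.
apply: GenM_add; first exact: HTm_HR.
apply/GenM_opp/HTm_DR; rewrite rmorphD; apply: isBtD; apply: isBt_io.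
  exact: isC_st.
exact: isC_al.
Qed.

Lemma MR_Qp lam p : validD lam -> (p.+1 < d)%N -> pos p.+1 \notin lam -> MR lam om * Qp p = 0.
Proof.
move=> vl pd nl; have T := typ_mul (@typ_MR _ S lam om) (HTm_typ (HTm_Qp pd)).
apply: entP => y x; rewrite ent0; have [xX|nX] := boolP (inX x); last first.
  by apply: (typ_neq T); rewrite [_ == om](negPf nX) orbT.
rewrite -(xg_rep xX) ent_mulQp // !ent_MR1 !lamY_mkY !proj_mkY // !rep_xg.
have -> : mkY lam (sp p * rep x)%g = mkY lam (rep x).
  by apply: mkY_eq; rewrite mulgK vcut_id // sp_Young.
by rewrite subrr mul0r.
Qed.

(** As theta is invertible, A Q_p = 0 equates the columns of [g] and s_p g. An element of the Young
    subgroup is reduced to 1 by removing descents, each inside a block, and every removal raises the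
    agreement with 1. *)
Lemma Young_invariant lam A : (forall p, (p.+1 < d)%N -> pos p.+1 \notin lam -> A * Qp p = 0) ->
  forall y g (s : 'S_d), s \in Young lam -> ent A y (xg (s * g)%g) = ent A y (xg g).
Proof.
move=> AQ y g s; move: {2}(d * d - co (xg 1%g) (xg s))%N (leqnn (d * d - co (xg 1%g) (xg s))) => N.
elim: N s => [|N IH] s HN sY; have [->|s1] := eqVneq s 1%g; rewrite ?mul1g //;
  have [p [pd lts]] := descent s1; have lt_co := co_descent pd lts;
  have cle := co_le (xg 1%g) (xg (sp p * s)%g); first by lia.
have sbl (a b : 'I_d) : (a <= b)%N -> (s b < s a)%N -> blk lam a = blk lam b.
  move=> ab sab; apply/eqP; rewrite eqn_leq leq_blk // -(YoungP _ _ sY b) -(YoungP _ _ sY a).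
  by rewrite leq_blk // ltnW.
have nl : pos p.+1 \notin lam.
  have pp : (pos p < pos p.+1)%N by rewrite !inordK //; lia.
  apply/negP => pl; have := @ltn_blk_cut _ lam (pos p.+1) (pos p) (pos p.+1) pl pp (leqnn _).
  by rewrite (sbl _ _ (ltnW pp) lts) ltnn.
have sY' : (sp p * s)%g \in Young lam.
  apply/YoungP => i; rewrite permM (YoungP _ _ sY); exact: (YoungP _ _ (sp_Young pd nl)).
rewrite -(IH (sp p * s)%g) //; last by lia.
have := congr1 (fun f => ent f y (xg (s * g)%g)) (AQ p pd nl).
rewrite /= ent0 ent_mulQp // mulgA => E.
have ng : (s * g)%g (pos p.+1) != (s * g)%g (pos p).
  by rewrite (inj_eq perm_inj); apply: pos_neq; lia.
move/(congr1 (fun e => e * io (thv ((s * g)%g (pos p.+1)) ((s * g)%g (pos p))))): E.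
rewrite -mulrA -rmorphM (thK ng) rmorph1 mulr1 mul0r => /eqP; by rewrite subr_eq0 => /eqP ->.
Qed.

(** The images of the M_lambda determine phi. Their components descend along X -> Y_lambda to [F],
    and [lead_closure] puts [F] into the Schur algebra because S_mu * F * M_lambda lies in H_d^T. *)
Lemma EndR_Sm phi : EndR phi <-> exists s : Mx d R, Sm s /\ forall c : Mx d R, CTm c -> phi c = s * c.
Proof.
split=> [[phiC add lin]|[s [Ss E]]]; last first.
  split=> [c Cc|c c' Cc Cc'|a c Ha Cc].
  - by rewrite E //; apply: CTm_mull.
  - by rewrite !E ?mulrDr //; apply: CTm_add.
  by rewrite !E ?mulrA //; apply: CTm_mulr.
pose m lam mu := TR mu 1 * phi (MR lam om).
(* The column at [y'] is read off at one total order above [y']; [minv] shows that the choice is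
   immaterial. *)
pose F lam mu : Mx d R := mk (fun y y' => if lamY y' == lam then ent (m lam mu) y (xg (rep y')) else 0).
have mE lam mu : validD lam -> validD mu -> exists2 B, HTm B & m lam mu = MR mu om * B.
  move=> vl vm; have [hs [Hh E]] := phiC _ (CTm_MR S vl).
  by exists (hs mu); [apply: Hh|rewrite /m E TR1_CTm].
have mQ lam mu p : validD lam -> (p.+1 < d)%N -> pos p.+1 \notin lam -> m lam mu * Qp p = 0.
  move=> vl pd nl; rewrite /m -mulrA -lin //; [|exact: HTm_Qp|exact: CTm_MR].
  rewrite MR_Qp //; have := add 0 0 (CTm0 S) (CTm0 S); rewrite addr0 => /eqP.
  by rewrite -subr_eq0 opprD addNKr oppr_eq0 => /eqP ->; rewrite mulr0.
have minv lam mu y g (s : 'S_d) : validD lam -> s \in Young lam ->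
    ent (m lam mu) y (xg (s * g)%g) = ent (m lam mu) y (xg g).
  by move=> vl; apply: Young_invariant => p pd nl; apply: mQ.
have FM lam mu : validD lam -> validD mu -> F lam mu * MR lam om = m lam mu.
  move=> vl vm; have [B HB EB] := mE _ _ vl vm.
  have tm : typ mu om (m lam mu) by rewrite EB; apply: typ_mul (@typ_MR _ _ _ _) (HTm_typ HB).
  apply: entP => y x; rewrite ent_mulMR //; have [xX|nX] := eqVneq (lamY x) om; last first.
    by rewrite (typ_neq tm) // nX orbT.
  rewrite ent_mk lamY_proj // eqxx proj_mkY //.
  have sY := rep_mkY lam (rep x); rewrite vcut_id // in sY.
  rewrite -(mulgKV (rep x) (rep (mkY lam (rep x)))) minv // xg_rep //.
  by rewrite /inX xX.
have FS lam mu : validD lam -> validD mu -> Sm (F lam mu) /\ typ mu lam (F lam mu).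
  move=> vl vm; have [B HB EB] := mE _ _ vl vm.
  have em : eqv (m lam mu) by rewrite EB; apply: eqv_MRHT.
  have tm : typ mu om (m lam mu) by rewrite EB; apply: typ_mul (@typ_MR _ _ _ _) (HTm_typ HB).
  have tF : typ mu lam (F lam mu).
    move=> y y'; rewrite ent_mk; case: (eqVneq (lamY y') lam) => [y'l nz|_]; last by rewrite eqxx.
    by have [] := tm _ _ nz.
  have eF : eqv (F lam mu).
    move=> h y y'; rewrite !ent_mk lamY_yact; case: (eqVneq (lamY y') lam) => [y'l|_]; last by rewrite rmorph0.
    have [s sY ->] := rep_yact h y'; rewrite y'l in sY.
    by rewrite minv // -yact_xg em.
  have UF : Un d (SR om mu * F lam mu * MR lam om).
    rewrite -mulrA FM // EB SR_MR_HT //; apply: HTm_Ud; apply: GenM_mul => //; exact: HTm_K.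
  pose M f := Sm f /\ typ mu lam f.
  suff: M (F lam mu) by []; apply: (@lead_closure _ S M mu lam) => //.
  - split; first exact: GenM_zero.
    by move=> y y'; rewrite ent0 eqxx.
  - move=> f f' [Sf tf] [Sf' tf']; split; first exact: GenM_add.
    move=> y y'; rewrite entD; have [->|n0] := eqVneq (ent f y y') 0; last by move=> _; apply: tf.
    by rewrite add0r; apply: tf'.
  - by move=> f [Sf _]; apply: Sm_eqv.
  - by move=> f [].
  - move=> f [Sf tf]; have [hs [Hh E]] := CTm_mull Sf (CTm_MR S vl).
    rewrite -mulrA -[f * _](@TR1_mul _ S mu om); last first.
      by apply: typ_mul tf (@typ_MR _ _ _ _).
    rewrite E TR1_CTm // (SR_MR_HT vm (Hh _ vm)); apply: HTm_Ud; apply: GenM_mul; last exact: Hh.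
    exact: HTm_K.
  move=> u v b um vl' Bb fixb; have [A SA LA] := lead_Sm Bb fixb.
  by exists A => //; split=> //; rewrite -um -vl'; apply: lead_typ LA.
exists (\sum_(lam | validD lam) \sum_(mu | validD mu) F lam mu); split.
  by apply: GenM_sum => lam vl; apply: GenM_sum => mu vm; have [] := FS _ _ vl vm.
move=> c [hs [Hh ->]]; rewrite (phi_sum _ add) => [|lam vl]; last first.
  by apply: CTm_gen => //; apply: Hh.
rewrite mulr_sumr; apply: eq_bigr => lam vl.
rewrite lin; [|exact: Hh|exact: CTm_MR].
rewrite mulrA; congr (_ * _); rewrite mulr_suml (bigD1 lam) //= [X in _ + X]big1 ?addr0.
  have [hs' [Hh' E]] := phiC _ (CTm_MR S vl).
  rewrite mulr_suml; transitivity (\sum_(mu | validD mu) m lam mu); last first.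
    by apply: eq_bigr => mu vm; rewrite FM.
  by rewrite {1}E; apply: eq_bigr => mu vm; rewrite /m E TR1_CTm.
move=> nu /andP[vn ne]; rewrite mulr_suml big1 // => mu vm.
by have [_ tF] := FS _ _ vn vm; rewrite (typ_MR_neq tF).
Qed.
End RightEndomorphisms.

(** * Renaming variables in rational functions *)

(** [renK] is defined through a chosen representative of the fraction, so the link between the two
    comes first. *)
Lemma frac_numden (D : idomainType) (x : {fraction D}) :
  x * FracField.tofrac (\d_(@repr_of _ _ x)) = FracField.tofrac (\n_(@repr_of _ _ x)).
Proof.
have d0 := denom_ratioP (@repr_of _ _ x).
have Ex : x = \pi_{fraction D}%qT (@repr_of _ _ x) :> {fraction D}.
  rewrite -{1}[x](@generic_quotient.reprK _ {fraction D}).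
  by rewrite generic_quotient.repr.unlock.
move: d0 Ex; set r := @repr_of _ _ x => d0 ->.
unlock FracField.tofrac; rewrite -[LHS]FracField.pi_mul /FracField.mulf.
apply/generic_quotient.eqmodP; rewrite /= FracField.equivfE !numden_Ratio ?mulf_neq0 ?oner_neq0 //.
by rewrite !mulr1 mulrC.
Qed.

Section Fractions.
Variable k : fieldType.
Implicit Types (m n : nat).

Lemma cstK_is_zmod m : zmod_morphism (@cstK k m).
Proof. by move=> x y; rewrite /cstK /tofracK !rmorphB. Qed.
Lemma cstK_is_monoid m : monoid_morphism (@cstK k m).
Proof.
split=> [|x y]; first by rewrite /cstK /tofracK !rmorph1.
by rewrite /cstK /tofracK !rmorphM.
Qed.
HB.instance Definition _ m := GRing.isZmodMorphism.Build k (Kf k m) (@cstK k m) (@cstK_is_zmod m).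
HB.instance Definition _ m := GRing.isMonoidMorphism.Build k (Kf k m) (@cstK k m) (@cstK_is_monoid m).

HB.instance Definition _ m := GRing.RMorphism.copy (@tofracK k m) (@FracField.tofrac {mpoly k[m]}).
HB.instance Definition _ m n (h : 'I_m -> 'I_n) := GRing.RMorphism.copy (@renP k m n h)
  (mmap (@mpolyC n k) (fun i => 'X_(h i))).

Lemma renPM m n (h : 'I_m -> 'I_n) (p q : {mpoly k[m]}) : renP h (p * q) = renP h p * renP h q.
Proof. exact: (rmorphM (mmap (@mpolyC n k) (fun i => 'X_(h i)))). Qed.
Lemma renPD m n (h : 'I_m -> 'I_n) (p q : {mpoly k[m]}) : renP h (p + q) = renP h p + renP h q.
Proof. exact: (rmorphD (mmap (@mpolyC n k) (fun i => 'X_(h i)))). Qed.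
Lemma renPB m n (h : 'I_m -> 'I_n) (p q : {mpoly k[m]}) : renP h (p - q) = renP h p - renP h q.
Proof. exact: (rmorphB (mmap (@mpolyC n k) (fun i => 'X_(h i)))). Qed.
Lemma tofracKM m (p q : {mpoly k[m]}) : tofracK (p * q) = tofracK p * tofracK q.
Proof. exact: (rmorphM (@FracField.tofrac {mpoly k[m]})). Qed.
Lemma tofracKD m (p q : {mpoly k[m]}) : tofracK (p + q) = tofracK p + tofracK q.
Proof. exact: (rmorphD (@FracField.tofrac {mpoly k[m]})). Qed.
Lemma tofracKB m (p q : {mpoly k[m]}) : tofracK (p - q) = tofracK p - tofracK q.
Proof. exact: (rmorphB (@FracField.tofrac {mpoly k[m]})). Qed.

Lemma tofracK_eq0 m (p : {mpoly k[m]}) : (tofracK p == 0) = (p == 0).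
Proof. exact: tofrac_eq0. Qed.

Lemma fracE m (x : Kf k m) :
  x = tofracK (\n_(@repr_of _ _ x)) / tofracK (\d_(@repr_of _ _ x)).
Proof.
apply: (@mulIf _ (tofracK (\d_(@repr_of _ _ x)))); first by rewrite tofracK_eq0 denom_ratioP.
by rewrite divfK ?tofracK_eq0 ?denom_ratioP //; exact: frac_numden.
Qed.

Lemma fracP m (x : Kf k m) : exists p q : {mpoly k[m]}, q != 0 /\ x = tofracK p / tofracK q.
Proof.
exists (\n_(@repr_of _ _ x)), (\d_(@repr_of _ _ x)); split; [exact: denom_ratioP|exact: fracE].
Qed.

Lemma mpoly_ext m (T : comNzRingType) (f g : {rmorphism {mpoly k[m]} -> T}) :
  (forall c, f c%:MP = g c%:MP) -> (forall i, f 'X_i = g 'X_i) -> f =1 g.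
Proof.
move=> HC HX; elim/mpolyind => [|c e p _ _ IH]; first by rewrite !rmorph0.
rewrite -mul_mpolyC !rmorphD !rmorphM IH HC; congr (_ * _ + _).
rewrite mpolyXE_id !rmorph_prod; apply: eq_bigr => i _.
by rewrite !rmorphXn HX.
Qed.

Lemma renPC m n (h : 'I_m -> 'I_n) (c : k) : renP h c%:MP = c%:MP.
Proof. exact: mmapC. Qed.
Lemma renPX m n (h : 'I_m -> 'I_n) i : renP h 'X_i = 'X_(h i) :> {mpoly k[n]}.
Proof. by rewrite /renP mmapX mmap1U. Qed.

Lemma renP_comp m n l (h : 'I_m -> 'I_n) (h' : 'I_n -> 'I_l) (p : {mpoly k[m]}) :
  renP h' (renP h p) = renP (h' \o h) p.
Proof.
apply: (@mpoly_ext m _ (@renP k n l h' \o @renP k m n h) (@renP k m l (h' \o h))) => [c|i] /=.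
  by rewrite !renPC.
by rewrite !renPX.
Qed.

Lemma renP_id m (p : {mpoly k[m]}) : renP id p = p.
Proof.
apply: (@mpoly_ext m _ (@renP k m m id) idfun) => [c|i] /=; first by rewrite renPC.
by rewrite renPX.
Qed.

Lemma renP_eq0 m n (h : 'I_m -> 'I_n) (p : {mpoly k[m]}) : injective h ->
  (renP h p == 0) = (p == 0).
Proof.
(* A left inverse of the renaming, sending the variables outside the image of [h] to 0. *)
move=> hi; pose e (j : 'I_n) : {mpoly k[m]} := if [pick i | h i == j] is Some i then 'X_i else 0.
pose f := mmap (@mpolyC m k) e.
have E : f \o @renP k m n h =1 idfun.
  apply: (@mpoly_ext m _ (f \o @renP k m n h) idfun) => [c|i] /=.
    by rewrite renPC /f mmapC.
  rewrite renPX /f mmapX mmap1U /e; case: pickP => [i' /eqP/hi -> //|/(_ i)].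
  by rewrite eqxx.
apply/eqP/eqP => [p0|->]; last by rewrite rmorph0.
by rewrite -[p]E /= p0 /f rmorph0.
Qed.

Lemma tofracK_inj m : injective (@tofracK k m).
Proof.
by move=> p q /eqP; rewrite -subr_eq0 -rmorphB tofracK_eq0 subr_eq0 => /eqP.
Qed.

Section Ren.
Variables (m n : nat) (h : 'I_m -> 'I_n).
Hypothesis hi : injective h.

(** Independence of the representative: cross-multiply, rename, and use that injective renaming
    kills no denominator. *)
Lemma renK_frac (p q : {mpoly k[m]}) : q != 0 ->
  renK h (tofracK p / tofracK q) = tofracK (renP h p) / tofracK (renP h q).
Proof.
move=> q0; set x := _ / _; rewrite /renK.
have := fracE x; move: (denom_ratioP (@repr_of _ _ x)).
move: (\n_ _) (\d_ _) => a b b0 E.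
have nz l (r : {mpoly k[l]}) : r != 0 -> tofracK r != 0 by rewrite tofracK_eq0.
have nr (r : {mpoly k[m]}) : r != 0 -> renP h r != 0 by rewrite renP_eq0.
have {E}: p * b = a * q.
  apply: tofracK_inj; rewrite !rmorphM; move/eqP: E.
  by rewrite /x eqr_div ?nz // => /eqP.
move/(congr1 (@renP k m n h)); rewrite !renPM => E.
apply/eqP; rewrite eqr_div; [|exact/nz/nr|exact/nz/nr].
by rewrite -2!tofracKM E mulrC.
Qed.

Lemma renK_tofrac (p : {mpoly k[m]}) : renK h (tofracK p) = tofracK (renP h p).
Proof.
by rewrite -[tofracK p]divr1 -[1](rmorph1 (@tofracK k m)) renK_frac ?oner_neq0 // !rmorph1 divr1.
Qed.

Lemma renK_cst c : renK h (@cstK k m c) = cstK n c.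
Proof. by rewrite renK_tofrac renPC. Qed.
Lemma renK_var i : renK h (varK k i) = varK k (h i).
Proof. by rewrite renK_tofrac renPX. Qed.

Lemma renK_is_zmod : zmod_morphism (@renK k m n h).
Proof.
move=> x y; have [p [q [q0 ->]]] := fracP x; have [r [s [s0 ->]]] := fracP y.
have nz l (t : {mpoly k[l]}) : t != 0 -> tofracK t != 0 by rewrite tofracK_eq0.
have nr (t : {mpoly k[m]}) : t != 0 -> renP h t != 0 by rewrite renP_eq0.
rewrite -mulNr addf_div ?nz // mulNr -!tofracKM -tofracKB !renK_frac ?mulf_neq0 //.
rewrite -[X in _ = _ + X]mulNr [RHS]addf_div ?nz ?nr //.
by rewrite mulNr -!tofracKM -tofracKB !renPM renPB !renPM.
Qed.

Lemma renK_is_monoid : monoid_morphism (@renK k m n h).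
Proof.
split; first by rewrite -(rmorph1 (@tofracK k m)) renK_tofrac !rmorph1.
move=> x y; have [p [q [q0 ->]]] := fracP x; have [r [s [s0 ->]]] := fracP y.
by rewrite mulf_div -!tofracKM !renK_frac ?mulf_neq0 // mulf_div -!tofracKM !renPM.
Qed.
End Ren.

(** The injectivity proof is made an argument so that the ring morphism structure can be
    attached. *)
Definition renM m n (h : 'I_m -> 'I_n) (hi : injective h) : Kf k m -> Kf k n := renK h.
HB.instance Definition _ m n (h : 'I_m -> 'I_n) (hi : injective h) :=
  GRing.isZmodMorphism.Build (Kf k m) (Kf k n) (renM hi) (renK_is_zmod hi).
HB.instance Definition _ m n (h : 'I_m -> 'I_n) (hi : injective h) :=
  GRing.isMonoidMorphism.Build (Kf k m) (Kf k n) (renM hi) (renK_is_monoid hi).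

Section RenMorphism.
Variables (m n : nat) (h : 'I_m -> 'I_n).
Hypothesis hi : injective h.
Implicit Types x y : Kf k m.
Lemma renKD x y : renK h (x + y) = renK h x + renK h y.
Proof. exact: (rmorphD (renM hi)). Qed.
Lemma renKB x y : renK h (x - y) = renK h x - renK h y.
Proof. exact: (rmorphB (renM hi)). Qed.
Lemma renKN x : renK h (- x) = - renK h x.
Proof. exact: (rmorphN (renM hi)). Qed.
Lemma renKM x y : renK h (x * y) = renK h x * renK h y.
Proof. exact: (rmorphM (renM hi)). Qed.
Lemma renKV x : renK h x^-1 = (renK h x)^-1.
Proof. exact: (fmorphV (renM hi)). Qed.
Lemma renK0 : renK h (0 : Kf k m) = 0.
Proof. exact: (rmorph0 (renM hi)). Qed.
End RenMorphism.

Lemma renK_comp m n l (h : 'I_m -> 'I_n) (h' : 'I_n -> 'I_l) (x : Kf k m) :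
  injective h -> injective h' -> renK h' (renK h x) = renK (h' \o h) x.
Proof.
move=> hi hi'; have [p [q [q0 ->]]] := fracP x.
rewrite !renK_frac ?renP_eq0 ?renP_comp //; exact: inj_comp.
Qed.

Lemma renK_id m (x : Kf k m) : renK id x = x.
Proof.
have [p [q [q0 ->]]] := fracP x; rewrite renK_frac //.
by rewrite !renP_id.
Qed.

(** Divisibility holds for the variables and passes to products by a twisted Leibniz rule. *)
Lemma renP_tperm_dvd m (i j : 'I_m) (p : {mpoly k[m]}) :
  exists q, p - renP (tperm i j) p = q * ('X_i - 'X_j).
Proof.
pose D (p : {mpoly k[m]}) := exists q, p - renP (tperm i j) p = q * ('X_i - 'X_j).
have DX a : D 'X_a.
  rewrite /D renPX; case: tpermP => [->|->|_ _]; first by exists 1; rewrite mul1r.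
    by exists (-1); rewrite mulN1r opprB.
  by exists 0; rewrite subrr mul0r.
have DM a b : D a -> D b -> D (a * b).
  move=> [u Eu] [v Ev]; exists (u * b + renP (tperm i j) a * v).
  rewrite mulrDl [u * b * _]mulrAC -Eu -mulrA -Ev renPM; ring.
have D1 : D 1 by exists 0; rewrite rmorph1 subrr mul0r.
have DXn a e : D ('X_a ^+ e) by elim: e => [|e IH]; [rewrite expr0|rewrite exprS; apply: DM].
have De e : D 'X_[e] by rewrite mpolyXE_id; elim/big_rec: _ => // a b _; apply: DM.
move: p; elim/mpolyind => [|c e p _ _ [q Eq]]; first by exists 0; rewrite rmorph0 subrr mul0r.
have [q' Eq'] := De e.
exists (c%:MP * q' + q); rewrite mulrDl -mulrA -Eq -Eq' -mul_mpolyC.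
by rewrite renPD renPM renPC mulrBr opprD addrACA.
Qed.
End Fractions.

(** * The rings F^{(x)m} (x) k(x_1, ..., x_m) *)

Section TensorRing.
Variables (k : fieldType) (F : falgType k).
Implicit Types m n : nat.
Local Notation NF := (NF F).
Local Notation ix m := {ffun 'I_m -> 'I_NF}.

HB.instance Definition _ m := GRing.Zmodule.copy (Rt F m) {ffun ix m -> Kf k m}.

Definition pure m (f : 'I_m -> F) : Rt F m :=
  [ffun c : ix m => @cstK k m (\prod_(i < m) coord (basF F) (c i) (f i))].
Definition ebas m (a : ix m) : Rt F m := pure (fun i => tnth (basF F) (a i)).

Lemma ebasE m (a c : ix m) : ebas a c = (c == a)%:R.
Proof.
have coordE (p q : 'I_NF) : coord (basF F) p (tnth (basF F) q) = (q == p)%:R.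
  rewrite (tnth_nth 0) coord_free //; exact: basis_free (vbasisP _).
rewrite ffunE; have [->|N] := eqVneq c a.
  by rewrite big1 ?rmorph1 // => i _; rewrite coordE eqxx.
have [i Ni] : exists i, c i != a i.
  apply/existsP; rewrite -negb_forall; apply: contraNN N => /forallP E.
  by apply/eqP/ffunP => i; apply/eqP.
by rewrite (bigD1 i) //= coordE eq_sym (negPf Ni) mul0r rmorph0.
Qed.

Lemma sclRDl m c c' (f : Rt F m) : sclR (c + c') f = sclR c f + sclR c' f.
Proof. by apply/ffunP => a; rewrite !ffunE mulrDl. Qed.
Lemma sclRNl m c (f : Rt F m) : sclR (- c) f = - sclR c f.
Proof. by apply/ffunP => a; rewrite !ffunE mulNr. Qed.
Lemma sclRA m c c' (f : Rt F m) : sclR c (sclR c' f) = sclR (c * c') f.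
Proof. by apply/ffunP => a; rewrite !ffunE mulrA. Qed.
Lemma scl1R m (f : Rt F m) : sclR 1 f = f.
Proof. by apply/ffunP => a; rewrite !ffunE mul1r. Qed.
Lemma scl0R m (f : Rt F m) : sclR 0 f = 0.
Proof. by apply/ffunP => a; rewrite !ffunE mul0r. Qed.
Lemma sclR0 m c : sclR c (0 : Rt F m) = 0.
Proof. by apply/ffunP => a; rewrite !ffunE mulr0. Qed.

Lemma Rt_sumE m (f : Rt F m) : f = \sum_a sclR (f a) (ebas a).
Proof.
apply/ffunP => c; rewrite sum_ffunE (bigD1 c) //= ffunE ebasE eqxx mulr1.
by rewrite big1 ?addr0 // => a N; rewrite ffunE ebasE eq_sym (negPf N) mulr0.
Qed.

(** Reduces multilinear identities to pure tensors, where they can be checked slot by slot. *)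
Lemma Rt_ind m (Q : Rt F m -> Prop) : Q 0 -> (forall f g, Q f -> Q g -> Q (f + g)) ->
  (forall c f, Q (pure f) -> Q (sclR c (pure f))) -> (forall f, Q (pure f)) -> forall r, Q r.
Proof.
move=> Q0 QD QZ QP r; rewrite [r]Rt_sumE; elim/big_rec: _ => // a f _ Qf.
by apply: QD => //; apply: QZ.
Qed.

Lemma mulRDl m (f g h : Rt F m) : mulR (f + g) h = mulR f h + mulR g h.
Proof.
apply/ffunP => c; rewrite !ffunE -big_split; apply: eq_bigr => a _ /=.
by rewrite -big_split; apply: eq_bigr => b _ /=; rewrite ffunE !mulrDl.
Qed.
Lemma mulRDr m (f g h : Rt F m) : mulR f (g + h) = mulR f g + mulR f h.
Proof.
apply/ffunP => c; rewrite !ffunE -big_split; apply: eq_bigr => a _ /=.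
by rewrite -big_split; apply: eq_bigr => b _ /=; rewrite ffunE mulrDr !mulrDl.
Qed.
Lemma mulRZl m c (f g : Rt F m) : mulR (sclR c f) g = sclR c (mulR f g).
Proof.
apply/ffunP => a; rewrite !ffunE mulr_sumr; apply: eq_bigr => b _.
by rewrite mulr_sumr; apply: eq_bigr => b' _; rewrite ffunE !mulrA.
Qed.
Lemma mulRZr m c (f g : Rt F m) : mulR f (sclR c g) = sclR c (mulR f g).
Proof.
apply/ffunP => a; rewrite !ffunE mulr_sumr; apply: eq_bigr => b _.
rewrite mulr_sumr; apply: eq_bigr => b' _; rewrite ffunE; ring.
Qed.
Lemma mul0R m (f : Rt F m) : mulR 0 f = 0.
Proof. by rewrite -[X in mulR X](scl0R f) mulRZl scl0R. Qed.
Lemma mulR0 m (f : Rt F m) : mulR f 0 = 0.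
Proof. by rewrite -[X in mulR _ X](scl0R f) mulRZr scl0R. Qed.

Lemma eq_pure m (f g : 'I_m -> F) : f =1 g -> pure f = pure g.
Proof.
by move=> E; apply/ffunP => c; rewrite !ffunE; congr cstK; apply: eq_bigr => i _; rewrite E.
Qed.

(** Expanding each slot in the basis and distributing the product over the slots gives the structure
    constants of [mulR]. *)
Lemma mulR_pure m (f g : 'I_m -> F) : mulR (pure f) (pure g) = pure (fun i => f i * g i).
Proof.
apply/ffunP => c; rewrite !ffunE.
have E (x y : F) p : coord (basF F) p (x * y) =
    \sum_u \sum_v coord (basF F) u x * coord (basF F) v y * gam u v p.
  rewrite {1}(coord_vbasis (memvf x)) {1}(coord_vbasis (memvf y)) mulr_suml linear_sum.
  apply: eq_bigr => u _; rewrite mulr_sumr linear_sum; apply: eq_bigr => v _.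
  by rewrite -scalerAl -scalerAr scalerA linearZ /= /gam !(tnth_nth 0).
transitivity (@cstK k m (\prod_i \sum_u \sum_v
    coord (basF F) u (f i) * coord (basF F) v (g i) * gam u v (c i))); last first.
  by congr cstK; apply: eq_bigr => i _; rewrite E.
rewrite bigA_distr_bigA rmorph_sum; apply: eq_bigr => a _.
rewrite bigA_distr_bigA rmorph_sum; apply: eq_bigr => b _.
by rewrite !ffunE !big_split !rmorphM.
Qed.

Lemma oneR_pure m : oneR F m = pure (fun=> 1).
Proof. by apply/ffunP => c; rewrite !ffunE. Qed.

Lemma mulRA m : associative (@mulR k F m).
Proof.
move=> x y z; elim/Rt_ind: x => [|f g Ef Eg|c f E|f].
- by rewrite !mul0R.
- by rewrite !mulRDl Ef Eg.
- by rewrite !mulRZl E.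
elim/Rt_ind: y => [|f' g Ef Eg|c f' E|f'].
- by rewrite mul0R mulR0 mul0R.
- by rewrite mulRDl !mulRDr mulRDl Ef Eg.
- by rewrite mulRZl !mulRZr mulRZl E.
elim/Rt_ind: z => [|f'' g Ef Eg|c f'' E|f''].
- by rewrite !mulR0.
- by rewrite !mulRDr Ef Eg.
- by rewrite !mulRZr E.
by rewrite !mulR_pure; apply: eq_pure => i; rewrite mulrA.
Qed.
Lemma mul1R m : left_id (oneR F m) (@mulR k F m).
Proof.
move=> x; elim/Rt_ind: x => [|f g Ef Eg|c f E|f].
- by rewrite mulR0.
- by rewrite mulRDr Ef Eg.
- by rewrite mulRZr E.
by rewrite oneR_pure mulR_pure; apply: eq_pure => i; rewrite mul1r.
Qed.
Lemma mulR1 m : right_id (oneR F m) (@mulR k F m).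
Proof.
move=> x; elim/Rt_ind: x => [|f g Ef Eg|c f E|f].
- by rewrite mul0R.
- by rewrite mulRDl Ef Eg.
- by rewrite mulRZl E.
by rewrite oneR_pure mulR_pure; apply: eq_pure => i; rewrite mulr1.
Qed.

HB.instance Definition _ m := GRing.Zmodule_isPzRing.Build (Rt F m)
  (@mulRA m) (@mul1R m) (@mulR1 m) (@mulRDl m) (@mulRDr m).

Section Emb.
Variables (m n : nat) (h : 'I_m -> 'I_n).
Hypothesis hi : injective h.

Lemma embD (f g : Rt F m) : emb h (f + g) = emb h f + emb h g.
Proof. by apply/ffunP => a; rewrite !ffunE renKD // mulrDl. Qed.
Lemma embZ c (f : Rt F m) : emb h (sclR c f) = sclR (renK h c) (emb h f).
Proof. by apply/ffunP => a; rewrite !ffunE renKM // mulrA. Qed.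
Lemma emb0 : emb h (0 : Rt F m) = 0.
Proof. by apply/ffunP => a; rewrite !ffunE renK0 // mul0r. Qed.
Lemma embN (f : Rt F m) : emb h (- f) = - emb h f.
Proof. by apply/ffunP => a; rewrite !ffunE renKN // mulNr. Qed.
Lemma embB (f g : Rt F m) : emb h (f - g) = emb h f - emb h g.
Proof. by rewrite embD embN. Qed.

Definition extf (f : 'I_m -> F) (j : 'I_n) : F := if [pick i | h i == j] is Some i then f i else 1.
Lemma extf_in f i : extf f (h i) = f i.
Proof. by rewrite /extf; case: pickP => [i' /eqP/hi -> //|/(_ i)]; rewrite eqxx. Qed.
Lemma extf_out f j : ~~ [exists i, h i == j] -> extf f j = 1.
Proof.
rewrite /extf; case: pickP => // i E /existsP []; by exists i.
Qed.

Lemma emb_pure f : emb h (pure f) = pure (extf f).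
Proof.
apply/ffunP => a; rewrite !ffunE renK_cst // -rmorphM; congr cstK.
rewrite [RHS](bigID (fun j => [exists i, h i == j])) /=; congr (_ * _); last first.
  by apply: eq_bigr => j N; rewrite extf_out.
rewrite (eq_bigl (mem (h @: setT))) => [|j]; last first.
  by apply/existsP/imsetP => [[i /eqP <-]|[i _ ->]]; [exists i|exists i; rewrite eqxx].
rewrite big_imset /= => [|x y _ _]; last exact: hi.
by apply: eq_big => [i|i _]; rewrite ?inE // ffunE extf_in.
Qed.

Lemma embM (f g : Rt F m) : emb h (f * g) = emb h f * emb h g.
Proof.
elim/Rt_ind: f => [|f f' Ef Eg|c f E|f].
- by rewrite mul0r emb0 mul0r.
- by rewrite mulrDl !embD mulrDl Ef Eg.
- by rewrite [_ * _]mulRZl !embZ E [RHS]mulRZl.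
elim/Rt_ind: g => [|g g' Ef Eg|c g E|g].
- by rewrite mulr0 emb0 mulr0.
- by rewrite mulrDr !embD mulrDr Ef Eg.
- by rewrite [_ * _]mulRZr !embZ E [RHS]mulRZr.
rewrite [_ * _]mulR_pure !emb_pure [RHS]mulR_pure; apply: eq_pure => j; rewrite /extf.
by case: pickP => //; rewrite mulr1.
Qed.
Lemma emb1 : emb h (1 : Rt F m) = 1.
Proof.
rewrite [1]oneR_pure emb_pure [RHS]oneR_pure; apply: eq_pure => j; rewrite /extf.
by case: pickP.
Qed.
End Emb.

Lemma emb_comp m n l (h : 'I_m -> 'I_n) (h' : 'I_n -> 'I_l) (f : Rt F m) :
  injective h -> injective h' -> emb h' (emb h f) = emb (h' \o h) f.
Proof.
move=> hi hi'; have hh := inj_comp hi' hi.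
elim/Rt_ind: f => [|f f' Ef Eg|c f E|f].
- by rewrite !emb0.
- by rewrite !embD // Ef Eg.
- by rewrite !embZ // E renK_comp.
rewrite !emb_pure //; apply: eq_pure => j.
have [|N] := boolP [exists i, h' i == j]; last first.
  rewrite !extf_out //; apply: contra N => /existsP [i /eqP <-]; apply/existsP; by exists (h i).
move=> /existsP [i /eqP <-]; rewrite extf_in //.
have [|N] := boolP [exists a, h a == i]; last first.
  rewrite !extf_out //; apply: contra N => /existsP [a /eqP /hi' <-]; apply/existsP; by exists a.
by move=> /existsP [a /eqP <-]; rewrite extf_in // (extf_in hh).
Qed.

Lemma emb_id m (f : Rt F m) : emb id f = f.
Proof.
have hi : injective (@id 'I_m) by [].
elim/Rt_ind: f => [|f f' Ef Eg|c f E|f].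
- by rewrite emb0.
- by rewrite embD // Ef Eg.
- by rewrite embZ // E renK_id.
by rewrite emb_pure //; apply: eq_pure => i; exact: (extf_in hi).
Qed.

Lemma eq_emb m n (h h' : 'I_m -> 'I_n) (f : Rt F m) : h =1 h' -> emb h f = emb h' f.
Proof. by move=> E; have -> : h = h' by apply: functional_extensionality. Qed.

End TensorRing.

(** * The centre and the permutation action *)

Section Center.
Variables (k : fieldType) (F : falgType k).
Implicit Types m n : nat.

(** Commuting with the finitely many basis tensors is a decidable test, which allows the centre to
    be a subtype and a commutative ring. *)
Definition zpred m : {pred Rt F m} := fun z => [forall a, z * ebas a == ebas a * z].

Lemma sclR_mull m c (f g : Rt F m) : sclR c f * g = sclR c (f * g).
Proof. exact: mulRZl. Qed.
Lemma sclR_mulr m c (f g : Rt F m) : f * sclR c g = sclR c (f * g).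
Proof. exact: mulRZr. Qed.
Lemma pureM m (f g : 'I_m -> F) : pure f * pure g = pure (fun i => f i * g i).
Proof. exact: mulR_pure. Qed.

Lemma zpredP m (z : Rt F m) : reflect (forall r, z * r = r * z) (z \in @zpred m).
Proof.
apply: (iffP forallP) => [H r|H a]; last by rewrite H.
rewrite [r]Rt_sumE mulr_suml mulr_sumr; apply: eq_bigr => a _.
by rewrite sclR_mulr sclR_mull (eqP (H a)).
Qed.

Lemma zpred_subring m : subring_closed (@zpred m).
Proof.
split=> [|x y /zpredP Hx /zpredP Hy|x y /zpredP Hx /zpredP Hy]; apply/zpredP => r.
- by rewrite mul1r mulr1.
- by rewrite mulrBl mulrBr Hx Hy.
- by rewrite -mulrA Hy mulrA Hx mulrA.
Qed.
Definition Zc m := {z : Rt F m | z \in @zpred m}.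
HB.instance Definition _ m := SubType.on (Zc m).
HB.instance Definition _ m := Choice.on (Zc m).
HB.instance Definition _ m := GRing.SubChoice_isSubPzRing.Build _ _ (Zc m) (@zpred_subring m).
Lemma Zc_mulC m : commutative (@GRing.mul (Zc m)).
Proof. by move=> x y; apply: val_inj; have /zpredP := valP x; apply. Qed.
HB.instance Definition _ m := GRing.PzRing_hasCommutativeMul.Build (Zc m) (@Zc_mulC m).

Definition zv m (z : Zc m) : Rt F m := val z.
Lemma zv_is_zmod m : zmod_morphism (@zv m). Proof. exact: rmorphB. Qed.
Lemma zv_is_monoid m : monoid_morphism (@zv m).
Proof. by split=> [|x y]; [exact: rmorph1|exact: rmorphM]. Qed.
HB.instance Definition _ m := GRing.isZmodMorphism.Build (Zc m) (Rt F m) (@zv m) (@zv_is_zmod m).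
HB.instance Definition _ m := GRing.isMonoidMorphism.Build (Zc m) (Rt F m) (@zv m) (@zv_is_monoid m).
Lemma zvB m (x y : Zc m) : zv (x - y) = zv x - zv y. Proof. exact: (rmorphB (@zv m)). Qed.
Lemma zvD m (x y : Zc m) : zv (x + y) = zv x + zv y. Proof. exact: (rmorphD (@zv m)). Qed.
Lemma zvM m (x y : Zc m) : zv (x * y) = zv x * zv y. Proof. exact: (rmorphM (@zv m)). Qed.
Lemma zv1 m : zv (1 : Zc m) = 1. Proof. exact: (rmorph1 (@zv m)). Qed.
Lemma zv_prod m (I : finType) (Q : pred I) (f : I -> Zc m) :
  zv (\prod_(i | Q i) f i) = \prod_(i | Q i) zv (f i).
Proof. exact: (rmorph_prod (@zv m)). Qed.
Lemma zv_inj m : injective (@zv m). Proof. exact: val_inj. Qed.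

(** The default value 0 is taken outside the centre; the lock keeps it from unfolding. *)
Definition toZ m : Rt F m -> Zc m := locked (insubd (0 : Zc m)).
Lemma toZK m (z : Rt F m) : (forall r, z * r = r * z) -> zv (toZ z) = z.
Proof. by move=> H; rewrite /zv /toZ -lock insubdK //; apply/zpredP. Qed.
Lemma zv_comm m (z : Zc m) r : zv z * r = r * zv z.
Proof. by have /zpredP := valP z. Qed.

Lemma sclR_comm m c (r : Rt F m) : sclR c 1 * r = r * sclR c 1.
Proof. by rewrite sclR_mull sclR_mulr mul1r mulr1. Qed.
Lemma sclR1_mul m c (r : Rt F m) : sclR c 1 * r = sclR c r.
Proof. by rewrite sclR_mull mul1r. Qed.

Definition sclZ m (c : Kf k m) : Zc m := toZ (sclR c 1).
Lemma zv_sclZ m (c : Kf k m) : zv (sclZ c) = sclR c 1.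
Proof. by rewrite toZK //; exact: sclR_comm. Qed.
Lemma sclZ_is_zmod m : zmod_morphism (@sclZ m).
Proof. by move=> x y; apply: zv_inj; rewrite [RHS]zvB !zv_sclZ sclRDl sclRNl. Qed.
Lemma sclZ_is_monoid m : monoid_morphism (@sclZ m).
Proof.
split=> [|x y]; apply: zv_inj; first by rewrite zv_sclZ scl1R zv1.
by rewrite [RHS]zvM !zv_sclZ sclR1_mul sclRA.
Qed.
HB.instance Definition _ m := GRing.isZmodMorphism.Build (Kf k m) (Zc m) (@sclZ m) (@sclZ_is_zmod m).
HB.instance Definition _ m := GRing.isMonoidMorphism.Build (Kf k m) (Zc m) (@sclZ m) (@sclZ_is_monoid m).

Lemma sclZB m (x y : Kf k m) : sclZ (x - y) = sclZ x - sclZ y. Proof. exact: (rmorphB (@sclZ m)). Qed.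
Lemma sclZN m (x : Kf k m) : sclZ (- x) = - sclZ x. Proof. exact: (rmorphN (@sclZ m)). Qed.
Lemma sclZM m (x y : Kf k m) : sclZ (x * y) = sclZ x * sclZ y. Proof. exact: (rmorphM (@sclZ m)). Qed.
Lemma sclZ1 m : sclZ (1 : Kf k m) = 1. Proof. exact: (rmorph1 (@sclZ m)). Qed.

Definition kZ m (c : k) : Zc m := sclZ (@cstK k m c).
HB.instance Definition _ m := GRing.RMorphism.copy (@kZ m) (@sclZ m \o @cstK k m).
Lemma zv_kZ m c : zv (kZ m c) = sclR (@cstK k m c) 1.
Proof. exact: zv_sclZ. Qed.

Section Act.
Variable d : nat.
Implicit Types g h : 'S_d.
Local Notation act := (@Defs.act k F d).

Lemma pact_is_zmod g : zmod_morphism (@Defs.act k F d g).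
Proof. by move=> x y; exact: embB (@perm_inj _ g) _ _. Qed.
Lemma pact_is_monoid g : monoid_morphism (@Defs.act k F d g).
Proof. by split=> [|x y]; [exact: emb1 (@perm_inj _ g)|exact: embM (@perm_inj _ g) _ _]. Qed.
HB.instance Definition _ g := GRing.isZmodMorphism.Build (Rt F d) (Rt F d) (@Defs.act k F d g) (@pact_is_zmod g).
HB.instance Definition _ g := GRing.isMonoidMorphism.Build (Rt F d) (Rt F d) (@Defs.act k F d g) (@pact_is_monoid g).
Lemma pactB g (x y : Rt F d) : act g (x - y) = act g x - act g y.
Proof. exact: pact_is_zmod. Qed.
Lemma pact_sum g (I : finType) (f : I -> Rt F d) : act g (\sum_i f i) = \sum_i act g (f i).
Proof. exact: (raddf_sum (@Defs.act k F d g)). Qed.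
Lemma pactMr g (x y : Rt F d) : act g (x * y) = act g x * act g y.
Proof. exact: (pact_is_monoid g).2. Qed.
Lemma pact_1 g : act g (1 : Rt F d) = 1.
Proof. exact: (pact_is_monoid g).1. Qed.
Lemma pact1 (r : Rt F d) : act 1 r = r.
Proof. by rewrite -{2}[r]emb_id; apply: eq_emb => i; rewrite perm1. Qed.
Lemma pactM g h (r : Rt F d) : act (g * h) r = act h (act g r).
Proof.
rewrite /Defs.act emb_comp; [|exact: perm_inj..].
by apply: eq_emb => i; rewrite permM.
Qed.
Lemma pactZ g c (r : Rt F d) : act g (sclR c r) = sclR (renK g c) (act g r).
Proof. exact: embZ (@perm_inj _ g) _ _. Qed.

Definition actz g (z : Zc d) : Zc d := toZ (act g (zv z)).
Lemma zv_actz g z : zv (actz g z) = act g (zv z).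
Proof.
apply: toZK => r; have -> : r = act g (act g^-1%g r) by rewrite -pactM mulVg pact1.
by rewrite -!pactMr zv_comm.
Qed.
Lemma actz_is_zmod g : zmod_morphism (actz g).
Proof. by move=> x y; apply: zv_inj; rewrite [RHS]zvB !zv_actz zvB pactB. Qed.
Lemma actz_is_monoid g : monoid_morphism (actz g).
Proof.
split=> [|x y]; apply: zv_inj; first by rewrite zv_actz !zv1 pact_1.
by rewrite [RHS]zvM !zv_actz zvM pactMr.
Qed.
HB.instance Definition _ g := GRing.isZmodMorphism.Build (Zc d) (Zc d) (actz g) (actz_is_zmod g).
HB.instance Definition _ g := GRing.isMonoidMorphism.Build (Zc d) (Zc d) (actz g) (actz_is_monoid g).

Lemma actz_mul g x y : actz g (x * y) = actz g x * actz g y. Proof. exact: (actz_is_monoid g).2. Qed.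
Lemma actzB g x y : actz g (x - y) = actz g x - actz g y. Proof. exact: (rmorphB (actz g)). Qed.
Lemma actz_prod g (I : finType) (Q : pred I) (f : I -> Zc d) :
  actz g (\prod_(i | Q i) f i) = \prod_(i | Q i) actz g (f i).
Proof. exact: (rmorph_prod (actz g)). Qed.
Lemma actz1 z : actz 1 z = z.
Proof. by apply: zv_inj; rewrite zv_actz pact1. Qed.
Lemma actzM g h z : actz (g * h) z = actz h (actz g z).
Proof. by apply: zv_inj; rewrite !zv_actz pactM. Qed.
Lemma actz_sclZ g c : actz g (sclZ c) = sclZ (renK g c).
Proof. by apply: zv_inj; rewrite zv_actz !zv_sclZ pactZ pact_1. Qed.
Lemma actz_kZ g c : actz g (kZ d c) = kZ d c.
Proof. rewrite actz_sclZ renK_cst //; exact: perm_inj. Qed.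
End Act.

Section Constants.
Variables m n : nat.
Variable h : 'I_m -> 'I_n.
Hypothesis hi : injective h.

Lemma isF_pure (f : 'I_m -> F) : isF (pure f).
Proof. by move=> a; rewrite ffunE; eexists. Qed.

Lemma isF_ind (Q : Rt F m -> Prop) : Q 0 -> (forall f g, Q f -> Q g -> Q (f + g)) ->
  (forall c f, Q (pure f) -> Q (sclR (@cstK k m c) (pure f))) -> (forall f, Q (pure f)) ->
  forall r, isF r -> Q r.
Proof.
move=> Q0 QD QZ QP r Fr; rewrite [r]Rt_sumE; elim/big_rec: _ => // a f _ Qf.
by apply: QD => //; have [c ->] := Fr a; apply: QZ.
Qed.

Definition outf (f : 'I_n -> F) (j : 'I_n) : F := if [exists i, h i == j] then 1 else f j.
Lemma pure_split (f : 'I_n -> F) : pure f = emb h (pure (f \o h)) * pure (outf f).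
Proof.
rewrite emb_pure // pureM; apply: eq_pure => j; rewrite /outf.
case: ifPn => [/existsP [i /eqP <-]|N]; first by rewrite extf_in // mulr1.
by rewrite extf_out // mul1r.
Qed.
Lemma emb_out (r : Rt F m) (f : 'I_n -> F) : emb h r * pure (outf f) = pure (outf f) * emb h r.
Proof.
elim/Rt_ind: r => [|u v Eu Ev|c u E|u].
- by rewrite emb0 // mul0r mulr0.
- by rewrite embD // mulrDl mulrDr Eu Ev.
- by rewrite embZ // sclR_mull sclR_mulr E.
rewrite emb_pure // !pureM; apply: eq_pure => j; rewrite /outf.
by case: ifPn => [_|N]; rewrite ?mul1r ?mulr1 // extf_out // mul1r mulr1.
Qed.

(** A pure tensor splits into its part in the slots of [h] and a part elsewhere; the latter commutes
    with everything embedded by [h]. *)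
Lemma emb_central (C : Rt F m) : (forall f, pure f * C = C * pure f) ->
  forall r, emb h C * r = r * emb h C.
Proof.
move=> HC r; elim/Rt_ind: r => [|u v Eu Ev|c u E|u].
- by rewrite mul0r mulr0.
- by rewrite mulrDl mulrDr Eu Ev.
- by rewrite sclR_mull sclR_mulr E.
rewrite pure_split mulrA -embM // -HC embM // -mulrA emb_out mulrA; by [].
Qed.

Lemma emb_isF (r : Rt F m) : isF r -> isF (emb h r).
Proof.
by move=> Fr a; have [c E] := Fr [ffun i => a (h i)]; rewrite ffunE E renK_cst // -rmorphM; eexists.
Qed.
End Constants.

Lemma isFD m (f g : Rt F m) : isF f -> isF g -> isF (f + g).
Proof. by move=> Ff Fg a; have [c E] := Ff a; have [c' E'] := Fg a; rewrite ffunE E E' -rmorphD; eexists. Qed.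
Lemma isFN m (f : Rt F m) : isF f -> isF (- f).
Proof. by move=> Ff a; have [c E] := Ff a; rewrite ffunE E -rmorphN; eexists. Qed.
Lemma isF_scl m c : isF (sclR (@cstK k m c) (1 : Rt F m)).
Proof. by move=> a; rewrite !ffunE -rmorphM; eexists. Qed.
End Center.

(** * Integrality, and inversion of P *)

Section Integral.
Variables (k : fieldType) (F : falgType k) (laurent : bool).
Implicit Types m n d : nat.
Local Notation isBcoef := (@isBcoef k laurent _).
Local Notation isB := (@isB k F laurent _).

Definition monX m : {mpoly k[m]} := \prod_(i < m) 'X_i.
Lemma monX_neq0 m N : tofracK (monX m ^+ N) != 0.
Proof.
rewrite tofracK_eq0 expf_neq0 // /monX prodf_seq_neq0; apply/allP => i _.
apply/eqP => /(congr1 (mcoeff U_(i))); rewrite mcoeffXU eqxx mcoeff0 => /eqP.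
by rewrite oner_eq0.
Qed.
Lemma isBcoefP m c : isBcoef c <->
  exists (p : {mpoly k[m]}) N, (laurent \/ N = 0%N) /\ c * tofracK (monX m ^+ N) = tofracK p.
Proof.
split=> [[p [N [H ->]]]|[p [N [H E]]]]; exists p, N; split=> //.
  exact: divfK (monX_neq0 m N) _.
rewrite -E; exact: esym (mulfK (monX_neq0 m N) _).
Qed.

Lemma isBcoefD m (c c' : Kf k m) : isBcoef c -> isBcoef c' -> isBcoef (c + c').
Proof.
move=> /isBcoefP [p [N [H E]]] /isBcoefP [p' [N' [H' E']]].
apply/isBcoefP; exists (p * monX m ^+ N' + p' * monX m ^+ N), (N + N')%N; split.
  by case: H => [->|->]; [left|case: H' => [->|->]; [left|right]].
rewrite exprD tofracKM tofracKD !tofracKM mulrDl -E -E'; ring.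
Qed.
Lemma isBcoefM m (c c' : Kf k m) : isBcoef c -> isBcoef c' -> isBcoef (c * c').
Proof.
move=> /isBcoefP [p [N [H E]]] /isBcoefP [p' [N' [H' E']]].
apply/isBcoefP; exists (p * p'), (N + N')%N; split.
  by case: H => [->|->]; [left|case: H' => [->|->]; [left|right]].
rewrite exprD !tofracKM -E -E'; ring.
Qed.
Lemma isBcoef_tofrac m (p : {mpoly k[m]}) : isBcoef (tofracK p).
Proof. by apply/isBcoefP; exists p, 0%N; split; [right|rewrite expr0 rmorph1 mulr1]. Qed.
Lemma isBcoef_cst m c : isBcoef (@cstK k m c).
Proof. exact: isBcoef_tofrac. Qed.
Lemma isBcoef0 m : isBcoef (0 : Kf k m).
Proof. by have := isBcoef_cst m 0; rewrite rmorph0. Qed.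

Lemma renP_monX d (g : 'S_d) : renP g (monX d) = monX d.
Proof.
rewrite /monX rmorph_prod [RHS](reindex_inj (@perm_inj _ g)).
by apply: eq_bigr => i _; exact: renPX.
Qed.
Lemma renP_monXn d (g : 'S_d) N : renP g (monX d ^+ N) = monX d ^+ N.
Proof. by elim: N => [|N IH]; [rewrite expr0 rmorph1|rewrite exprS renPM IH renP_monX]. Qed.

Lemma isBcoef_renK d (g : 'S_d) (c : Kf k d) : isBcoef c -> isBcoef (renK g c).
Proof.
have gi := @perm_inj _ g.
move=> /isBcoefP [p [N [H E]]]; apply/isBcoefP; exists (renP g p), N; split=> //.
by rewrite -renK_tofrac // -E renKM // renK_tofrac // renP_monXn.
Qed.

Lemma isB0 m : isB (0 : Rt F m). Proof. by move=> a; rewrite ffunE; exact: isBcoef0. Qed.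
Lemma isB_D m (f g : Rt F m) : isB f -> isB g -> isB (f + g).
Proof. by move=> Hf Hg a; rewrite ffunE; apply: isBcoefD. Qed.
Lemma isB_Z m c (f : Rt F m) : isBcoef c -> isB f -> isB (sclR c f).
Proof. by move=> Hc Hf a; rewrite ffunE; apply: isBcoefM. Qed.
Lemma isB_sum m (I : Type) (s : seq I) (f : I -> Rt F m) : (forall i, isB (f i)) -> isB (\sum_(i <- s) f i).
Proof. by move=> H; elim/big_ind: _ => // [|x y]; [exact: isB0|exact: isB_D]. Qed.
Lemma isB_isF m (f : Rt F m) : isF f -> isB f.
Proof. by move=> H a; have [c ->] := H a; exact: isBcoef_cst. Qed.
Lemma isB_M m (f g : Rt F m) : isB f -> isB g -> isB (f * g).
Proof.
move=> Hf Hg c; rewrite ffunE.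
elim/big_ind: _ => [||a _]; [exact: isBcoef0|exact: isBcoefD|].
elim/big_ind: _ => [||b _]; [exact: isBcoef0|exact: isBcoefD|].
apply: isBcoefM; [exact: isBcoefM|exact: isBcoef_cst].
Qed.
Lemma isB_act d (g : 'S_d) (f : Rt F d) : isB f -> isB (Defs.act g f).
Proof.
by move=> Hf a; rewrite ffunE; apply: isBcoefM; [exact: isBcoef_renK|exact: isBcoef_cst].
Qed.

(** The monomial denominator is symmetric, so only the numerator is moved and [renP_tperm_dvd]
    applies. *)
Lemma isBcoef_tperm d (i j : 'I_d) (c : Kf k d) : i != j -> isBcoef c ->
  isBcoef ((c - renK (tperm i j) c) / (varK k i - varK k j)).
Proof.
move=> ij; have ti := @perm_inj _ (tperm i j).
move=> /isBcoefP [p [N [H E]]]; have [q Eq] := renP_tperm_dvd i j p.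
have nz : varK k i - varK k j != 0.
  rewrite -tofracKB tofracK_eq0 subr_eq0; apply: contra ij => /eqP /(congr1 (mcoeff U_(i))).
  by rewrite !mcoeffXU eqxx eq_sym; case: eqP => // _ /eqP; rewrite oner_eq0.
apply/isBcoefP; exists q, N; split=> //.
apply: (mulIf nz); rewrite [in RHS]/varK -[X in _ = _ * X]tofracKB -tofracKM -Eq.
rewrite [in RHS]tofracKB -renK_tofrac // -E renKM // renK_tofrac // renP_monXn -mulrBl.
by rewrite mulrAC divfK.
Qed.

(* A non zero divisor is invertible over the field of fractions: clearing denominators turns a
   kernel vector of the multiplication matrix into an element of [B (x) B]. *)
Lemma nzd_inv (P : Rt F 2) : C3 laurent P -> exists Q : Rt F 2, Q * P = 1.
Proof.
move=> HP; pose A := {ffun 'I_2 -> 'I_(NF F)}; pose e (i : 'I_#|{: A}|) : Rt F 2 := ebas (enum_val i).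
pose M : 'M[Kf k 2]_#|{: A}| := \matrix_(i, j) (e i * P) (enum_val j).
pose v2f (v : 'rV[Kf k 2]_#|{: A}|) : Rt F 2 := [ffun a => v 0 (enum_rank a)].
have ME (v : 'rV[Kf k 2]_#|{: A}|) : v2f (v *m M) = v2f v * P.
  rewrite [v2f v]Rt_sumE mulr_suml; apply/ffunP => a; rewrite ffunE mxE sum_ffunE.
  rewrite (reindex (@enum_rank A)) /=; last first.
    by exists enum_val => x _; rewrite ?enum_rankK ?enum_valK.
  apply: eq_bigr => b _; rewrite sclR_mull !ffunE mxE /e !enum_rankK.
  by rewrite [(_ * _ : Rt F 2) _]ffunE.
have inj (v : 'rV[Kf k 2]_#|{: A}|) : v *m M = 0 -> v = 0.
  move=> vM.
  have den (x : Kf k 2) : exists q, q != 0 /\ exists p, tofracK q * x = tofracK p.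
    have [p [q [q0 ->]]] := fracP x; exists q; split=> //; exists p.
    by rewrite mulrC divfK // tofracK_eq0.
  have [q [q0 Hq]] : exists q, q != 0 /\ forall a, a \in enum A -> exists p, tofracK q * v2f v a = tofracK p.
    elim: (enum A) => [|a s [q [q0 IH]]]; first by exists 1; split; [exact: oner_neq0|].
    have [q' [q'0 [p' Ep']]] := den (v2f v a); exists (q * q'); split; first exact: mulf_neq0.
    move=> b; rewrite inE => /predU1P [->|/IH [p Ep]]; rewrite tofracKM.
      by exists (q * p'); rewrite -mulrA Ep' tofracKM.
    by exists (q' * p); rewrite [_ * tofracK q']mulrC -mulrA Ep tofracKM.
  have B : isB (sclR (tofracK q) (v2f v)).
    move=> a; have [p Ep] := Hq a (mem_enum _ a); rewrite ffunE Ep; exact: isBcoef_tofrac.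
  have [_] := HP _ B; rewrite mulRZl -[mulR _ _]/(v2f v * P) -ME vM.
  have -> : v2f 0 = 0 by apply/ffunP => a; rewrite !ffunE mxE.
  rewrite sclR0 => /(_ erefl) Z; apply/rowP => i; rewrite mxE.
  move/ffunP: Z => /(_ (enum_val i)); rewrite !ffunE enum_valK => /eqP.
  by rewrite mulf_eq0 tofracK_eq0 (negPf q0) => /eqP.
(* With trivial kernel the square matrix has full rank, so 1 is a combination of its rows; the
   coefficients form the inverse. *)
have full : row_full M.
  by rewrite row_full_unit -row_free_unit -kermx_eq0; apply/eqP/row_matrixP => i; rewrite row0; apply: inj; rewrite -row_mul mulmx_ker row0.
have /submxP [D ED] := submx_full (\row_j (1 : Rt F 2) (enum_val j)) full.
by exists (v2f D); rewrite -ME -ED; apply/ffunP => a; rewrite ffunE mxE enum_rankK.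
Qed.
End Integral.

(** * The Yang-Baxter identity for beta/(x_i - x_j) *)

(** The shape of beta, with coefficients in the order Delta^00, Delta^10, Delta^01, Delta^11. *)
Definition quad (A : pzRingType) (x y a b c e : A) : A := a + x * b + y * c + x * y * e.

(** The absorption hypotheses write [Bx * By] in two ways, through [Bji] and through [Bij]. The two
    correction terms agree by the quadratic relations on the coefficients, and partial fractions
    combine the two expressions. *)
Lemma divided_YB (A : comPzRingType) (x y z uxy uxz uyz : A)
    (a00 a01 a10 a11 b00 b01 b10 b11 Bji Bij : A) :
  uxy * (x - y) = 1 -> uxz * (x - z) = 1 -> uyz * (y - z) = 1 ->
  let Bx := quad x z a00 a10 a01 a11 in
  let By := quad y z b00 b10 b01 b11 in
  Bx * Bji = Bx * quad y x b00 b10 b01 b11 ->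
  By * Bij = By * quad x y a00 a10 a01 a11 ->
  a00 * b01 = a01 * b00 -> a10 * b01 = a11 * b00 -> a00 * b11 = a01 * b10 ->
  a10 * b11 = a11 * b10 ->
  (uxz * Bx) * (uyz * By) = (uxz * Bx) * ((- uxy) * Bji) + (uyz * By) * (uxy * Bij).
Proof.
move=> Uxy Uxz Uyz Bx By E2 E3 e1 e2 e3 e4.
have G : Bx * (b01 + y * b11) = By * (a01 + x * a11).
  apply/eqP; rewrite -subr_eq0; apply/eqP.
  transitivity ((a00 * b01 - a01 * b00) + x * (a10 * b01 - a11 * b00)
    + y * (a00 * b11 - a01 * b10) + x * y * (a10 * b11 - a11 * b10)); first by rewrite /Bx /By /quad; ring.
  by rewrite e1 e2 e3 e4 !subrr !mulr0 !addr0.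
(* Partial fractions for 1/((x-z)(y-z)). *)
have part : uxz * uyz = uxy * (uyz - uxz).
  transitivity (uxz * uyz * (uxy * (x - y))); first by rewrite Uxy mulr1.
  transitivity (uxy * (uyz * (uxz * (x - z)) - uxz * (uyz * (y - z)))); first by ring.
  by rewrite Uxz Uyz !mulr1.
have F2 : Bx * By = Bx * Bji - (x - z) * (Bx * (b01 + y * b11)) by rewrite E2 /By /quad; ring.
have F3 : Bx * By = By * Bij - (y - z) * (Bx * (b01 + y * b11)) by rewrite E3 G /Bx /quad; ring.
transitivity (uxz * uyz * (Bx * By)); first by ring.
transitivity (uxy * (uyz * (Bx * By) - uxz * (Bx * By))); first by rewrite part; ring.
rewrite {1}F3 F2.
transitivity (uxz * Bx * (- uxy * Bji) + uyz * By * (uxy * Bij) +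
  uxy * (Bx * (b01 + y * b11)) * (uxz * (x - z) - uyz * (y - z))); first by ring.
by rewrite Uxz Uyz subrr mulr0 addr0.
Qed.

Lemma quad_swap (A : comPzRingType) (R : pzRingType) (f : {rmorphism A -> R})
    (u x y a b c e : A) (z z' : R) :
  f a * z = f a * z' -> f b * z = f b * z' -> f c * z = f c * z' -> f e * z = f e * z' ->
  f (u * quad x y a b c e) * z = f (u * quad x y a b c e) * z'.
Proof.
rewrite /quad => Ea Eb Ec Ee; rewrite rmorphM !rmorphD !rmorphM.
by rewrite -!mulrA !mulrDl -!mulrA Ea Eb Ec Ee.
Qed.

Lemma quad_mul_eq (A : comPzRingType) (x y a b c e x' y' a1 b1 c1 e1 a2 b2 c2 e2 : A)
  (K := fun s => [/\ s * a1 = s * a2, s * b1 = s * b2, s * c1 = s * c2 & s * e1 = s * e2]) :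
  [/\ K a, K b, K c & K e] ->
  quad x y a b c e * quad x' y' a1 b1 c1 e1 = quad x y a b c e * quad x' y' a2 b2 c2 e2.
Proof.
move=> [Ka Kb Kc Ke]; have KM s : K s -> s * quad x' y' a1 b1 c1 e1 = s * quad x' y' a2 b2 c2 e2.
  move=> [E1 E2 E3 E4]; rewrite /quad !mulrDr.
  by rewrite !(mulrCA s x') !(mulrCA s (x' * y')) !(mulrCA s y') E1 E2 E3 E4.
by rewrite -[quad x y _ _ _ _]mul1r; apply: (quad_swap (f := idfun)); apply: KM.
Qed.

Lemma quad_anti (A : comPzRingType) (u x y a b c e : A) :
  u * quad x y a b c e + - u * quad y x a b c e = u * (x - y) * (b - c).
Proof. by rewrite /quad; ring. Qed.

Lemma cross_terms (A : comPzRingType) (a a' b b' : A) : b * a' = b * a ->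
  (a + b) * (a' + b') - b * b' = a * (a' + (b + b')).
Proof.
move=> E; transitivity (a * a' + a * b' + b * a'); first by ring.
by rewrite E; ring.
Qed.

Lemma rmorph_quad (A B : pzRingType) (f : {rmorphism A -> B}) (x y a b c e : A) :
  f (quad x y a b c e) = quad (f x) (f y) (f a) (f b) (f c) (f e).
Proof. by rewrite /quad !rmorphD !rmorphM. Qed.

(** * Central elements placed in two slots *)

Section Pairs.
Variables (k : fieldType) (F : falgType k) (d : nat).
Local Notation Z := (Zc F d).
Implicit Types (i j m : 'I_d) (C D : Rt F 2).
Local Notation act := (@Defs.act k F d).

Definition cen2 C := forall f, pure f * C = C * pure f.
Lemma cen2_central C : centralF2 C -> cen2 C.
Proof. by move=> H f; apply: H; exact: isF_pure. Qed.
Lemma cen2_comm C : cen2 C -> forall r, C * r = r * C.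
Proof.
by move=> H r; have := @emb_central k F _ _ id (fun _ _ e => e) C H r; rewrite emb_id.
Qed.
Lemma cen2D C D : cen2 C -> cen2 D -> cen2 (C + D).
Proof. by move=> HC HD f; rewrite mulrDl mulrDr HC HD. Qed.
Lemma cen2N C : cen2 C -> cen2 (- C).
Proof. by move=> HC f; rewrite mulrN mulNr HC. Qed.
Lemma cen2Z c C : cen2 C -> cen2 (sclR c C).
Proof. by move=> HC f; rewrite sclR_mull sclR_mulr HC. Qed.

Lemma pairf_inj i j : i != j -> injective (pairf i j).
Proof.
move=> ij s t; have e2 (u : 'I_2) : u = i0 \/ u = i1.
  by case: u => [[|[|u]] hu] //; [left|right]; apply: val_inj.
have ji : j != i by rewrite eq_sym.
by case: (e2 s) => ->; case: (e2 t) => -> //; rewrite /pairf /= => E; move: ij ji; rewrite E eqxx.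
Qed.
Lemma pairf_comp (n : nat) (h : 'I_d -> 'I_n) i j : h \o pairf i j =1 pairf (h i) (h j).
Proof. by move=> s; rewrite /= /pairf; case: ifP. Qed.

Definition pz i j C : Z := toZ (emb (pairf i j) C).
Lemma zv_pz i j C : i != j -> cen2 C -> zv (pz i j C) = emb (pairf i j) C.
Proof. by move=> ij HC; apply: toZK; apply: emb_central => //; exact: pairf_inj. Qed.
Lemma actz_pz g i j C : i != j -> cen2 C -> actz g (pz i j C) = pz (g i) (g j) C.
Proof.
move=> ij HC; apply: zv_inj; rewrite zv_actz !zv_pz ?(inj_eq perm_inj) // /Defs.act.
rewrite emb_comp; [|exact: pairf_inj|exact: perm_inj].
by apply: eq_emb; exact: pairf_comp.
Qed.

Definition X i : Z := sclZ F (varK k i).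
Definition U i j : Z := sclZ F (varK k i - varK k j)^-1.
Lemma varKB_neq0 i j : i != j -> varK k i - varK k j != 0.
Proof.
move=> ij; rewrite -tofracKB tofracK_eq0 subr_eq0; apply: contra ij => /eqP /(congr1 (mcoeff U_(i))).
by rewrite !mcoeffXU eqxx eq_sym; case: eqP => // _ /eqP; rewrite oner_eq0.
Qed.
Lemma UX i j : i != j -> U i j * (X i - X j) = 1.
Proof.
by move=> ij; rewrite /U /X -sclZB -sclZM mulVf ?sclZ1 // varKB_neq0.
Qed.
Lemma UN i j : U j i = - U i j.
Proof. by rewrite /U -sclZN -invrN opprB. Qed.
Lemma actz_X g i : actz g (X i) = X (g i).
Proof. by rewrite /X actz_sclZ renK_var //; exact: perm_inj. Qed.
Lemma actz_U g i j : actz g (U i j) = U (g i) (g j).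
Proof.
have gi := @perm_inj _ g.
by rewrite /U actz_sclZ renKV // renKB // !renK_var.
Qed.

Lemma pzD i j C D : i != j -> cen2 C -> cen2 D -> pz i j (C + D) = pz i j C + pz i j D.
Proof.
move=> ij HC HD; apply: zv_inj; rewrite [RHS]zvD !zv_pz //; last exact: cen2D.
by rewrite embD //; exact: pairf_inj.
Qed.
Lemma pzZ i j c C : i != j -> cen2 C -> pz i j (sclR c C) = sclZ F (renK (pairf i j) c) * pz i j C.
Proof.
move=> ij HC; apply: zv_inj; rewrite [RHS]zvM !zv_pz //; last exact: cen2Z.
by rewrite embZ ?zv_sclZ ?sclR1_mul //; exact: pairf_inj.
Qed.
Lemma pzM i j C D : i != j -> cen2 C -> cen2 D -> cen2 (C * D) -> pz i j (C * D) = pz i j C * pz i j D.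
Proof.
move=> ij HC HD HM; apply: zv_inj; rewrite [RHS]zvM !zv_pz //.
by rewrite embM //; exact: pairf_inj.
Qed.
Lemma pzN i j C : i != j -> cen2 C -> pz i j (- C) = - pz i j C.
Proof.
move=> ij HC; have pi := pairf_inj ij.
by rewrite -[in LHS](scl1R C) -sclRNl pzZ // renKN // (renK_cst pi 1) sclZN sclZ1 mulN1r.
Qed.
Lemma pz1 i j : i != j -> pz i j 1 = 1.
Proof.
move=> ij; apply: zv_inj; rewrite [RHS]zv1 zv_pz ?emb1 //; first exact: pairf_inj.
by move=> f; rewrite mulr1 mul1r.
Qed.
Lemma pz_isF i j C : i != j -> cen2 C -> isF C -> isF (zv (pz i j C)).
Proof. by move=> ij HC HF; rewrite zv_pz //; apply: emb_isF => //; exact: pairf_inj. Qed.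

Lemma pz_flip i j C : i != j -> cen2 C -> pz j i C = pz i j (flip C).
Proof.
have si : injective swap2 by case=> [[|[|s]] hs] // [[|[|t]] ht] // _; apply: val_inj.
move=> ij HC; apply: zv_inj; rewrite /pz; congr (zv (toZ _)).
rewrite /flip emb_comp //; last exact: pairf_inj.
by apply: eq_emb => -[[|[|s]] hs].
Qed.

(** For a central weak Frobenius element, Delta (a (x) b) = (a (x) b) Delta = Delta (b (x) a); the
    other slots are not affected. *)
Lemma pz_swap i j D r : i != j -> cen2 D -> weakFrob D -> isF r ->
  zv (pz i j D) * r = zv (pz i j D) * act (tperm i j) r.
Proof.
move=> ij HD [_ HW] Fr; rewrite zv_pz //.
have hi := pairf_inj ij; have ti := @perm_inj _ (tperm i j).
move: r Fr; apply: isF_ind => [|u v Eu Ev|c u E|u].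
- by rewrite /Defs.act emb0.
- by rewrite /Defs.act embD // !mulrDr Eu Ev.
- by rewrite /Defs.act embZ // renK_cst // !sclR_mulr E.
have -> : act (tperm i j) (pure u) = pure (fun a => u (tperm i j a)).
  rewrite /Defs.act emb_pure //; apply: eq_pure => a.
  by rewrite -{1}[a](tpermK i j) extf_in.
rewrite (pure_split hi u) (pure_split hi (fun a => u (tperm i j a))) !mulrA -!embM //.
have -> : outf (pairf i j) (fun a => u (tperm i j a)) = outf (pairf i j) u.
  apply: functional_extensionality => a; rewrite /outf; case: ifPn => // N.
  rewrite tpermD //; apply: contra N => /eqP <-; apply/existsP; [by exists i0|by exists i1].
have pE (f : 'I_2 -> F) : pure f = pure2 (f i0) (f i1).
  apply/ffunP => a; rewrite !ffunE big_ord_recl big_ord1; congr (cstK _ (_ * coord _ (a _) (f _))); exact: val_inj.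
suff -> : D * pure (u \o pairf i j) = D * pure ((fun a => u (tperm i j a)) \o pairf i j) by [].
by rewrite -[LHS]HD !pE /= [LHS]HW /pairf /= tpermL tpermR.
Qed.
End Pairs.

(** * The datum of a wreath product of polynomial type *)

Section Concrete.
Variables (k : fieldType) (F : falgType k) (laurent : bool) (d : nat).
Variables (Rr alpha D00 D01 D10 D11 : Rt F 2).
Hypothesis Hpt : poly_type Rr D00 D01 D10 D11.
Hypothesis HC1 : C1 Rr alpha D01 D10.
Hypothesis HC2 : C2 alpha D00 D01 D10 D11.
Local Notation Z := (Zc F d).
Local Notation P := (PP alpha D00 D01 D10 D11).
Hypothesis HC3 : C3 laurent P.
Implicit Types (i j m : 'I_d) (C D : Rt F 2).
Local Notation act := (@Defs.act k F d).
Local Notation X := (@X k F d).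
Local Notation U := (@U k F d).
Local Notation pz := (@pz k F d).
Let WF C := [/\ cen2 C, WS2 C & isF C].

Lemma WF00 : WF D00.
Proof. by case: Hpt HC2 => _ _ _ [H _ _ _] _ [_ /cen2_central]; split=> //; case: H => -[]. Qed.
Lemma WF01 : WF D01.
Proof. by case: Hpt HC2 => _ _ _ [_ H _ _] _ [_ _ /cen2_central]; split=> //; case: H => -[]. Qed.
Lemma WF10 : WF D10.
Proof. by case: Hpt HC2 => _ _ _ [_ _ H _] _ [_ _ _ /cen2_central]; split=> //; case: H => -[]. Qed.
Lemma WF11 : WF D11.
Proof. by case: Hpt HC2 => _ _ _ [_ _ _ H] _ [_ _ _ _ /cen2_central]; split=> //; case: H => -[]. Qed.
Lemma cen_alpha : cen2 alpha. Proof. by case: HC2 => /cen2_central. Qed.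
Let c00 := let: And3 c _ _ := WF00 in c.
Let c01 := let: And3 c _ _ := WF01 in c.
Let c10 := let: And3 c _ _ := WF10 in c.
Let c11 := let: And3 c _ _ := WF11 in c.

Lemma cen_beta : cen2 (betaP D00 D01 D10 D11).
Proof. exact: cen2D (cen2D (cen2D c00 (cen2Z _ c10)) (cen2Z _ c01)) (cen2Z _ c11). Qed.
Lemma cen_P : cen2 P.
Proof. by apply: cen2D; [exact/cen2Z/cen_alpha|exact: cen_beta]. Qed.

Lemma Pinv_ex : exists Q : Rt F 2, P * Q = 1 /\ cen2 Q.
Proof.
have [Q QP] := nzd_inv HC3; have PQ : P * Q = 1 by rewrite (cen2_comm cen_P).
exists Q; split=> // f.
by rewrite -[LHS]mul1r -QP -mulrA [P * _]mulrA (cen2_comm cen_P) -!mulrA PQ mulr1.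
Qed.
Definition Pinv : Rt F 2 := sval (constructive_indefinite_description _ Pinv_ex).
Lemma P_Pinv : P * Pinv = 1.
Proof. by rewrite /Pinv; case: constructive_indefinite_description => Q []. Qed.
Lemma cen_Pinv : cen2 Pinv.
Proof. by rewrite /Pinv; case: constructive_indefinite_description => Q []. Qed.

Definition cbt i j : Z :=
  U i j * quad (X i) (X j) (pz i j D00) (pz i j D10) (pz i j D01) (pz i j D11).
Definition cal i j : Z := pz i j alpha.
Definition cth i j : Z := U i j * pz i j P.
Definition cthv i j : Z := (X i - X j) * pz i j Pinv.

Lemma pz_beta i j : i != j -> pz i j (betaP D00 D01 D10 D11) =
  quad (X i) (X j) (pz i j D00) (pz i j D10) (pz i j D01) (pz i j D11).
Proof.
move=> ij; have pi := pairf_inj ij.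
have C1' := cen2Z (@varK k 2 i0) c10; have C2' := cen2Z (@varK k 2 i1) c01.
have C3' := cen2Z (@varK k 2 i0 * varK k i1) c11.
have S2 := cen2D c00 C1'; have S3 := cen2D S2 C2'.
rewrite /betaP (pzD ij S3 C3') (pzD ij S2 C2') (pzD ij c00 C1').
by rewrite !pzZ // renKM // !renK_var // sclZM.
Qed.

Lemma cthE i j : i != j -> cth i j = cal i j + cbt i j.
Proof.
move=> ij; have pi := pairf_inj ij; have H := cen2Z (varK k i0 - varK k i1) cen_alpha.
rewrite /cth /PP pzD //; last exact: cen_beta.
rewrite pz_beta // mulrDr; congr (_ + _).
rewrite pzZ //; last exact: cen_alpha.
by rewrite renKB // !renK_var // sclZB mulrA (UX F ij) mul1r.
Qed.

Lemma cthK i j : i != j -> cth i j * cthv i j = 1.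
Proof.
move=> ij; rewrite /cth /cthv mulrACA (UX F ij) mul1r -pzM //; first by rewrite P_Pinv pz1.
- exact: cen_P.
- exact: cen_Pinv.
by rewrite P_Pinv => f; rewrite mulr1 mul1r.
Qed.

Lemma act_cal (g : 'S_d) i j : i != j -> actz g (cal i j) = cal (g i) (g j).
Proof. by move=> ij; rewrite /cal actz_pz //; exact: cen_alpha. Qed.
Lemma act_cbt (g : 'S_d) i j : i != j -> actz g (cbt i j) = cbt (g i) (g j).
Proof.
move=> ij; rewrite /cbt actz_mul actz_U (rmorph_quad (actz g)) /= !actz_X !actz_pz //.
Qed.

Lemma pz_sym i j C : i != j -> WF C -> pz j i C = pz i j C.
Proof. by move=> ij [H [_ E] _]; rewrite pz_flip // E. Qed.

Let isC (z : Z) := isF (zv z).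
Let isBt := @isB k F laurent d.

Lemma cbt_swap r i j : isF r -> i != j ->
  zv (cbt i j) * r = zv (cbt i j) * act (tperm i j) r.
Proof.
move=> Fc ij.
have sw C : WF C -> zv (pz i j C) * r = zv (pz i j C) * act (tperm i j) r.
  by move=> [H [W _] _]; exact: pz_swap.
by apply: quad_swap; apply: sw; [exact: WF00|exact: WF10|exact: WF01|exact: WF11].
Qed.

Lemma cswap c i j : isC c -> i != j -> cbt i j * c = cbt i j * actz (tperm i j) c.
Proof.
by move=> Fc ij; apply: zv_inj; rewrite [LHS]zvM [RHS]zvM zv_actz; exact: cbt_swap.
Qed.

(** The symmetric terms of beta cancel, and x_i - x_j factors out of the others. *)
Lemma cst_SP i j : i != j -> cbt i j + cbt j i = pz i j (SP D01 D10).
Proof.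
move=> ij; rewrite /SP (pzD ij c10 (cen2N c01)) (pzN ij c01) /cbt (UN F i j).
rewrite (pz_sym ij WF00) (pz_sym ij WF01) (pz_sym ij WF10) (pz_sym ij WF11).
by rewrite quad_anti (UX F ij) mul1r.
Qed.

Lemma cisC_st i j : i != j -> isC (cbt i j + cbt j i).
Proof.
move=> ij; rewrite cst_SP //; apply: pz_isF => //; first exact: cen2D c10 (cen2N c01).
by apply: isFD; [case: WF10|apply: isFN; case: WF01].
Qed.

Lemma cisC_al i j : i != j -> isC (cal i j).
Proof. by move=> ij; apply: pz_isF => //; [exact: cen_alpha|case: HC1]. Qed.

(** The expression is R_ij: expanding theta = alpha + beta/(x_i-x_j), absorption turns the cross
    terms into alpha bar alpha, which is R by (C1). *)
Lemma cisC_rr i j : i != j -> isC (cth i j * cth j i - cbt i j * cbt j i).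
Proof.
move=> ij; have ji : j != i by rewrite eq_sym.
have Rc : cen2 Rr by case: Hpt => _ /cen2_central.
suff -> : cth i j * cth j i - cbt i j * cbt j i = pz i j Rr.
  by apply: pz_isF => //; case: Hpt.
have sw : cbt i j * cal j i = cbt i j * cal i j.
  by rewrite (cswap (cisC_al ji)) // act_cal // tpermL tpermR.
have flc : cal j i = pz i j (flip alpha) by rewrite /cal pz_flip //; exact: cen_alpha.
have cfl : cen2 (flip alpha).
  have si : injective swap2 by case=> [[|[|s]] hs] // [[|[|t]] ht] // _; apply: val_inj.
  by move=> f; rewrite [RHS](emb_central si cen_alpha).
have cS : cen2 (SP D01 D10) := cen2D c10 (cen2N c01).
have ER : alpha * (flip alpha + SP D01 D10) = Rr by case: HC1.
have E : pz i j Rr = cal i j * (cal j i + (cbt i j + cbt j i)).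
  have cM : cen2 (alpha * (flip alpha + SP D01 D10)) by rewrite ER.
  by rewrite cst_SP // flc -(pzD ij cfl cS) -(pzM ij cen_alpha (cen2D cfl cS) cM) ER.
by rewrite E !cthE //; apply: cross_terms.
Qed.

(** C in the slots i, m absorbs the transposition (i m), which moves the second factor from slot m
    to slot i. *)
Lemma pz_slide i j m C D : i != j -> i != m -> j != m -> WF C -> WF D ->
  pz i m C * pz j m D = pz i m C * pz j i D.
Proof.
move=> ij im jm [HC [W _] _] [HD _ FD].
have jm' : m != j by rewrite eq_sym.
apply: zv_inj; rewrite [LHS]zvM [RHS]zvM (pz_swap im HC W (pz_isF jm HD FD)) -zv_actz.
by rewrite (actz_pz _ jm HD) tpermR tpermD.

Qed.

(** Sliding puts D into the slots i, j on both sides; there it absorbs (i j), which exchanges the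
    two positions of C. *)
Lemma pz_T i j m C D : i != j -> i != m -> j != m -> WF C -> WF D ->
  pz i m C * pz j m D = pz i m D * pz j m C.
Proof.
move=> ij im jm WC WD; have ji : j != i by rewrite eq_sym.
rewrite (pz_slide ij im jm WC WD) (mulrC (pz i m D)) (pz_slide ji jm im WC WD) (pz_sym ij WD).
rewrite !(mulrC _ (pz i j D)); case: WD WC => [HD [W _] _] [HC _ FC].
apply: zv_inj; rewrite [LHS]zvM [RHS]zvM (pz_swap ij HD W (pz_isF im HC FC)) -zv_actz.
by rewrite (actz_pz _ im HC) tpermL tpermD.

Qed.

Lemma pz_rel i j m : i != j -> i != m -> j != m -> 
  pz i m D00 * pz j m D11 = pz i m D01 * pz j m D10.
Proof.
move=> ij im jm; have mj : m != j by rewrite eq_sym.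
rewrite -(pz_sym jm WF11) -(pz_sym jm WF10).
(* The three-slot relation shares its middle slot, which must become [m]. *)
pose h (t : 'I_3) : 'I_d := if t == 0 :> nat then i else if t == 1 :> nat then m else j.
have hi : injective h.
  move=> [[|[|[|s]]] hs] // [[|[|[|t]]] ht] //; rewrite /h /= => E; apply: val_inj => //=;
    by move: ij im jm; rewrite ?E ?eqxx // -?E ?eqxx.
have Hrel : emb h01 D00 * emb h12 D11 = emb h01 D01 * emb h12 D10 by case: Hpt.
have h1i : injective h01 by move=> [s hs] [t ht] [E]; apply: val_inj.
have h2i : injective h12 by exact: lift_inj.
have e1 : h \o h01 =1 pairf i m by case=> [[|[|s]] hs].
have e2 : h \o h12 =1 pairf m j by case=> [[|[|s]] hs].
apply: zv_inj; rewrite [LHS]zvM [RHS]zvM (zv_pz im c00) (zv_pz mj c11) (zv_pz im c01) (zv_pz mj c10).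
rewrite -(eq_emb _ e1) -(eq_emb _ e2) -(eq_emb _ e1) -(eq_emb _ e2).
rewrite -(emb_comp D00 h1i hi) -(emb_comp D11 h2i hi) -(emb_comp D01 h1i hi) -(emb_comp D10 h2i hi).
by rewrite -[LHS](embM hi) -[RHS](embM hi) Hrel.
Qed.

Lemma cbtYB i j m : i != j -> i != m -> j != m ->
  cbt i m * cbt j m = cbt i m * cbt j i + cbt j m * cbt i j.
Proof.
move=> ij im jm; have ji : j != i by rewrite eq_sym.
have H1 C D : WF C -> WF D -> pz i m C * pz j i D = pz i m C * pz j m D.
  by move=> WC WD; rewrite (pz_slide ij im jm WC WD).
have H2 C D : WF C -> WF D -> pz j m C * pz i j D = pz j m C * pz i m D.
  by move=> WC WD; rewrite (pz_slide ji jm im WC WD).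
have [w00 w01 w10 w11] := And4 WF00 WF01 WF10 WF11.
rewrite /cbt (UN F i j); apply: divided_YB; [exact: UX|exact: UX|exact: UX|..].
- by apply: quad_mul_eq; split; split; apply: H1.
- by apply: quad_mul_eq; split; split; apply: H2.
- exact: pz_T ij im jm WF00 WF01.
- rewrite (pz_T ij im jm WF10 WF01) -(pz_rel ij im jm); exact: pz_T ij im jm WF00 WF11.
- exact: pz_rel ij im jm.
exact: pz_T ij im jm WF10 WF11.
Qed.

(** In a basis expansion the basis tensors are constants, absorbed by beta; what remains is the
    divided difference of each coefficient times beta. *)
Lemma cisBt_rho r i j : isBt r -> i != j ->
  isBt (zv (cbt i j) * r - act (tperm i j) r * zv (cbt i j)).
Proof.
move=> Br ij; have ti := @perm_inj _ (tperm i j).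
pose bb := emb (pairf i j) (betaP D00 D01 D10 D11); pose u := (varK k i - varK k j)^-1.
have Eb : zv (cbt i j) = sclR u bb.
  rewrite /cbt -pz_beta // [LHS]zvM zv_sclZ sclR1_mul (zv_pz ij); [by []|exact: cen_beta].
have Bbb : isBt bb.
  have vB m : isBcoef laurent (@varK k d m) by exact: isBcoef_tofrac.
  have dB C : WF C -> isBt (emb (pairf i j) C).
    by move=> [_ _ H]; apply: isB_isF; apply: emb_isF => //; exact: pairf_inj.
  have pi := pairf_inj ij; rewrite /bb /betaP !embD // !embZ // renKM // !renK_var // /pairf /=.
  apply: isB_D; [apply: isB_D; [apply: isB_D|]|]; try (apply: isB_Z); try (apply: dB).
  - exact: WF00.
  - exact: vB.
  - exact: WF10.
  - exact: vB.
  - exact: WF01.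
  - apply: isBcoefM; exact: vB.
  exact: WF11.
have key a : zv (cbt i j) * sclR (r a) (ebas a) - act (tperm i j) (sclR (r a) (ebas a)) * zv (cbt i j)
    = sclR ((r a - renK (tperm i j) (r a)) / (varK k i - varK k j)) (bb * ebas a).
  rewrite -zv_comm pactZ !sclR_mulr -(cbt_swap (isF_pure _) ij) Eb.
  by rewrite -sclRNl -sclRDl sclR_mull sclRA.
rewrite [r]Rt_sumE mulr_sumr pact_sum mulr_suml -sumrB.
apply: isB_sum => a; rewrite key; apply: isB_Z; first exact: isBcoef_tperm.
by apply: isB_M => //; apply: isB_isF; exact: isF_pure.
Qed.

(** Kept transparent: later steps identify its rings and actions with the concrete ones by
    conversion. *)
Definition cdatum : datum d.
Proof.
refine (@Datum d k (Zc F d) (Rt F d) (@kZ k F d) (@zv k F d)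
  (fun g => @actz k F d g) (fun g => @Defs.act k F d g) cth cthv cal cbt isC isBt
  (@zv_comm k F d) _ (@pact1 k F d) (@pactM k F d) (@actz1 k F d) (@actzM k F d)
  (@actz_kZ k F d) cthK cthE act_cal act_cbt _ _ _ _ _ _ cswap cisC_al cisC_st cisC_rr cbtYB cisBt_rho).
- by move=> g z; rewrite [RHS]zv_actz.
- by move=> c H; apply: isB_isF.
- by move=> g c H; rewrite /isC zv_actz; apply: emb_isF => //; exact: perm_inj.
- by move=> c; rewrite /isC zv_kZ; apply: isF_scl.
- by move=> g r; exact: isB_act.
- by move=> r s; exact: isB_D.
- by move=> r s; exact: isB_M.
Defined.
End Concrete.

(** * Removing the twist *)

Section Twist.
Variables (k : fieldType) (F : falgType k) (laurent : bool) (d : nat).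
Variables (Rr alpha D00 D01 D10 D11 : Rt F 2).
Hypothesis Hpt : poly_type Rr D00 D01 D10 D11.
Hypothesis HC1 : C1 Rr alpha D01 D10.
Hypothesis HC2 : C2 alpha D00 D01 D10 D11.
Local Notation Z := (Zc F d).
Local Notation P := (PP alpha D00 D01 D10 D11).
Hypothesis HC3 : C3 laurent P.
Implicit Types (y : Y d).
Local Notation X := (@X k F d).
Local Notation pz := (@pz k F d).
Local Notation thd := (@cth k F d alpha D00 D01 D10 D11).
Local Notation eY := (@eY k F d P).

Definition eZ y : Z := \prod_(p : 'I_d * 'I_d | p.1 != p.2)
  (if lt y p.1 p.2 then X p.1 - X p.2 else pz p.1 p.2 P).

(** Reindexing the product by the representative shows that the twist depends on the preorder
    alone. *)
Lemma eY_eZ y : eY y = zv (eZ y).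
Proof.
have cP := cen_P Hpt HC2.
pose fz D (p : 'I_d * 'I_d) : Z := if crossN D p.1 p.2 then X p.1 - X p.2 else pz p.1 p.2 P.
have Ee D : elam P D = zv (\prod_(p : 'I_d * 'I_d | p.1 != p.2) fz D p).
  rewrite zv_prod; apply: eq_bigr => p Np; rewrite /fz.
  case: ifP => _; last by rewrite zv_pz.
  by rewrite /X -sclZB zv_sclZ.
rewrite /Defs.eY Ee -zv_actz actz_prod; congr zv.
pose h (p : 'I_d * 'I_d) := (rep y p.1, rep y p.2).
have hi : injective h by move=> [a b] [a' b'] [/perm_inj -> /perm_inj ->].
rewrite /eZ [RHS](reindex_inj hi); apply: eq_big => [p|p Np]; first by rewrite (inj_eq perm_inj).
by rewrite lt_rep /= !permK /fz; case: ifP => _; rewrite ?actz_pz // actzB !actz_X.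
Qed.

Lemma eZ_unit y : exists z, eZ y * z = 1.
Proof.
pose iz (p : 'I_d * 'I_d) : Z := if lt y p.1 p.2 then U F p.1 p.2 else pz p.1 p.2 (Pinv Hpt HC2 HC3).
exists (\prod_(p : 'I_d * 'I_d | p.1 != p.2) iz p); rewrite -big_split big1 // => p Np /=.
have cP := cen_P Hpt HC2; have cQ := cen_Pinv Hpt HC2 HC3; have PQ := P_Pinv Hpt HC2 HC3.
rewrite /iz; case: ifP => _; first by rewrite mulrC UX.
rewrite -pzM // ?PQ ?pz1 // => f; by rewrite mulr1 mul1r.
Qed.

Lemma eY_comm y r : eY y * r = r * eY y.
Proof. by rewrite eY_eZ zv_comm. Qed.

Lemma eY_inv y : eY y * invR (eY y) = 1 /\ invR (eY y) * eY y = 1.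
Proof.
have [z Ez] := eZ_unit y.
suff : exists g, mulR (eY y) g = oneR F d /\ mulR g (eY y) = oneR F d by apply: epsilon_spec.
have E : eY y * zv z = 1 by rewrite eY_eZ -zvM Ez zv1.
by exists (zv z); split; [exact: E|exact: etrans (esym (eY_comm y (zv z))) E].
Qed.

(** The origin of Theta: coarsening turns a factor x_i - x_j of the twist into P_ij for each pair
    that becomes tied. *)
Lemma eZ_thet y y' : crs y y' ->
  eZ y * \prod_(p : 'I_d * 'I_d | lt y p.1 p.2 && ~~ lt y' p.1 p.2) thd p.1 p.2 = eZ y'.
Proof.
move=> yy'; rewrite /eZ.
rewrite (big_mkcond (fun p => lt y p.1 p.2 && _)) (big_mkcond (fun p => p.1 != p.2)) /=.
rewrite [RHS]big_mkcond -big_split; apply: eq_bigr => -[i j] _ /=.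
have [->|ij] := eqVneq i j; first by rewrite !lt_irr mulr1.
case: (boolP (lt y' i j)) => y'ij; first by rewrite (yy' _ _ y'ij) mulr1.
case: (lt y i j); last by rewrite mulr1.
by rewrite /cth mulrA (mulrC (X i - X j)) UX // mul1r.
Qed.
End Twist.

(** * Transport to the twisted convolution algebra *)

Section Transport.
Variables (k : fieldType) (F : falgType k) (laurent : bool) (d' : nat).
Variables (Rr alpha D00 D01 D10 D11 : Rt F 2).
Hypothesis Hpt : poly_type Rr D00 D01 D10 D11.
Hypothesis HC1 : C1 Rr alpha D01 D10.
Hypothesis HC2 : C2 alpha D00 D01 D10 D11.
Local Notation d := d'.+1.
Local Notation P := (PP alpha D00 D01 D10 D11).
Hypothesis HC3 : C3 laurent P.
Implicit Types (x y z : Y d) (f g : Fun F d) (lam nu : {set 'I_d}).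
Local Notation R := (Rt F d).
Local Notation eY := (@eY k F d P).
Local Notation conv := (@conv k F d P).
Local Notation om := (omegaD d).
Local Notation S := (cdatum d Hpt HC1 HC2 HC3).

Let eK y : eY y * invR (eY y) = 1. Proof. by case: (eY_inv Hpt HC2 HC3 y). Qed.
Let eVK y : invR (eY y) * eY y = 1. Proof. by case: (eY_inv Hpt HC2 HC3 y). Qed.
(* Dividing the rows by the twist turns twisted convolution into the matrix product. *)
Definition tomx f : Mx d (dR S) := mk (fun x y => invR (eY x) * f x y).
Definition ofmx (A : Mx d (dR S)) : Fun F d := fun x y => eY x * ent A x y.

Lemma ent_tomx f x y : ent (tomx f) x y = invR (eY x) * f x y.
Proof. exact: ent_mk. Qed.
Lemma tomxK f : ofmx (tomx f) = f.
Proof.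
apply: functional_extensionality => x; apply: functional_extensionality => y.
by rewrite /ofmx ent_tomx mulrA eK mul1r.
Qed.
Lemma ofmxK (A : Mx d (dR S)) : tomx (ofmx A) = A.
Proof. by apply: entP => x y; rewrite ent_tomx [_ * _]mulrA eVK [LHS]mul1r. Qed.
Lemma tomx_inj f g : tomx f = tomx g -> f = g.
Proof. by move=> E; rewrite -(tomxK f) E tomxK. Qed.

Lemma tomx_conv f g : tomx (conv f g) = tomx f * tomx g.
Proof.
apply: entP => x y; rewrite entM ent_tomx /Defs.conv mulr_sumr; apply: eq_bigr => z _.
rewrite !ent_tomx; exact: (etrans (congr1 _ (esym (mulrA _ _ _))) (mulrA _ _ _)).
Qed.
Lemma tomx_add f g : tomx (addF f g) = tomx f + tomx g.
Proof. by apply: entP => x y; rewrite entD !ent_tomx -[RHS]mulrDr. Qed.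
Lemma tomx_zero : tomx (@zeroF k F d) = 0.
Proof. by apply: entP => x y; rewrite ent0 ent_tomx mulr0. Qed.
Lemma tomx_scl c f : tomx (sclF c f) = @io _ S (@kz _ S c) *: tomx f.
Proof.
apply: entP => x y; rewrite entZ !ent_tomx; transitivity (zv (kZ F d c) * (invR (eY x) * f x y)) => //.
by rewrite zv_kZ sclR1_mul /sclF sclR_mulr.
Qed.
Lemma tomx_sum (Q : pred {set 'I_d}) (f : {set 'I_d} -> Fun F d) :
  tomx (\big[@addF k F d/@zeroF k F d]_(lam : {set 'I_d} | Q lam) f lam) = \sum_(lam : {set 'I_d} | Q lam) tomx (f lam).
Proof. exact: (big_morph _ tomx_add tomx_zero). Qed.

Lemma tomx_M lam nu : tomx (Mln P lam nu) = MR S lam nu.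
Proof.
apply: entP => y' y; rewrite ent_tomx ent_MR1 /Mln.
by case: ifP => _; [rewrite eVK|rewrite mulr0].
Qed.
Lemma tomx_S nu lam : refines nu lam -> tomx (Snl P nu lam) = SR S nu lam.
Proof.
move=> [_ vl lamnu]; apply: entP => y y'; rewrite ent_tomx ent_SR1 /Snl.
case: ifP => [/and3P [/eqP Ey _ /eqP E]|_]; last by rewrite mulr0.
have yy' : crs y y' by rewrite -E; apply: proj_crs; rewrite ?Ey.
have := congr1 (@zv k F d) (eZ_thet alpha D00 D01 D10 D11 yy').
rewrite zvM -(eY_eZ Hpt HC2 y) -(eY_eZ Hpt HC2 y') => <-.
by rewrite [LHS]mulrA eVK [LHS]mul1r.
Qed.
Lemma tomx_t lam t : tomx (tlam P lam t) = @TR d' S lam t.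
Proof.
apply: entP => y y'; rewrite ent_tomx ent_TR1 /tlam.
case: ifP => _; last by rewrite mulr0.
by rewrite [LHS]mulrA eVK [LHS]mul1r.
Qed.
Lemma tomx_xi t : tomx (xi1 P t) = @DR d' S t.
Proof.
apply: entP => y y'; rewrite ent_tomx ent_DR1 /xi1 (eq_sym y').
case: ifP => _; last by rewrite mulr0.
by rewrite [LHS]mulrA eVK [LHS]mul1r.
Qed.
Lemma tomx_one : tomx (oneOmega P) = @DR d' S 1.
Proof.
apply: entP => y y'; rewrite ent_tomx ent_DR1 /oneOmega.
case: ifP => _; last by rewrite mulr0.
exact: etrans (eVK y) (esym (pact_1 F (rep y))).
Qed.

Lemma Gen_GenM (G : Fun F d -> Prop) (Gm : Mx d (dR S) -> Prop) :
  (forall f, G f -> Gm (tomx f)) -> (forall A, Gm A -> G (ofmx A)) ->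
  forall f, Gen P G f <-> GenM Gm (tomx f).
Proof.
move=> HG HGm; split.
  elim=> {f} [f /HG|| f g _ Hf _ Hg|c f _ Hf|f g _ Hf _ Hg].
  - exact: GenM_gen.
  - rewrite tomx_zero; exact: GenM_zero.
  - rewrite tomx_add; exact: GenM_add.
  - rewrite tomx_scl; exact: GenM_scl.
  - rewrite tomx_conv; exact: GenM_mul.
rewrite -[f in Gen P G f]tomxK; elim=> {f} [A /HGm||A B _ HA _ HB|c A _ HA|A B _ HA _ HB].
- exact: Gen_gen.
- rewrite -tomx_zero tomxK; exact: Gen_zero.
- rewrite -(ofmxK A) -(ofmxK B) -tomx_add tomxK; exact: Gen_add.
- rewrite -(ofmxK A) -tomx_scl tomxK; exact: Gen_scl.
- rewrite -(ofmxK A) -(ofmxK B) -tomx_conv tomxK; exact: Gen_mul.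
Qed.

Lemma tomx_K lam : validD lam -> tomx (Klam P lam) = KR S lam.
Proof.
by move=> vl; rewrite tomx_conv tomx_M (tomx_S (omega_refines vl)) KR_SM.
Qed.

Lemma HT_HTm f : HT laurent P f <-> HTm (tomx f).
Proof.
apply: Gen_GenM => [{}f [[lam [vl ->]]|[t [Bt ->]]]|A [[lam [vl ->]]|[t [Bt ->]]]].
- by left; exists lam; rewrite tomx_K.
- by right; exists t; rewrite tomx_xi.
- by left; exists lam; rewrite -tomx_K // tomxK.
- by right; exists t; rewrite -tomx_xi tomxK.
Qed.

Lemma SBLM_Sm f : SBLM laurent P f <-> Sm (tomx f).
Proof.
apply: Gen_GenM => [{}f [[nu [lam [r ->]]]|[[nu [lam [r ->]]]|[lam [t [vl Bt It ->]]]]]|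
  A [[nu [lam [r ->]]]|[[nu [lam [r ->]]]|[lam [t [vl Bt It ->]]]]]].
- by left; exists nu, lam; rewrite tomx_S.
- by right; left; exists nu, lam; rewrite tomx_M.
- by right; right; exists lam, t; rewrite tomx_t.
- by left; exists nu, lam; rewrite -tomx_S // tomxK.
- by right; left; exists nu, lam; rewrite -tomx_M tomxK.
- by right; right; exists lam, t; rewrite -tomx_t tomxK.
Qed.

Lemma CT_CTm f : CT laurent P f <-> CTm (tomx f).
Proof.
split=> [[hs [Hh ->]]|[hs [Hh E]]].
  exists (fun lam => tomx (hs lam)); split=> [lam /Hh /HT_HTm //|].
  by rewrite tomx_sum; apply: eq_bigr => lam _; rewrite tomx_conv tomx_M.
exists (fun lam => ofmx (hs lam)); split=> [lam /Hh H|].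
  by apply/HT_HTm; rewrite ofmxK.
apply: tomx_inj; rewrite E tomx_sum; apply: eq_bigr => lam _.
by rewrite tomx_conv tomx_M ofmxK.
Qed.

Definition tophi (phi : Fun F d -> Fun F d) (A : Mx d (dR S)) : Mx d (dR S) := tomx (phi (ofmx A)).

Lemma tophiE phi f : tophi phi (tomx f) = tomx (phi f).
Proof. by rewrite /tophi tomxK. Qed.

Lemma forall_tomx (Q : Mx d (dR S) -> Prop) : (forall A, Q A) <-> (forall f, Q (tomx f)).
Proof. by split=> H A //; rewrite -(ofmxK A). Qed.

Lemma EndLeft_EndL phi : EndLeft laurent P (SBLM laurent P) phi <-> EndL (tophi phi).
Proof.
split=> -[HC Hadd Hlin]; split.
- by apply/forall_tomx => f /CT_CTm Cf; rewrite tophiE; apply/CT_CTm/HC.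
- apply/forall_tomx => f; apply/forall_tomx => g /CT_CTm Cf /CT_CTm Cg.
  by rewrite -tomx_add !tophiE Hadd ?tomx_add.
- apply/forall_tomx => f; apply/forall_tomx => g /SBLM_Sm Sf /CT_CTm Cg.
  by rewrite -tomx_conv !tophiE Hlin ?tomx_conv.
- by move=> f /CT_CTm /HC; rewrite tophiE => /CT_CTm.
- move=> f g /CT_CTm Cf /CT_CTm Cg; apply: tomx_inj.
  by rewrite -tophiE !tomx_add Hadd ?tophiE.
- move=> f g /SBLM_Sm Sf /CT_CTm Cg; apply: tomx_inj.
  by rewrite -tophiE !tomx_conv Hlin ?tophiE.
Qed.

Lemma EndRight_EndR phi : EndRight laurent P (HT laurent P) phi <-> EndR (tophi phi).
Proof.
split=> -[HC Hadd Hlin]; split.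
- by apply/forall_tomx => f /CT_CTm Cf; rewrite tophiE; apply/CT_CTm/HC.
- apply/forall_tomx => f; apply/forall_tomx => g /CT_CTm Cf /CT_CTm Cg.
  by rewrite -tomx_add !tophiE Hadd ?tomx_add.
- apply/forall_tomx => f; apply/forall_tomx => g /HT_HTm Hf /CT_CTm Cg.
  by rewrite -tomx_conv !tophiE Hlin ?tomx_conv.
- by move=> f /CT_CTm /HC; rewrite tophiE => /CT_CTm.
- move=> f g /CT_CTm Cf /CT_CTm Cg; apply: tomx_inj.
  by rewrite -tophiE !tomx_add Hadd ?tophiE.
- move=> f g /HT_HTm Hf /CT_CTm Cg; apply: tomx_inj.
  by rewrite -tophiE !tomx_conv Hlin ?tophiE.
Qed.

Lemma double_centralizer :
  [/\ (forall s c, SBLM laurent P s -> CT laurent P c -> CT laurent P (conv s c)),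
      (forall phi, EndLeft laurent P (SBLM laurent P) phi <->
         exists h, HT laurent P h /\ forall c, CT laurent P c -> phi c = conv c h)
      /\ (forall h h', HT laurent P h -> HT laurent P h' ->
         (forall c, CT laurent P c -> conv c h = conv c h') -> h = h'),
      (forall phi, EndRight laurent P (HT laurent P) phi <->
         exists s, SBLM laurent P s /\ forall c, CT laurent P c -> phi c = conv s c)
      /\ (forall s s', SBLM laurent P s -> SBLM laurent P s' ->
         (forall c, CT laurent P c -> conv s c = conv s' c) -> s = s') &
      (forall f, HT laurent P f <->
         exists s, SBLM laurent P s /\ f = conv (conv (oneOmega P) s) (oneOmega P))].
Proof.
split.
- by move=> s c /SBLM_Sm Ss /CT_CTm Cc; apply/CT_CTm; rewrite tomx_conv; apply: CTm_mull.
- split=> [phi|h h' /HT_HTm Hh /HT_HTm Hh' E]; last first.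
    apply: tomx_inj; apply: HTm_faithful => //.
    by apply/forall_tomx => c /CT_CTm Cc; rewrite -!tomx_conv E.
  rewrite EndLeft_EndL EndL_HTm; split=> -[h [Hh E]].
    exists (ofmx h); split=> [|c /CT_CTm Cc]; first by apply/HT_HTm; rewrite ofmxK.
    by apply: tomx_inj; rewrite tomx_conv ofmxK -E // tophiE.
  exists (tomx h); split; first exact/HT_HTm.
  by apply/forall_tomx => c /CT_CTm Cc; rewrite tophiE E // tomx_conv.
- split=> [phi|s s' _ _ E]; last first.
    apply: tomx_inj; apply: Sm_faithful.
    by apply/forall_tomx => c /CT_CTm Cc; rewrite -!tomx_conv E.
  rewrite EndRight_EndR EndR_Sm; split=> -[s [Ss E]].
    exists (ofmx s); split=> [|c /CT_CTm Cc]; first by apply/SBLM_Sm; rewrite ofmxK.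
    by apply: tomx_inj; rewrite tomx_conv ofmxK -E // tophiE.
  exists (tomx s); split; first exact/SBLM_Sm.
  by apply/forall_tomx => c /CT_CTm Cc; rewrite tophiE E // tomx_conv.
move=> f; rewrite HT_HTm HTm_corner; split=> -[s [Ss E]].
  exists (ofmx s); split; first by apply/SBLM_Sm; rewrite ofmxK.
  by apply: tomx_inj; rewrite !tomx_conv tomx_one ofmxK.
by exists (tomx s); split; [exact/SBLM_Sm|rewrite E !tomx_conv tomx_one].
Qed.
End Transport.

Theorem theorem6 (k : fieldType) (F : falgType k) (laurent : bool) (d : nat)
  (Rr alpha D00 D01 D10 D11 : Rt F 2) :
  (2 <= d)%N ->
  poly_type Rr D00 D01 D10 D11 ->
  C1 Rr alpha D01 D10 ->
  C2 alpha D00 D01 D10 D11 ->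
  C3 laurent (PP alpha D00 D01 D10 D11) ->
  let P := PP alpha D00 D01 D10 D11 in
  let CT := @CT k F d laurent P in
  let HT := @HT k F d laurent P in
  let SBLM := @SBLM k F d laurent P in
  let conv := @conv k F d P in
  [/\ (* C^T is stable under left twisted convolution by \bar S^BLM *)
      (forall s c, SBLM s -> CT c -> CT (conv s c)),
      (* End_{\bar S^BLM}(C^T) = B wr H(d)  (= H_d^T acting by right convolution) *)
      (forall phi, EndLeft laurent P SBLM phi <->
                   exists h, HT h /\ forall c, CT c -> phi c = conv c h)
      /\ (forall h h', HT h -> HT h' ->
                   (forall c, CT c -> conv c h = conv c h') -> h = h'),
      (* End_{B wr H(d)}(C^T) = \bar S^BLM  (acting by left convolution) *)
      (forall phi, EndRight laurent P HT phi <->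
                   exists s, SBLM s /\ forall c, CT c -> phi c = conv s c)
      /\ (forall s s', SBLM s -> SBLM s' ->
                   (forall c, CT c -> conv s c = conv s' c) -> s = s') &
      (* B wr H(d) = 1_omega * \bar S^BLM * 1_omega *)
      (forall f, HT f <-> exists s, SBLM s /\ f = conv (conv (oneOmega P) s) (oneOmega P))].
Proof.
case: d => // d' _ Hpt HC1 HC2 HC3; exact: double_centralizer Hpt HC1 HC2 HC3.
Qed.
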